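(* If $p\in[1,\infty)$, then $$\lim_{n\to\infty}n^{-2/p}\,\mathcal{C}\left(\mathcal{P}_{n,1},L_p([-1,1]),I\right)=2^{1/p}\,\mathcal{C}_0\left(E_{1,1}\cap L_{p,|t|}(\mathbb{R}),L_{p,|t|}(\mathbb{R}),I\right).$$
   Context: Sharp constants: for a space $\mathcal{B}\ne\{0\}$ of functions on $\Omega$ lying in a normed function space $F(\Omega)$, a linear operator $D$ on $\mathcal{B}$, and $a\in\Omega$, $$\mathcal{C}_a(\mathcal{B},F(\Omega),D):=\sup_{f\in\mathcal{B}\setminus\{0\}}\frac{|D(f)(a)|}{\|f\|_{F(\Omega)}},\qquad \mathcal{C}(\mathcal{B},F(\Omega),D):=\sup_{f\in\mathcal{B}\setminus\{0\}}\frac{\|D(f)\|_{L_\infty(\Omega)}}{\|f\|_{F(\Omega)}}.$$ $I$ is the identity (imbedding) operator. $\mathcal{P}_{n,1}$ is the set of univariate polynomials with complex coefficients of degree at most $n$, restricted to $[-1,1]$. $E_{1,1}$ is the set of entire functions $f:\mathbb{C}\to\mathbb{C}$ such that for any $\varepsilon>0$ there is a constant $C_0(\varepsilon,f)$ with $|f(z)|\le C_0(\varepsilon,f)\exp((1+\varepsilon)|z|)$, $z\in\mathbb{C}$, identified with their restrictions to $\mathbb{R}$. $L_p([-1,1])$ is the usual complex $L_p$ space, and $\|f\|_{L_{p,|t|}(\mathbb{R})}=\left(\int_{\mathbb{R}}|f(t)|^p|t|\,dt\right)^{1/p}$. *)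

(* Defs.v *)
From HB Require Import structures.
From mathcomp Require Import all_boot all_order all_algebra.
From mathcomp Require Import complex.
From mathcomp Require Import all_classical all_reals all_analysis.

Set Implicit Arguments.
Unset Strict Implicit.
Unset Printing Implicit Defensive.

Import Order.TTheory GRing.Theory Num.Theory.
Import numFieldNormedType.Exports.

Local Open Scope classical_set_scope.
Local Open Scope ring_scope.

Section sharp_constants.
Context {R : realType}.

(* A complex-valued function on a measurable set [Omega] of reals is represented
   by the function [R -> R[i]] extending it by 0 off [Omega], so that equality
   of representatives is equality on [Omega]. *)
Implicit Type f : R -> R[i].

Definition cabs f : R -> \bar R := fun t => (Normc.normc (f t))%:E.

Definition Lnorm_on (Omega : set R) (mOmega : measurable Omega) (q : \bar R) f
    : \bar R :=
  Lnorm (mrestr (@lebesgue_measure R) mOmega) q (cabs f).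

Definition Lnorm_abs_weight (p : R) f : \bar R :=
  ((\int[@lebesgue_measure R]_t
      (Normc.normc (f t) `^ p * `|t|)%:E) `^ p^-1)%E.

(* [N] is the norm of F(Omega). *)
Definition sharp_constant_at (B : set (R -> R[i])) (N : (R -> R[i]) -> \bar R)
    (D : (R -> R[i]) -> (R -> R[i])) (a : R) : \bar R :=
  ereal_sup [set (cabs (D f) a / N f)%E | f in B `\ cst 0].

Definition sharp_constant (Omega : set R) (mOmega : measurable Omega)
    (B : set (R -> R[i])) (N : (R -> R[i]) -> \bar R)
    (D : (R -> R[i]) -> (R -> R[i])) : \bar R :=
  ereal_sup [set (Lnorm_on mOmega +oo (D f) / N f)%E | f in B `\ cst 0].

Definition polys_on_itvN11 (n : nat) : set (R -> R[i]) :=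
  [set patch (cst 0) `[-1, 1] (fun t => q.[t%:C%C])
  | q in [set q : {poly R[i]} | (size q <= n.+1)%N]].

(* [R[i]] is a normed module over itself here: the derivative is complex. *)
Definition entire (g : R[i] -> R[i]) : Prop :=
  forall z : R[i], derivable (g : R[i]^o -> R[i]^o) z 1.

Definition exp_type_le1 : set (R[i] -> R[i]) :=
  [set g | entire g /\
    forall eps : R, 0 < eps -> exists C0 : R, forall z : R[i],
      Normc.normc (g z) <= C0 * expR ((1 + eps) * Normc.normc z)].

Definition E11 : set (R -> R[i]) :=
  [set (fun t : R => g t%:C%C) | g in exp_type_le1].

(* Measurability is omitted: it is automatic on [E11], where this is used. *)
Definition L_abs_weight (p : R) : set (R -> R[i]) :=
  [set f | (Lnorm_abs_weight p f < +oo)%E].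

End sharp_constants.

(* Main.v *)
Require Import Defs.
From HB Require Import structures.
From mathcomp Require Import all_boot all_order all_algebra.
From mathcomp Require Import complex ring lra zify.
From mathcomp Require Import all_classical all_reals all_analysis.
From mathcomp Require Import ess_sup_inf measurable_realfun.

Set Implicit Arguments.
Unset Strict Implicit.
Unset Printing Implicit Defensive.

Import Order.TTheory GRing.Theory Num.Theory.
Import numFieldNormedType.Exports.

Local Open Scope classical_set_scope.
Local Open Scope ring_scope.

(* For one inequality, a generalized (Legendre) translation, which contracts the
   L_p norm and the sup norm, moves the maximum of an extremal polynomial P of degree n
   to the endpoint 1. By V. A. Markov's bound at the endpoint, the Taylor coefficients of
   z |-> P(1 - z^2/(2 n^2)) are at most sup|P| / k!, so these functions have a limit F,
   which is even, entire, bounded by exp|z|, and |F(0)| = 1. The change of variable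
   x = 1 - v^2/(2 n^2) turns dx into the weight v dv, so n^2 |P|_p^p controls half of the
   weighted norm of F.

   Conversely, the even part f of a function of exponential type 1 with finite weighted
   norm is bounded on the real line (by a Nikolskii inequality for polynomial
   approximations), hence |f(x + iy)| <= C exp((1 + eps)|y|) by Phragmen-Lindelof. For
   kappa < 1, f(v) as a function of x = 1 - v^2/(2 (kappa n)^2) is then
   O(exp(omega n)) on a Bernstein ellipse of parameter r^2 with exp(omega) < r^2, so
   truncating Chebyshev expansions gives polynomials of degree n that approximate f
   exponentially well on the whole segment. *)

(** * Complex moduli and derivatives *)

(** The factor n^2 is the resolution of degree n at an endpoint: near 1 the extrema of T_n are at
    distances of order 1/n^2, whereas inside the segment they are of order 1/n apart. This is why
    the limit is taken at 1. The factor 2^(1/p) is the passage from the half-line to the line: an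
    even function has twice the half-line integral.

    Both inequalities are tested on reals strictly below or above the limit. The strict inequality
    leaves slack, which absorbs the loss kappa^-2 of the shrunk frequency and the loss l^(1-p) of
    the convexity inequality that replaces the triangle inequality in L_p.

    Cauchy's estimate and the maximum principle are proved for polynomials, where the mean over a
    circle is an exact finite sum over roots of unity. Entire functions are reached through
    Goursat's theorem: it makes their Fejer means polynomials, which converge uniformly on discs.

    A supremum over an empty set is -oo, so the limit space must be shown to contain a nonzero
    function. One is obtained by applying the compactness argument to polynomials concentrated at an
    endpoint. *)

Local Notation cn := Normc.normc.

Section ComplexNorm.
Context {R : realType}.
Implicit Types z w : R[i].

Lemma cnE z : (cn z)%:C%C = `|z|.
Proof. by case: z => a b; rewrite normc_def. Qed.

Lemma cn_ge0 z : 0 <= cn z.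
Proof. by case: z => a b /=; rewrite sqrtr_ge0. Qed.

Lemma cn0 : cn (0 : R[i]) = 0. Proof. exact: Normc.normc0. Qed.
Lemma cn1 : cn (1 : R[i]) = 1. Proof. exact: Normc.normc1. Qed.
Lemma cnM z w : cn (z * w) = cn z * cn w. Proof. exact: Normc.normcM. Qed.
Lemma cnD z w : cn (z + w) <= cn z + cn w. Proof. exact: le_normcD. Qed.
Lemma cnN z : cn (- z) = cn z. Proof. exact: normcN. Qed.
Lemma cnV z : cn z^-1 = (cn z)^-1. Proof. exact: Normc.normcV. Qed.

Lemma cnBC z w : cn (z - w) = cn (w - z).
Proof. by rewrite -cnN opprB. Qed.

Lemma cnX z n : cn (z ^+ n) = cn z ^+ n.
Proof. by elim: n => [|n IH]; rewrite ?expr0 ?cn1// !exprS cnM IH. Qed.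

Lemma cn_real (x : R) : cn x%:C%C = `|x|.
Proof. by rewrite /= expr0n addr0 sqrtr_sqr. Qed.

Lemma cn_nat n : cn (n%:R : R[i]) = n%:R.
Proof.
rewrite (_ : n%:R = (n%:R : R)%:C%C); first by rewrite cn_real normr_nat.
by rewrite rmorph_nat.
Qed.

Lemma cn_eq0 z : (cn z == 0) = (z == 0).
Proof.
apply/eqP/eqP => [|->]; [exact: Normc.eq0_normc|exact: cn0].
Qed.

Lemma cn_gt0 z : (0 < cn z) = (z != 0).
Proof. by rewrite lt_def cn_eq0 cn_ge0 andbT. Qed.

Lemma cn_sqr z : cn z ^+ 2 = complex.Re z ^+ 2 + complex.Im z ^+ 2.
Proof. by case: z => a b /=; rewrite sqr_sqrtr// addr_ge0 ?sqr_ge0. Qed.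

Lemma cn_Re z : `|complex.Re z| <= cn z.
Proof.
rewrite -(@ler_pXn2r _ 2) ?nnegrE ?cn_ge0// cn_sqr real_normK ?num_real//.
by rewrite lerDl sqr_ge0.
Qed.

Lemma cn_Im z : `|complex.Im z| <= cn z.
Proof.
rewrite -(@ler_pXn2r _ 2) ?nnegrE ?cn_ge0// cn_sqr real_normK ?num_real//.
by rewrite lerDr sqr_ge0.
Qed.

Lemma cn_le_ReIm z : cn z <= `|complex.Re z| + `|complex.Im z|.
Proof.
rewrite -(@ler_pXn2r _ 2) ?nnegrE ?cn_ge0 ?addr_ge0// cn_sqr sqrrD.
rewrite !real_normK ?num_real// addrAC lerDl.
by rewrite mulrn_wge0// mulr_ge0.
Qed.

Lemma cn_conj z : cn z^*%C = cn z.
Proof. by case: z => a b /=; rewrite sqrrN. Qed.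

Lemma cn_sum (I : Type) (r : seq I) (P : pred I) (F : I -> R[i]) :
  cn (\sum_(i <- r | P i) F i) <= \sum_(i <- r | P i) cn (F i).
Proof.
elim/big_ind2: _ => [|x1 x2 y1 y2 h1 h2|i _]; rewrite ?cn0//.
by apply: le_trans (cnD _ _) _; apply: lerD.
Qed.

Lemma cnB_ge z w : cn z - cn w <= cn (z - w).
Proof. by rewrite lerBlDr -{1}(subrK w z) cnD. Qed.

Lemma cn_dist z w : `|cn z - cn w| <= cn (z - w).
Proof. by rewrite ler_norml lerNl opprB cnB_ge (cnBC z) cnB_ge. Qed.

Lemma cn_i : cn ('i%C : R[i]) = 1.
Proof. by rewrite /= expr0n add0r expr1n sqrtr1. Qed.

End ComplexNorm.

Section EntireEpsDelta.
Context {R : realType}.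

(* Real radii: the norm of [R[i]^o] is itself complex-valued. *)
Definition cderiv (g : R[i] -> R[i]) (z d : R[i]) :=
  forall eps : R, 0 < eps -> exists2 delta : R, 0 < delta &
    forall h : R[i], cn h < delta -> cn (g (z + h) - g z - h * d) <= eps * cn h.

Lemma entire_cderiv (g : R[i] -> R[i]) : entire g ->
  forall z, exists d, cderiv g z d.
Proof.
move=> eg z; have /cvg_ex[d /= gd] := eg z.
exists d => eps e0.
have e0' : 0 < eps%:C%C by rewrite ltcR.
have /cvgrPdist_le/(_ _ e0') := gd.
rewrite /dnbhs /= near_withinE => /nbhs_ballP[/= r r0 hr].
have rE : r = (complex.Re r)%:C%C by rewrite RRe_real// gtr0_real.
exists (complex.Re r); first by rewrite -ltcR -rE.
move=> h hlt.
have [->|h0] := eqVneq h 0; first by rewrite addr0 subrr sub0r mul0r oppr0 cn0 mulr0.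
have := hr h; rewrite /ball /= sub0r normrN -cnE rE ltcR => /(_ hlt h0).
rewrite -cnE lecR => H.
have -> : g (z + h) - g z - h * d =
   - (h * (d - h^-1 *: (g (h *: (1 : R[i]^o) + z) - g z))).
  rewrite /GRing.scale /= mulr1 [h + z]addrC mulrBr mulrA divff// mul1r opprB addrC.
  by rewrite addrC.
by rewrite cnN cnM mulrC ler_wpM2r// cn_ge0.
Qed.

Lemma cderiv_entire (g : R[i] -> R[i]) :
  (forall z, exists d, cderiv g z d) -> entire g.
Proof.
move=> eg z; have [d gd] := eg z.
apply/cvg_ex; exists d => /=; apply/cvgrPdist_le => eps e0.
have eE : eps = (complex.Re eps)%:C%C by rewrite RRe_real// gtr0_real.
have e0' : 0 < complex.Re eps by rewrite -ltcR -eE.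
have [r r0 hr] := gd _ e0'.
rewrite /dnbhs /= near_withinE; apply/nbhs_ballP; exists r%:C%C => /=.
  by rewrite ltcR.
move=> h; rewrite /ball /= sub0r normrN -cnE ltcR => /hr H h0.
rewrite -cnE eE lecR.
have -> : d - h^-1 *: (g (h *: (1 : R[i]^o) + z) - g z) =
   - (h^-1 * (g (z + h) - g z - h * d)).
  rewrite /GRing.scale /= mulr1 [h + z]addrC [in RHS]mulrBr mulrA mulVf// mul1r opprB.
  by [].
rewrite cnN cnM cnV mulrC ler_pdivrMr ?cn_gt0//.
Qed.

End EntireEpsDelta.

(** * Integrals over segments *)

Section IntervalIntegral.
Context {R : realType}.
Notation mu := (@lebesgue_measure R).
Implicit Types (f g : R -> R) (a b c : R).

Definition RI f a b : R := (\int[mu]_(x in `[a, b]) f x)%R.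

Lemma cont_integrable f a b : continuous f ->
  mu.-integrable `[a, b] (EFin \o f).
Proof.
move=> cf; apply: continuous_compact_integrable; first exact: segment_compact.
exact: continuous_subspaceT.
Qed.

Lemma RI_EFin f a b : continuous f ->
  (\int[mu]_(x in `[a, b]) (f x)%:E)%E = (RI f a b)%:E.
Proof.
move=> cf; rewrite /RI /Rintegral fineK//.
by apply: integrable_fin_num => //; exact: cont_integrable.
Qed.

Lemma RI_eq f g a b : (forall x, a <= x <= b -> f x = g x) ->
  RI f a b = RI g a b.
Proof.
move=> fg; apply: eq_Rintegral => x /set_mem /=; rewrite in_itv /=; exact: fg.
Qed.

Lemma RI_le f g a b : continuous f -> continuous g ->
  (forall x, a <= x <= b -> f x <= g x) -> RI f a b <= RI g a b.
Proof.
move=> cf cg fg; apply: le_Rintegral => //; exact: cont_integrable.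
Qed.

Lemma RID f g a b : continuous f -> continuous g ->
  RI (fun x => f x + g x) a b = RI f a b + RI g a b.
Proof. by move=> cf cg; apply: RintegralD => //; exact: cont_integrable. Qed.

Lemma RIZ f k a b : continuous f -> RI (fun x => k * f x) a b = k * RI f a b.
Proof. by move=> cf; apply: RintegralZl => //; exact: cont_integrable. Qed.

Lemma RI_cst k a b : a <= b -> RI (fun _ : R => k) a b = k * (b - a).
Proof.
move=> ab; rewrite /RI Rintegral_cst//= lebesgue_measure_itv /= lte_fin.
case: ltP => [_|ba] /=; first by [].
suff -> : b = a by rewrite subrr.
by apply/eqP; rewrite eq_le ab ba.
Qed.

Lemma RI_ge0 f a b : (forall x, a <= x <= b -> 0 <= f x) -> 0 <= RI f a b.
Proof. by move=> f0; apply: Rintegral_ge0 => x /=; rewrite in_itv /=; exact: f0. Qed.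

Lemma RI_split f a b c : continuous f -> a <= b -> b <= c ->
  RI f a c = RI f a b + RI f b c.
Proof.
move=> cf ab bc.
have := @Rintegral_itvB R f (BLeft a) (BRight c) b (@cont_integrable f a c cf).
rewrite !bnd_simp => /(_ ab bc) H.
rewrite /RI -(@Rintegral_itv_obnd_cbnd _ b (BRight c)); last first.
  apply: integrableS (@cont_integrable f b c cf) => //.
  exact: subset_itv_oc_cc.
by rewrite -H addrC subrK.
Qed.

Lemma RI_point f a : RI f a a = 0.
Proof. by rewrite /RI set_itv1 Rintegral_set1. Qed.

Lemma RI_FTC f F a b : a <= b -> continuous f ->
  (forall x, a <= x <= b -> is_derive x 1 F (f x)) ->
  RI f a b = F b - F a.
Proof.
rewrite le_eqVlt => /predU1P[->|ab] cf dF; first by rewrite RI_point subrr.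
have cF x : a <= x <= b -> {for x, continuous F}.
  move=> /dF h; apply/differentiable_continuous/derivable1_diffP.
  exact: (@ex_derive _ _ _ _ _ _ _ h).
apply: EFin_inj; rewrite -RI_EFin// (@continuous_FTC2 _ f F)//.
- exact: continuous_subspaceT.
- split.
  + move=> x /[!in_itv] /andP[ax xb].
    have h := dF x; rewrite !ltW// in h.
    exact: (@ex_derive _ _ _ _ _ _ _ (h isT)).
  + by apply: cvg_at_right_filter; apply: cF; rewrite lexx ltW.
  + by apply: cvg_at_left_filter; apply: cF; rewrite lexx ltW.
- move=> x /[!in_itv] /andP[ax xb].
  have h := dF x; rewrite !ltW// in h.
  by rewrite derive1E; exact: (@derive_val _ _ _ _ _ _ _ (h isT)).
Qed.

Lemma RI_antiderivative f a : continuous f ->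
  forall x, a < x -> is_derive x 1 (RI f a) (f x).
Proof.
move=> cf x ax.
have xx1 : x < x + 1 by rewrite ltrDl.
have [||d1 d2] := @continuous_FTC1 R f (BLeft a) x (x + 1) xx1
   (@cont_integrable f a (x + 1) cf).
- by rewrite lte_fin.
- exact: cf.
exact: (DeriveDef d1 (etrans (esym (derive1E _ _)) d2)).
Qed.

Lemma RI_subst f (h h' : R -> R) a b : a <= b -> continuous f -> continuous h -> continuous h' ->
  (forall x, a <= x <= b -> is_derive x 1 h (h' x)) ->
  (h a <= h b -> RI (fun x => f (h x) * h' x) a b = RI f (h a) (h b)) /\
  (h b <= h a -> RI (fun x => f (h x) * h' x) a b = - RI f (h b) (h a)).
Proof.
move=> ab cf ch ch' dh.
have [m hm] : exists m, forall x, a <= x <= b -> m < h x.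
  have [c _ hc] := @EVT_min R h a b ab (continuous_subspaceT ch).
  by exists (h c - 1) => x xab; rewrite ltrBlDr (le_lt_trans (hc x _))// ltrDl.
pose F := RI f m.
have I1 : RI (fun x => f (h x) * h' x) a b = F (h b) - F (h a).
  apply: (@RI_FTC _ (F \o h)) => //.
    move=> x; apply: continuousM; last exact: ch'.
    by apply: continuous_comp; [exact: ch|exact: cf].
  move=> x xab; apply: is_derive1_comp; last exact: dh.
  by apply: RI_antiderivative => //; exact: hm.
have ma : m <= h a by apply/ltW/hm; rewrite lexx.
have mb : m <= h b by apply/ltW/hm; rewrite lexx andbT.
rewrite I1 /F; split => hab.
  by rewrite (@RI_split f m (h a) (h b))// addrC addKr.
by rewrite (@RI_split f m (h b) (h a))// opprD addrA subrr sub0r.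
Qed.

End IntervalIntegral.

(** * Holomorphic functions and Goursat's theorem *)

Section DyadicDescent.
Context {R : realType}.

(** A rectangle where [P] fails has a failing quarter; the nested failing quarters shrink to a
    point, where the local hypothesis contradicts the failure. This serves Goursat's theorem and
    also replaces compactness for bounds and uniform continuity. *)
Lemma dyadic_descent (P : R -> R -> R -> R -> Prop) :
  (forall x y a b, 0 < a -> 0 < b -> P x y a b -> P (x + a) y a b ->
     P x (y + b) a b -> P (x + a) (y + b) a b -> P x y (a + a) (b + b)) ->
  (forall x y, exists2 delta, 0 < delta & forall x' y' a b, 0 < a < delta ->
     0 < b < delta -> x' <= x <= x' + a -> y' <= y <= y' + b -> P x' y' a b) ->
  forall x y a b, 0 < a -> 0 < b -> P x y a b.
Proof.
move=> Pch Ploc x0 y0 a0 b0 a0_gt0 b0_gt0; apply: contrapT => nP.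
pose ha n := a0 / 2 ^+ n; pose hb n := b0 / 2 ^+ n.
have ha_gt0 n : 0 < ha n by rewrite divr_gt0// exprn_gt0.
have hb_gt0 n : 0 < hb n by rewrite divr_gt0// exprn_gt0.
have haS n : ha n = ha n.+1 + ha n.+1.
  by rewrite /ha exprS invfM mulrA mulrAC -splitr.
have hbS n : hb n = hb n.+1 + hb n.+1.
  by rewrite /hb exprS invfM mulrA mulrAC -splitr.
(* The failure is a premise under the existential, so that [choice] yields a total selection of
   quarters. *)
have step n (s : R * R) : exists s' : R * R,
    ~ P s.1 s.2 (ha n) (hb n) ->
    [/\ ~ P s'.1 s'.2 (ha n.+1) (hb n.+1),
        s.1 <= s'.1 <= s.1 + ha n.+1 & s.2 <= s'.2 <= s.2 + hb n.+1].
  have [Ps|nPs] := pselect (P s.1 s.2 (ha n) (hb n)); first by exists s.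
  have ha0 := ltW (ha_gt0 n.+1); have hb0 := ltW (hb_gt0 n.+1).
  have [P1|nP1] := pselect (P s.1 s.2 (ha n.+1) (hb n.+1)); last first.
    by exists s; split => //=; rewrite ?lexx ?lerDl ?ha0 ?hb0.
  have [P2|nP2] := pselect (P (s.1 + ha n.+1) s.2 (ha n.+1) (hb n.+1)); last first.
    by exists (s.1 + ha n.+1, s.2); split => //=; rewrite ?lexx ?lerDl ?ha0 ?hb0.
  have [P3|nP3] := pselect (P s.1 (s.2 + hb n.+1) (ha n.+1) (hb n.+1)); last first.
    by exists (s.1, s.2 + hb n.+1); split => //=; rewrite ?lexx ?lerDl ?ha0 ?hb0.
  have [P4|nP4] := pselect (P (s.1 + ha n.+1) (s.2 + hb n.+1) (ha n.+1) (hb n.+1)); last first.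
    by exists (s.1 + ha n.+1, s.2 + hb n.+1); split => //=; rewrite ?lexx ?lerDl ?ha0 ?hb0.
  by exfalso; apply: nPs; rewrite haS hbS; exact: Pch.
have [next nextP] := choice (fun ns : nat * (R * R) => step ns.1 ns.2).
pose sq := fix sq n := if n is m.+1 then next (m, sq m) else (x0, y0).
have sqP n : ~ P (sq n).1 (sq n).2 (ha n) (hb n).
  elim: n => [|n IH] /=; first by rewrite /ha /hb expr0 !divr1.
  by have [] := nextP (n, sq n) IH.
have sq1 n : (sq n).1 <= (sq n.+1).1 <= (sq n).1 + ha n.+1.
  by have [] := nextP (n, sq n) (sqP n).
have sq2 n : (sq n).2 <= (sq n.+1).2 <= (sq n).2 + hb n.+1.
  by have [] := nextP (n, sq n) (sqP n).
have lim (u h : nat -> R) : (forall n, 0 < h n) -> (forall n, h n = h n.+1 + h n.+1) ->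
    (forall n, u n <= u n.+1 <= u n + h n.+1) ->
    exists l, forall n, u n <= l <= u n + h n.
  move=> h0 hS uS.
  have u_nd : {homo u : n m / (n <= m)%N >-> n <= m}.
    by apply/nondecreasing_seqP => n; case/andP: (uS n).
  have uh_ni : {homo (fun n => u n + h n) : n m / (n <= m)%N >-> m <= n}.
    apply/nonincreasing_seqP => n.
    by rewrite (hS n) addrA lerD2r; case/andP: (uS n).
  have uuh n m : u n <= u m + h m.
    case: (leqP n m) => nm.
      by apply: le_trans (u_nd _ _ nm) _; rewrite lerDl ltW.
    by apply: le_trans (uh_ni _ _ (ltnW nm)); rewrite lerDl ltW.
  exists (sup (range u)) => n; apply/andP; split.
    apply: ub_le_sup; last by exists n.
    by exists (u 0 + h 0) => _ [m _ <-].
  apply: ge_sup; first by exists (u 0), 0.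
  by move=> _ [m _ <-].
have [x hx] := lim (fun n => (sq n).1) ha ha_gt0 haS sq1.
have [y hy] := lim (fun n => (sq n).2) hb hb_gt0 hbS sq2.
have [d d0 hd] := Ploc x y.
have ex2 c : 0 < c -> exists n0, forall n, (n0 <= n)%N -> c / 2 ^+ n < d.
  move=> c0; pose k := Num.bound (c / d); exists k => n kn.
  rewrite ltr_pdivrMr ?exprn_gt0// mulrC -ltr_pdivrMr//.
  apply: (@lt_le_trans _ _ k%:R); first by apply: archi_boundP; rewrite divr_ge0// ltW.
  rewrite -natrX ler_nat (leq_trans kn)// ltnW// ltn_expl//.
have [n1 h1] := ex2 _ a0_gt0; have [n2 h2] := ex2 _ b0_gt0.
apply: (sqP (n1 + n2)%N); apply: hd => //.
- by rewrite ha_gt0 h1// leq_addr.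
- by rewrite hb_gt0 h2// leq_addl.
Qed.

End DyadicDescent.

(** * Continuity of complex-valued functions with real radii *)

Section ComplexContinuity.
Context {R : realType}.
Local Notation C := R[i].
Implicit Types (phi psi : R -> C) (f g : C -> C).

Definition rcont phi := forall x (eps : R), 0 < eps -> exists2 delta : R, 0 < delta &
  forall h, `|h| < delta -> cn (phi (x + h) - phi x) <= eps.

Definition ccont f := forall z (eps : R), 0 < eps -> exists2 delta : R, 0 < delta &
  forall h, cn h < delta -> cn (f (z + h) - f z) <= eps.

Lemma continuous_eps (u : R -> R) :
  (forall x (eps : R), 0 < eps -> exists2 delta : R, 0 < delta &
    forall h, `|h| < delta -> `|u (x + h) - u x| <= eps) -> continuous u.
Proof.
move=> H x; apply/cvgrPdist_le => eps /(H x)[d d0 hd].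
apply/nbhs_ballP; exists d => //= y; rewrite /ball /= => yd.
have := hd (y - x); rewrite (_ : x + (y - x) = y); last by ring.
rewrite distrC => /(_ yd).
by rewrite distrC.
Qed.

Lemma eps_continuous (u : R -> R) : continuous u ->
  forall x (eps : R), 0 < eps -> exists2 delta : R, 0 < delta &
    forall h, `|h| < delta -> `|u (x + h) - u x| <= eps.
Proof.
move=> cu x eps e0; have /cvgrPdist_le/(_ _ e0)/nbhs_ballP[d /= d0 hd] := cu x.
exists d => // h hlt; have := hd (x + h); rewrite /ball /= opprD addNKr normrN.
by move=> /(_ hlt); rewrite distrC.
Qed.

Lemma rcont_Re phi : rcont phi -> continuous (fun x => complex.Re (phi x)).
Proof.
move=> H; apply: continuous_eps => x eps /(H x)[d d0 hd]; exists d => // h /hd.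
by apply: le_trans; rewrite -raddfB cn_Re.
Qed.

Lemma rcont_Im phi : rcont phi -> continuous (fun x => complex.Im (phi x)).
Proof.
move=> H; apply: continuous_eps => x eps /(H x)[d d0 hd]; exists d => // h /hd.
by apply: le_trans; rewrite -raddfB cn_Im.
Qed.

Lemma rcont_cn phi : rcont phi -> continuous (fun x => cn (phi x)).
Proof.
move=> H; apply: continuous_eps => x eps /(H x)[d d0 hd]; exists d => // h /hd.
by apply: le_trans; rewrite cn_dist.
Qed.

Lemma rcont_mk (u v : R -> R) : continuous u -> continuous v ->
  rcont (fun x => u x +i* v x)%C.
Proof.
move=> cu cv x eps e0; have e20 : 0 < eps / 2 by rewrite divr_gt0.
have [d1 d10 h1] := eps_continuous cu x e20.
have [d2 d20 h2] := eps_continuous cv x e20.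
exists (Num.min d1 d2) => [|h]; first by rewrite lt_min d10.
rewrite lt_min => /andP[/h1 k1 /h2 k2].
by apply: le_trans (cn_le_ReIm _) _; rewrite /= (splitr eps) lerD.
Qed.

Lemma rcont_cst (c : C) : rcont (fun _ => c).
Proof. by move=> x eps e0; exists 1 => // h _; rewrite subrr cn0 ltW. Qed.

Lemma ccont_comp f phi : ccont f -> rcont phi -> rcont (fun x => f (phi x)).
Proof.
move=> cf cphi x eps /(cf (phi x))[d d0 hd].
have d20 : 0 < d / 2 by rewrite divr_gt0.
have [d' d'0 hd'] := cphi x _ d20; exists d' => // h /hd' hh.
rewrite (_ : phi (x + h) = phi x + (phi (x + h) - phi x)); last by ring.
apply: hd.
by rewrite (le_lt_trans hh)// ltr_pdivrMr// mulr_natr mulr2n ltrDl.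
Qed.

Lemma rcontD phi psi : rcont phi -> rcont psi -> rcont (fun x => phi x + psi x).
Proof.
move=> c1 c2 x eps e0; have e20 : 0 < eps / 2 by rewrite divr_gt0.
have [d1 d10 h1] := c1 x _ e20; have [d2 d20 h2] := c2 x _ e20.
exists (Num.min d1 d2) => [|h]; first by rewrite lt_min d10.
rewrite lt_min => /andP[/h1 k1 /h2 k2].
rewrite opprD addrACA; apply: le_trans (cnD _ _) _.
by rewrite (splitr eps) lerD.
Qed.

Lemma rcontM phi psi : rcont phi -> rcont psi -> rcont (fun x => phi x * psi x).
Proof.
move=> c1 c2 x eps e0.
pose M := cn (phi x) + cn (psi x) + 1.
have M0 : 0 < M by rewrite ltr_wpDl// addr_ge0// cn_ge0.
pose e := Num.min 1 (eps / (M * 2)).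
have e'0 : 0 < e by rewrite lt_min ltr01 divr_gt0// mulr_gt0.
have [d1 d10 h1] := c1 x _ e'0; have [d2 d20 h2] := c2 x _ e'0.
exists (Num.min d1 d2) => [|h]; first by rewrite lt_min d10.
rewrite lt_min => /andP[/h1 k1 /h2 k2].
have -> : phi (x + h) * psi (x + h) - phi x * psi x =
  (phi (x + h) - phi x) * psi (x + h) + phi x * (psi (x + h) - psi x) by ring.
apply: le_trans (cnD _ _) _; rewrite !cnM.
have psiM : cn (psi (x + h)) <= M.
  rewrite -[psi (x + h)](subrK (psi x)); apply: le_trans (cnD _ _) _.
  rewrite addrC /M -addrA [leRHS]addrC -addrA lerD//.
  by rewrite (le_trans k2)// (le_trans (_ : e <= 1)) ?ge_min ?lexx// lerDl cn_ge0.
have phiM : cn (phi x) <= M by rewrite /M -addrA lerDl addr_ge0// cn_ge0.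
have eE : e * (M * 2) <= eps.
  by rewrite -ler_pdivlMr ?mulr_gt0// /e ge_min lexx orbT.
apply: le_trans eE; rewrite mulrA mulr_natr mulr2n; apply: lerD.
  by apply: ler_pM; rewrite ?cn_ge0.
by rewrite mulrC; apply: ler_pM; rewrite ?cn_ge0.
Qed.

Lemma rcont_eq phi psi : phi =1 psi -> rcont phi -> rcont psi.
Proof. by move=> e; rewrite (_ : psi = phi)//; apply/funext => x; rewrite e. Qed.

Lemma cderiv_cont f : (forall z, exists d, cderiv f z d) -> ccont f.
Proof.
move=> df z eps e0; have [d hd] := df z; have [r r0 hr] := hd _ ltr01.
pose r' := Num.min r (eps / (1 + cn d)).
have d1 : 0 < 1 + cn d by rewrite ltr_pwDl// cn_ge0.
exists r' => [|h]; first by rewrite lt_min r0 divr_gt0.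
rewrite lt_min => /andP[/hr hh he].
rewrite -[X in cn X](subrK (h * d)); apply: le_trans (cnD _ _) _.
rewrite cnM; apply: le_trans (lerD hh (lexx _)) _.
have := ltW he; rewrite ler_pdivlMr// => hhe; apply: le_trans hhe.
by rewrite mul1r mulrDr mulr1.
Qed.

End ComplexContinuity.

(** * Entire functions and the complex exponential *)

Section Holomorphy.
Context {R : realType}.
Local Notation C := R[i].
Implicit Types f g : C -> C.

Lemma entireM f g : entire f -> entire g -> entire (fun z => f z * g z).
Proof. by move=> ef eg z; have := derivableM (ef z) (eg z). Qed.

Lemma entire_comp f g : entire f -> entire g -> entire (fun z => f (g z)).
Proof.
move=> ef eg z; apply/derivable1_diffP.
apply: (@differentiable_comp _ _ _ _ (g : C^o -> C^o) (f : C^o -> C^o)); exact/derivable1_diffP.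
Qed.

Lemma entire_cst (c : C) : entire (fun _ => c).
Proof. by move=> z; exact: derivable_cst. Qed.

Lemma entire_id : entire (fun z : C => z).
Proof. by move=> z; exact: derivable_id. Qed.

Lemma entireD f g : entire f -> entire g -> entire (fun z => f z + g z).
Proof. by move=> ef eg z; have := derivableD (ef z) (eg z). Qed.

Lemma entire_horner (q : {poly C}) : entire (horner q).
Proof.
elim/poly_ind: q => [|q c IH].
  by rewrite (_ : horner _ = fun=> 0); [exact: entire_cst|apply/funext => z; rewrite horner0].
rewrite (_ : horner _ = fun z => q.[z] * z + c); last first.
  by apply/funext => z; rewrite hornerMXaddC.
have H1 := @entireM (horner q) (fun z => z) IH entire_id.
have H2 := @entireD (fun z : C => q.[z] * z) (fun _ : C => c) H1 (@entire_cst c).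
exact: H2.
Qed.

Lemma real_deriv_eps (f : R -> R) (x d : R) : is_derive x 1 f d ->
  forall eps, 0 < eps -> exists2 delta, 0 < delta &
    forall h, `|h| < delta -> `|f (x + h) - f x - h * d| <= eps * `|h|.
Proof.
move=> df eps e0; have [/cvg_ex[d' /= fd'] dE] := df.
have d'E : d' = d by rewrite -dE /derive; apply/esym/cvg_lim.
have /cvgrPdist_le/(_ _ e0) := fd'.
rewrite /dnbhs /= near_withinE => /nbhs_ballP[/= r r0 hr].
exists r => // h hlt.
have [->|h0] := eqVneq h 0; first by rewrite addr0 subrr sub0r mul0r oppr0 normr0 mulr0.
have := hr h; rewrite /ball /= sub0r normrN => /(_ hlt h0).
rewrite d'E => H.
have -> : f (x + h) - f x - h * d =
   - (h * (d - h^-1 *: (f (h *: (1 : R^o) + x) - f x))).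
  by rewrite /GRing.scale /= mulr1 [h + x]addrC; field.
by rewrite normrN normrM mulrC ler_wpM2r.
Qed.

Definition cexp (w : C) : C :=
  ((expR (complex.Re w) * cos (complex.Im w)) +i* (expR (complex.Re w) * sin (complex.Im w)))%C.

Lemma cexpD w h : cexp (w + h) = cexp w * cexp h.
Proof.
case: w h => [a b] [c d]; apply/eqP; rewrite eq_complex /= expRD cosD sinD.
by apply/andP; split; apply/eqP; ring.
Qed.

Lemma cexp0 : cexp 0 = 1.
Proof. by rewrite /cexp /= expR0 cos0 sin0 mul1r mulr0. Qed.

Lemma cn_cexp w : cn (cexp w) = expR (complex.Re w).
Proof.
rewrite /cexp /= !exprMn -mulrDr cos2Dsin2 mulr1 sqrtr_sqr ger0_norm//.
Qed.

Lemma cexp_neq0 w : cexp w != 0.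
Proof. by rewrite -cn_gt0 cn_cexp expR_gt0. Qed.

Lemma cexp_cderiv0 : cderiv cexp 0 1.
Proof.
(* The errors in the real and imaginary parts add up to at most 9 e |h|. *)
move=> eps e0; pose e := Num.min 1 (eps / 16).
have e'0 : 0 < e by rewrite lt_min ltr01 divr_gt0.
have e1 : e <= 1 by rewrite ge_min lexx.
have e16 : e * 16 <= eps by rewrite -ler_pdivlMr// ge_min lexx orbT.
have [d1 d10 h1] := real_deriv_eps (is_derive_expR (0 : R)) e'0.
have [d2 d20 h2] := real_deriv_eps (is_derive_cos (0 : R)) e'0.
have [d3 d30 h3] := real_deriv_eps (is_derive_sin (0 : R)) e'0.
exists (Num.min (Num.min d1 d2) (Num.min d3 e)).
  by rewrite !lt_min d10 d20 d30 ltr01 divr_gt0.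
move=> h; rewrite !lt_min => /andP[/andP[hd1 hd2] /andP[hd3 /andP[he1 he]]].
pose a := complex.Re h; pose b := complex.Im h.
have ah : `|a| <= cn h by exact: cn_Re.
have bh : `|b| <= cn h by exact: cn_Im.
have {h1} := h1 a (le_lt_trans ah hd1).
have {h2} := h2 b (le_lt_trans bh hd2).
have {h3} := h3 b (le_lt_trans bh hd3).
rewrite !add0r expR0 cos0 sin0 oppr0 mulr0 !subr0 !mulr1 ?addr0 => S Co E.
have t0 := cn_ge0 h.
have E1 : `|expR a - 1| <= 2 * cn h.
  rewrite -[X in `|X|](subrK a); apply: le_trans (ler_normD _ _) _.
  apply: le_trans (lerD E ah) _; have m0 := ler_pM (ltW e'0) (normr_ge0 a) e1 ah.
  by lra.
have E3 : `|expR a| <= 3.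
  rewrite -[X in `|X|](subrK 1); apply: le_trans (ler_normD _ _) _.
  by rewrite normr1; lra.
apply: le_trans (cn_le_ReIm _) _.
rewrite cexp0 !raddfB /= -/a -/b.
have -> : expR a * cos b - 1 - a = expR a * (cos b - 1) + (expR a - 1 - a) by ring.
have -> : expR a * sin b - 0 - b = expR a * (sin b - b) + b * (expR a - 1) by ring.
have k1 := ler_normD (expR a * (cos b - 1)) (expR a - 1 - a).
have k2 := ler_normD (expR a * (sin b - b)) (b * (expR a - 1)).
rewrite !normrM in k1 k2.
have m1 := ler_pM (normr_ge0 _) (normr_ge0 _) E3 Co.
have m2 := ler_pM (normr_ge0 _) (normr_ge0 _) E3 S.
have m3 := ler_pM (normr_ge0 _) (normr_ge0 _) bh E1.
have n1 := ler_wpM2l (ltW e'0) bh.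
have n2 := ler_wpM2l (ltW e'0) ah.
have n3 := ler_wpM2r t0 (ltW he).
have n4 := ler_wpM2r t0 e16.
have n5 := mulr_ge0 (ltW e0) t0; by lra.
Qed.

(** The functional equation carries the derivative at 0 to every point. *)
Lemma entire_cexp : entire cexp.
Proof.
apply: cderiv_entire => z; exists (cexp z) => eps e0.
have E0 := expR_gt0 (complex.Re z).
have [d d0 hd] := cexp_cderiv0 (divr_gt0 e0 E0).
exists d => // h /hd; rewrite add0r cexp0 mulr1 => H.
rewrite cexpD (_ : _ - _ - _ = cexp z * (cexp h - 1 - h)); last by ring.
rewrite cnM cn_cexp; apply: le_trans (ler_wpM2l (ltW E0) H) _.
by rewrite mulrA mulrCA divff ?gt_eqF// mulr1.
Qed.

Lemma cexp_period w (k : nat) : cexp (w + (0 +i* (pi *+ 2 *+ k))%C) = cexp w.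
Proof.
have e1 : cexp (0 +i* (pi *+ 2))%C = 1.
  by rewrite /cexp /= expR0 cos2pi sin2pi !mul1r.
elim: k => [|k IH]; first by rewrite mulr0n (_ : (0 +i* 0)%C = 0)// addr0.
rewrite mulrS (_ : (0 +i* _)%C = (0 +i* (pi *+ 2 *+ k))%C + (0 +i* (pi *+ 2))%C).
  by rewrite addrA cexpD e1 mulr1.
by apply/eqP; rewrite eq_complex /= addr0 addrC !eqxx.
Qed.

End Holomorphy.

(** * Contour integrals around rectangles *)

Section Goursat.
Context {R : realType}.
Local Notation C := R[i].
Implicit Types (phi psi : R -> C) (F : C -> C).

Definition CI phi (a b : R) : C :=
  (RI (fun x => complex.Re (phi x)) a b +i* RI (fun x => complex.Im (phi x)) a b)%C.

Lemma CI_eq phi psi a b : (forall x, a <= x <= b -> phi x = psi x) ->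
  CI phi a b = CI psi a b.
Proof. by move=> e; congr Complex; apply: RI_eq => x /e ->. Qed.

Lemma CID phi psi a b : rcont phi -> rcont psi ->
  CI (fun x => phi x + psi x) a b = CI phi a b + CI psi a b.
Proof.
move=> c1 c2; apply/eqP; rewrite eq_complex /=.
rewrite -!RID; try exact: rcont_Re; try exact: rcont_Im.
by apply/andP; split; apply/eqP; apply: RI_eq => x _; rewrite raddfD.
Qed.

Lemma CIZ c phi a b : rcont phi ->
  CI (fun x => c * phi x) a b = c * CI phi a b.
Proof.
move=> c1; have cr := rcont_Re c1; have ci := rcont_Im c1.
have cZ k (u : R -> R) : continuous u -> continuous (fun x => k * u x).
  by move=> cu x; apply: cvgMr; exact: cu.
case: c => u v; apply/eqP; rewrite eq_complex /=; apply/andP; split; apply/eqP.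
  rewrite -mulNr -!RIZ// -RID; try exact: cZ.
  by apply: RI_eq => x _; case: (phi x) => p q /=; ring.
rewrite -!RIZ// -RID; try exact: cZ.
by apply: RI_eq => x _; case: (phi x) => p q /=; ring.
Qed.

Lemma CI_split phi a b c : rcont phi -> a <= b -> b <= c ->
  CI phi a c = CI phi a b + CI phi b c.
Proof.
move=> c1 ab bc; apply/eqP; rewrite eq_complex /=.
by rewrite -!RI_split ?eqxx//; [exact: rcont_Im|exact: rcont_Re].
Qed.

(** The factor 2 comes from bounding real and imaginary parts separately; it is harmless wherever
    the bound is made arbitrarily small. *)
Lemma CI_le phi (u : R -> R) a b : rcont phi -> continuous u -> a <= b ->
  (forall x, a <= x <= b -> cn (phi x) <= u x) -> cn (CI phi a b) <= 2 * RI u a b.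
Proof.
move=> c1 cu ab hu; apply: le_trans (cn_le_ReIm _) _ => /=.
have H (v : R -> R) : continuous v -> (forall x, `|v x| <= cn (phi x)) ->
    `|RI v a b| <= RI u a b.
  move=> cv hv; have cNu : continuous (fun x => -1 * u x).
    by move=> x; apply: cvgMr; exact: cu.
  rewrite ler_norml -mulN1r -RIZ//; apply/andP; split; apply: RI_le => // x /hu hx;
    have := le_trans (hv x) hx; rewrite ler_norml => /andP[]//.
  by rewrite mulN1r.
rewrite mulr_natl mulr2n; apply: lerD; apply: H => [|x].
- exact: rcont_Re.
- exact: cn_Re.
- exact: rcont_Im.
- exact: cn_Im.
Qed.

Lemma CI_norm phi a b M : rcont phi -> a <= b ->
  (forall x, a <= x <= b -> cn (phi x) <= M) -> cn (CI phi a b) <= 2 * (M * (b - a)).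
Proof.
move=> c1 ab hM; rewrite -RI_cst//; apply: CI_le => //.
exact: (@cst_continuous _ _ M).
Qed.

Lemma CI_cst (c : C) a b : a <= b -> CI (fun _ => c) a b = c * (b - a)%:C%C.
Proof.
move=> ab; case: c => u v; apply/eqP; rewrite eq_complex /= !RI_cst//.
by rewrite !mulr0 subr0 add0r !eqxx.
Qed.

Lemma rcont_real (u : R -> R) : continuous u -> rcont (fun x => (u x)%:C%C).
Proof. by move=> cu; apply: rcont_mk => //; exact: (@cst_continuous _ _ (0 : R)). Qed.

Lemma cont_id : continuous (fun x : R => x).
Proof. by move=> x; exact: cvg_id. Qed.

Lemma CI_affine (u v : C) a b : a <= b ->
  CI (fun x => u + v * x%:C%C) a b =
  (u + v * ((a + b) / 2)%:C%C) * (b - a)%:C%C.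
Proof.
move=> ab; have rid : rcont (fun x => x%:C%C : C) by apply: rcont_real; exact: cont_id.
have rv : rcont (fun x => v * x%:C%C) by apply: rcontM => //; exact: rcont_cst.
rewrite CID//; last exact: rcont_cst.
rewrite CI_cst// CIZ// mulrDl; congr (_ + _).
rewrite -mulrA; congr (v * _).
rewrite -rmorphM; congr Complex => /=.
  have E : RI (fun x : R => x) a b = 2^-1 * b ^+ 2 - 2^-1 * a ^+ 2.
    apply: (@RI_FTC _ _ (fun x : R => 2^-1 * x ^+ 2)) => //; first exact: cont_id.
    by move=> x _; apply: is_derive_eq => /=; rewrite /GRing.scale /=; field.
  by rewrite E; field.
by rewrite RI_cst// mul0r.
Qed.

(** The contour integral of [F] counterclockwise around [x, x + a] x [y, y + b]: bottom minus top,
    plus i times right minus left. *)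
Definition bdry F (x y a b : R) : C :=
  CI (fun t => F (t +i* y)%C) x (x + a) - CI (fun t => F (t +i* (y + b))%C) x (x + a)
  + 'i%C * (CI (fun t => F ((x + a) +i* t)%C) y (y + b) - CI (fun t => F (x +i* t)%C) y (y + b)).

Lemma rcont_h F y : ccont F -> rcont (fun t => F (t +i* y)%C).
Proof.
move=> cF; apply: ccont_comp => //; apply: rcont_mk; [exact: cont_id|].
exact: (@cst_continuous _ _ (y : R)).
Qed.

Lemma rcont_v F x : ccont F -> rcont (fun t => F (x +i* t)%C).
Proof.
move=> cF; apply: ccont_comp => //; apply: rcont_mk; [|exact: cont_id].
exact: (@cst_continuous _ _ (x : R)).
Qed.

(** The inner edges of the four quarters are traversed twice in opposite directions. *)
Lemma bdry_split F x y a b : ccont F -> 0 < a -> 0 < b ->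
  bdry F x y (a + a) (b + b) =
  bdry F x y a b + bdry F (x + a) y a b + bdry F x (y + b) a b + bdry F (x + a) (y + b) a b.
Proof.
move=> cF a0 b0.
have hs z : CI (fun t => F (t +i* z)%C) x (x + (a + a)) =
    CI (fun t => F (t +i* z)%C) x (x + a) + CI (fun t => F (t +i* z)%C) (x + a) (x + a + a).
  by rewrite addrA; apply: CI_split; rewrite ?lerDl ?ltW//; exact: rcont_h.
have vs z : CI (fun t => F (z +i* t)%C) y (y + (b + b)) =
    CI (fun t => F (z +i* t)%C) y (y + b) + CI (fun t => F (z +i* t)%C) (y + b) (y + b + b).
  by rewrite addrA; apply: CI_split; rewrite ?lerDl ?ltW//; exact: rcont_v.
rewrite /bdry !hs !vs !addrA; ring.
Qed.

(** The horizontal sides contribute - v i a b and the vertical sides i v a b. *)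
Lemma bdry_affine (u v : C) x y a b : 0 < a -> 0 < b ->
  bdry (fun z => u + v * z) x y a b = 0.
Proof.
move=> a0 b0; rewrite /bdry.
have h z : CI (fun t => u + v * (t +i* z)%C) x (x + a) =
   (u + v * 'i%C * z%:C%C + v * ((x + (x + a)) / 2)%:C%C) * (x + a - x)%:C%C.
  rewrite -CI_affine ?lerDl ?ltW//; apply: CI_eq => t _.
  rewrite (_ : (t +i* z)%C = t%:C%C + 'i%C * z%:C%C); first by ring.
  by apply/eqP; rewrite eq_complex /=; apply/andP; split; apply/eqP; ring.
have k z : CI (fun t => u + v * (z +i* t)%C) y (y + b) =
   (u + v * z%:C%C + v * 'i%C * ((y + (y + b)) / 2)%:C%C) * (y + b - y)%:C%C.
  rewrite -CI_affine ?lerDl ?ltW//; apply: CI_eq => t _.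
  rewrite (_ : (z +i* t)%C = z%:C%C + 'i%C * t%:C%C); first by ring.
  by apply/eqP; rewrite eq_complex /=; apply/andP; split; apply/eqP; ring.
rewrite !h !k !rmorphM !rmorphB !rmorphD /=.
rewrite (_ : _ + 'i%C * _ = - v * 'i%C * b%:C%C * a%:C%C - v * 'i%C ^+ 2 * (0) + v * 'i%C * a%:C%C * b%:C%C); last by ring.
by ring.
Qed.

Lemma bdry_eq F G x y a b : F =1 G -> bdry F x y a b = bdry G x y a b.
Proof. by move=> e; rewrite (_ : F = G)//; apply/funext. Qed.

Lemma bdryD F G x y a b : ccont F -> ccont G ->
  bdry (fun z => F z + G z) x y a b = bdry F x y a b + bdry G x y a b.
Proof.
move=> cF cG; rewrite /bdry !CID; try exact: rcont_h; try exact: rcont_v.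
ring.
Qed.

Lemma bdry_norm F x y a b M : ccont F -> 0 < a -> 0 < b ->
  (forall s t, x <= s <= x + a -> y <= t <= y + b -> cn (F (s +i* t)%C) <= M) ->
  cn (bdry F x y a b) <= 4 * M * (a + b).
Proof.
move=> cF a0 b0 hM; have a0' := ltW a0; have b0' := ltW b0.
rewrite /bdry; apply: le_trans (cnD _ _) _; rewrite cnM cn_i mul1r.
have k1 := le_trans (cnD (CI (fun t => F (t +i* y)%C) x (x + a)) (- CI (fun t => F (t +i* (y + b))%C) x (x + a))) (lerD (lexx _) (lexx _)).
have k2 := cnD (CI (fun t => F ((x + a) +i* t)%C) y (y + b)) (- CI (fun t => F (x +i* t)%C) y (y + b)).
rewrite cnN in k1; rewrite cnN in k2.
have h1 : cn (CI (fun t => F (t +i* y)%C) x (x + a)) <= 2 * (M * (x + a - x)).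
  apply: CI_norm => [||t tx]; rewrite ?lerDl//; first exact: rcont_h.
  by apply: hM => //; rewrite lexx lerDl.
have h2 : cn (CI (fun t => F (t +i* (y + b))%C) x (x + a)) <= 2 * (M * (x + a - x)).
  apply: CI_norm => [||t tx]; rewrite ?lerDl//; first exact: rcont_h.
  by apply: hM => //; rewrite lexx lerDl b0'.
have h3 : cn (CI (fun t => F ((x + a) +i* t)%C) y (y + b)) <= 2 * (M * (y + b - y)).
  apply: CI_norm => [||t tx]; rewrite ?lerDl//; first exact: rcont_v.
  by apply: hM => //; rewrite lexx lerDl a0'.
have h4 : cn (CI (fun t => F (x +i* t)%C) y (y + b)) <= 2 * (M * (y + b - y)).
  apply: CI_norm => [||t tx]; rewrite ?lerDl//; first exact: rcont_v.
  by apply: hM => //; rewrite lexx lerDl.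
lra.
Qed.

Lemma goursat F : entire F -> forall x y a b, 0 < a -> 0 < b -> bdry F x y a b = 0.
Proof.
move=> eF x0 y0 a0 b0 a00 b00.
have dF := entire_cderiv eF; have cF := cderiv_cont dF.
(* The bound is quadratic in the side lengths, so four quarters add up exactly to the whole, as
   bisection requires. *)
suff H eps : 0 < eps -> forall x y a b, 0 < a -> 0 < b ->
    cn (bdry F x y a b) <= eps * (a + b) ^+ 2.
  apply/eqP; rewrite -cn_eq0 eq_le cn_ge0 andbT; apply/ler_addgt0Pr => e e0.
  have ab0 : 0 < (a0 + b0) ^+ 2 by rewrite exprn_gt0// addr_gt0.
  have := H _ (divr_gt0 e0 ab0) x0 y0 _ _ a00 b00.
  by rewrite divfK ?gt_eqF// add0r.
move=> e0; apply: dyadic_descent.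
  move=> x y a b a1 b1 h1 h2 h3 h4; rewrite bdry_split//.
  set e := eps * (a + b) ^+ 2 in h1 h2 h3 h4.
  have -> : eps * (a + a + (b + b)) ^+ 2 = e + e + e + e by rewrite /e; ring.
  by do 3!(apply: le_trans (cnD _ _) _; apply: lerD => //).
move=> x y; have [d hd] := dF (x +i* y)%C.
have e40 : 0 < eps / 4 by rewrite divr_gt0.
have [r r0 hr] := hd _ e40.
exists (r / 2); first by rewrite divr_gt0.
move=> x' y' a b /andP[a1 ar] /andP[b1 br] xx' yy'.
pose z0 := (x +i* y)%C.
(* Subtracting the tangent map at [z0] does not change the contour integral and leaves an integrand
   of size eps/4 times the diameter. *)
pose A z := F z0 - d * z0 + d * z.
have eA : entire A.
  have e1 := @entireM _ (fun _ => d) (fun z => z) (@entire_cst _ d) (@entire_id _).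
  exact: (@entireD _ (fun _ => F z0 - d * z0) (fun z => d * z) (@entire_cst _ _) e1).
have cA : ccont A by apply: cderiv_cont; apply: entire_cderiv.
have cFA : ccont (fun z => F z + -1 * A z).
  apply: cderiv_cont; apply: entire_cderiv.
  have e1 := @entireM _ (fun _ => -1) A (@entire_cst _ (-1)) eA.
  exact: (@entireD _ F (fun z => -1 * A z) eF e1).
have -> : bdry F x' y' a b = bdry (fun z => F z + -1 * A z) x' y' a b.
  have -> : bdry F x' y' a b = bdry (fun z => (F z + -1 * A z) + A z) x' y' a b.
    by apply: bdry_eq => z; ring.
  by rewrite bdryD// /A bdry_affine// addr0.
apply: (@le_trans _ _ (4 * (eps / 4 * (a + b)) * (a + b))); last first.
  by rewrite (_ : 4 * _ * _ = eps * (a + b) ^+ 2)//; field.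
apply: bdry_norm => // s t xs yt.
pose h := (s +i* t)%C - z0.
have hab : cn h <= a + b.
  apply: le_trans (cn_le_ReIm _) _; rewrite /=.
  by apply: lerD; rewrite ler_norml; lra.
have hlt : cn h < r by lra.
have := hr _ hlt; rewrite (_ : z0 + h = (s +i* t)%C); last by rewrite /h; ring.
rewrite (_ : _ - _ - _ = F (s +i* t)%C + -1 * A (s +i* t)%C); last by rewrite /A /h; ring.
move=> H; apply: le_trans H _; rewrite ler_wpM2l// ltW//.
Qed.

End Goursat.

(** * Polynomial approximation of entire functions *)

Section CircleCoefficients.
Context {R : realType}.
Local Notation C := R[i].
Implicit Types (f : C -> C) (s t : R) (j : int).

Definition ecirc (t : R) : C := cexp (0 +i* t)%C.

Lemma ecircD s t : ecirc (s + t) = ecirc s * ecirc t.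
Proof.
rewrite /ecirc -cexpD; congr cexp.
by apply/eqP; rewrite eq_complex /= addr0 !eqxx.
Qed.

Lemma ecirc0 : ecirc 0 = 1. Proof. exact: cexp0. Qed.

Lemma cn_ecirc t : cn (ecirc t) = 1.
Proof. by rewrite /ecirc cn_cexp expR0. Qed.

Lemma ecirc_neq0 t : ecirc t != 0. Proof. exact: cexp_neq0. Qed.

Lemma ecircN t : ecirc (- t) = (ecirc t)^-1.
Proof.
apply: (@mulfI _ (ecirc t)); first exact: ecirc_neq0.
by rewrite -ecircD subrr ecirc0 divff// ecirc_neq0.
Qed.

Lemma ecirc_conj t : (ecirc t)^*%C = ecirc (- t).
Proof. by rewrite /ecirc /cexp /= cosN sinN !expR0 !mul1r. Qed.

Lemma ecircMn t n : ecirc (t *+ n) = ecirc t ^+ n.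
Proof. by elim: n => [|n IH]; rewrite ?mulr0n ?ecirc0// mulrS ecircD IH exprS. Qed.

Lemma ecirc_2pi j : ecirc (j%:~R * (pi *+ 2)) = 1.
Proof.
have P n : ecirc (pi *+ 2 *+ n) = 1.
  by have := cexp_period (0 : C) n; rewrite add0r cexp0.
case: j => n; first by rewrite -[_%:~R]/(n%:R) mulr_natl P.
by rewrite NegzE mulrNz mulNr ecircN mulr_natl P invr1.
Qed.

Lemma cexpE s t : cexp (s +i* t)%C = (expR s)%:C%C * ecirc t.
Proof.
by rewrite /ecirc /cexp /= expR0 !mul1r; apply/eqP; rewrite eq_complex /= !mul0r subr0 addr0 !eqxx.
Qed.

Lemma rcont_ecirc (k : R) (b : R) : rcont (fun t => ecirc (k * t + b)).
Proof.
apply: ccont_comp; first exact: cderiv_cont (entire_cderiv entire_cexp).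
apply: rcont_mk; first exact: (@cst_continuous _ _ (0 : R)).
move=> x; apply: cvgD; last exact: cvg_cst.
by apply: cvgMr; exact: cvg_id.
Qed.

Lemma rcont_circ f s : entire f -> rcont (fun t => f (cexp (s +i* t)%C)).
Proof.
move=> ef; apply: (@rcont_v _ (fun w => f (cexp w))).
apply: cderiv_cont; apply: entire_cderiv; exact: entire_comp ef entire_cexp.
Qed.

(** 2 pi times the Fourier coefficient of index - j of [f] on the circle of radius e^s; with this
    sign it is the positive [j] that give zero. *)
Definition fourier f j s : C :=
  CI (fun t => f (cexp (s +i* t)%C) * ecirc (j%:~R * t)) 0 (pi *+ 2).

Lemma pi2_gt0 : 0 < pi *+ 2 :> R. Proof. by rewrite mulrn_wgt0// pi_gt0. Qed.

Lemma rcont_fourier f j s : entire f ->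
  rcont (fun t => f (cexp (s +i* t)%C) * ecirc (j%:~R * t)).
Proof.
move=> ef; apply: rcontM; first exact: rcont_circ.
apply: (@rcont_eq _ (fun t => ecirc (j%:~R * t + 0))); last exact: rcont_ecirc.
by move=> t; rewrite addr0.
Qed.

(** In Goursat's theorem for a rectangle one period high, the two horizontal sides cancel. *)
Lemma periodic_vertical (F : C -> C) (T s s' : R) : entire F -> 0 < T -> s < s' ->
  (forall t, F (t +i* T)%C = F (t +i* 0)%C) ->
  CI (fun t => F (s' +i* t)%C) 0 T = CI (fun t => F (s +i* t)%C) 0 T.
Proof.
move=> eF T0 ss' FT.
have ss'0 : 0 < s' - s by rewrite subr_gt0.
have := @goursat _ F eF s 0 (s' - s) T ss'0 T0.
rewrite /bdry add0r [s + _]addrC subrK.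
rewrite (@CI_eq _ (fun t => F (t +i* T)%C) (fun t => F (t +i* 0)%C)); last by [].
rewrite subrr add0r => /eqP; rewrite mulf_eq0 -[_ == 0]cn_eq0 cn_i oner_eq0 /=.
by rewrite subr_eq0 => /eqP ->.
Qed.

(** In the coordinate w = log z, circles become vertical segments and f(e^w) e^(j w) is entire with
    period 2 pi i. Independence of the radius thus needs only rectangles, no annuli. *)
Lemma fourier_radius f j s s' : entire f ->
  (expR (j%:~R * s))%:C%C * fourier f j s = (expR (j%:~R * s'))%:C%C * fourier f j s'.
Proof.
move=> ef; wlog ss' : s s' / s < s'.
  move=> H; have [ss'|s's|->//] := ltgtP s s'; first exact: H.
  by apply/esym; exact: H.
pose c : C := (j%:~R : R)%:C%C.
have eF : entire (fun w => f (cexp w) * cexp (c * w)).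
  have e1 := @entireM _ (fun _ => c) (fun w => w) (@entire_cst _ c) (@entire_id _).
  have e2 := @entire_comp _ cexp (fun w => c * w) (@entire_cexp _) e1.
  exact: (@entireM _ (fun w => f (cexp w)) (fun w => cexp (c * w)) (@entire_comp _ f cexp ef (@entire_cexp _)) e2).
have FE s0 : CI (fun t => f (cexp (s0 +i* t)%C) * cexp (c * (s0 +i* t)%C)) 0 (pi *+ 2) =
    (expR (j%:~R * s0))%:C%C * fourier f j s0.
  rewrite /fourier -CIZ; last exact: rcont_fourier.
  apply: CI_eq => t _; rewrite mulrCA; congr (_ * _).
  rewrite -cexpE; congr cexp.
  by apply/eqP; rewrite eq_complex /= !mul0r subr0 addr0 !eqxx.
have := @periodic_vertical _ (pi *+ 2) s s' eF pi2_gt0 ss'.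
rewrite !FE => ->//.
move=> t; congr (f _ * _).
  rewrite -(cexp_period (t +i* 0)%C 1); congr cexp.
  by apply/eqP; rewrite eq_complex /= mulr1n addr0 add0r !eqxx.
rewrite (_ : c * (t +i* (pi *+ 2))%C =
   c * (t +i* 0)%C + (0 +i* (j%:~R * (pi *+ 2)))%C).
  by rewrite cexpD -/(ecirc _) ecirc_2pi mulr1.
by apply/eqP; rewrite eq_complex /= !mul0r !mulr0 !addr0 !add0r !eqxx.
Qed.

Lemma fourierE f j s : entire f ->
  fourier f j s = (expR (- (j%:~R * s)))%:C%C * fourier f j 0.
Proof.
move=> ef; have := fourier_radius j s 0 ef.
rewrite mulr0 expR0 mul1r => <-; rewrite mulrA -rmorphM -expRD addNr expR0.
by rewrite mul1r.
Qed.

(** As the radius e^x tends to 0, [f] stays bounded on the circle while the factor e^(j x), j > 0,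
    tends to 0. *)
Lemma fourier_pos f (k : nat) s : entire f -> fourier f (k.+1 : int) s = 0.
Proof.
move=> ef; rewrite fourierE//; apply/eqP; rewrite mulf_eq0; apply/orP; right.
have [d d0 hd] := cderiv_cont (entire_cderiv ef) (0 : C) ltr01.
pose M := cn (f 0) + 1.
have M0 : 0 < M by rewrite ltr_wpDl// cn_ge0.
have bnd x : x < 0 -> expR x < d ->
   cn (fourier f (k.+1 : int) 0) <= expR x * (2 * (M * (pi *+ 2))).
  move=> x0 xd; have := fourier_radius (k.+1 : int) x 0 ef.
  rewrite mulr0 expR0 mul1r => <-; rewrite cnM cn_real ger0_norm ?expR_ge0//.
  apply: ler_pM; rewrite ?expR_ge0 ?cn_ge0//.
    rewrite ler_expR -[leRHS]mul1r; apply: ler_wnM2r; first exact: ltW.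
    by rewrite -[X in X <= _](mulr1z 1) ler_int.
  have := @CI_norm R _ 0 (pi *+ 2) M (rcont_fourier (k.+1 : int) x ef) (ltW pi2_gt0).
  rewrite subr0; apply => t _; rewrite cnM cn_ecirc mulr1.
  rewrite -[X in cn X](subrK (f 0)); apply: le_trans (cnD _ _) _.
  rewrite addrC lerD2l; have := hd (cexp (x +i* t)%C).
  by rewrite add0r cn_cexp /=; exact.
rewrite -cn_eq0 eq_le cn_ge0 andbT; apply/ler_addgt0Pr => e e0; rewrite add0r.
pose K := 2 * (M * (pi *+ 2)).
have K0 : 0 < K by rewrite !mulr_gt0// pi2_gt0.
pose y := Num.min (2^-1) (Num.min (d / 2) (e / K)).
have y0 : 0 < y by rewrite !lt_min invr_gt0 ltr0n !divr_gt0.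
have y1 : y <= 2^-1 by rewrite ge_min lexx.
have y2 : y <= d / 2 by rewrite !ge_min lexx !orbT.
have y3 : y <= e / K by rewrite !ge_min lexx !orbT.
have := bnd (ln y); rewrite lnK ?posrE// => H.
apply: le_trans (H _ _) _.
- by rewrite ln_lt0// y0 /=; lra.
- by lra.
- by rewrite -ler_pdivlMr.
Qed.

End CircleCoefficients.

(** * Fejer means and uniform approximation on discs *)

Section FejerApproximation.
Context {R : realType}.
Local Notation C := R[i].
Implicit Types (f : C -> C) (s t : R) (j : int).

Lemma rcont_sum (I : Type) (r : seq I) (F : I -> R -> C) :
  (forall i, rcont (F i)) -> rcont (fun t => \sum_(i <- r) F i t).
Proof.
move=> H; elim: r => [|i r IH].
  by apply: rcont_eq (rcont_cst (0 : C)) => t; rewrite big_nil.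
by apply: rcont_eq (rcontD (H i) IH) => t; rewrite big_cons.
Qed.

Lemma CI_sum (I : Type) (r : seq I) (F : I -> R -> C) a b : a <= b ->
  (forall i, rcont (F i)) ->
  CI (fun t => \sum_(i <- r) F i t) a b = \sum_(i <- r) CI (F i) a b.
Proof.
move=> ab H; elim: r => [|i r IH].
  rewrite big_nil (@CI_eq _ _ (fun _ => 0)); last by move=> t _; rewrite big_nil.
  by rewrite CI_cst// mul0r.
rewrite big_cons -IH -CID//; last exact: rcont_sum.
by apply: CI_eq => t _; rewrite big_cons.
Qed.

Definition dirichlet (N : nat) (u : R) : C := \sum_(k < N) ecirc u ^+ k.

Lemma dirichlet_sqr N u : (cn (dirichlet N u) ^+ 2)%:C%C =
  \sum_(k < N) \sum_(l < N) ecirc (((k : nat)%:Z - (l : nat)%:Z)%:~R * u).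
Proof.
rewrite rmorphXn /= cnE sqr_normc /dirichlet rmorph_sum /= mulr_suml.
apply: eq_bigr => k _; rewrite mulr_sumr; apply: eq_bigr => l _.
rewrite -!ecircMn ecirc_conj -ecircD; congr ecirc.
by rewrite rmorphB /= mulrBl -[u *+ k]mulr_natl -[u *+ l]mulr_natl.
Qed.

(** The geometric sum telescopes to |e^(iNu) - 1| <= 2. Away from u = 0 the Fejer kernel is
    therefore bounded independently of [N]. *)
Lemma ecirc_chord N u : cn (ecirc u - 1) ^+ 2 * cn (dirichlet N u) ^+ 2 <= 4.
Proof.
rewrite -exprMn -cnM /dirichlet -subrX1.
have : cn (ecirc u ^+ N - 1) <= 2.
  by apply: le_trans (cnD _ _) _; rewrite cnN cn1 cnX cn_ecirc expr1n.
by move=> h; rewrite (_ : 4 = 2 ^+ 2 :> R) ?ler_pXn2r ?nnegrE ?cn_ge0//; ring.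
Qed.

Lemma fourier_cst1 j s : fourier (fun _ => 1 : C) j s = (if j == 0 then pi *+ 2 else 0)%:C%C.
Proof.
have e1 : entire (fun _ : C => 1 : C) by exact: entire_cst.
have [->|j0] := eqVneq j 0.
  rewrite /fourier (@CI_eq _ _ (fun _ => 1)).
    by rewrite CI_cst ?ltW ?pi2_gt0// mul1r subr0.
  by move=> t _; rewrite mul0r ecirc0 mulr1.
have := fourierE j 1 e1; rewrite (_ : fourier _ j 1 = fourier (fun _ => 1) j 0)//.
rewrite (_ : fourier _ j s = fourier (fun _ => 1) j 0)//.
have [->//|F0] := eqVneq (fourier (fun _ => 1 : C) j 0) 0.
rewrite -[LHS]mul1r => /(mulIf F0) /(congr1 (@complex.Re _)) /= /esym/eqP.
rewrite mulr1 -[X in _ == X]expR0 (inj_eq (@expR_inj R)) oppr_eq0 intr_eq0 => j00.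
by rewrite j00 in j0.
Qed.

(** The Fejer mean multiplied by 2 pi N. Terms with l > k are dropped because their coefficients
    vanish by [fourier_pos]; coefficients on the unit circle serve all radii by [fourierE]. *)
Definition fejer f N : {poly C} :=
  \sum_(k < N) \sum_(l < N) if (l <= k)%N
    then fourier f (- (k - l)%N%:Z) 0 *: 'X^(k - l) else 0.

Lemma cexp_exp s phi n :
  cexp (s +i* phi)%C ^+ n = (expR (s *+ n))%:C%C * ecirc (phi *+ n).
Proof. by rewrite cexpE exprMn -rmorphXn -ecircMn -expRM_natl mulr_natl. Qed.

Lemma fejerE f N s phi : entire f ->
  (fejer f N).[cexp (s +i* phi)%C] =
  CI (fun t => f (cexp (s +i* t)%C) * (cn (dirichlet N (phi - t)) ^+ 2)%:C%C) 0 (pi *+ 2).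
Proof.
move=> ef.
have rc (j : int) : rcont (fun t => f (cexp (s +i* t)%C) * ecirc (j%:~R * (phi - t))).
  apply: rcontM; first exact: rcont_circ.
  apply: (@rcont_eq _ (fun t => ecirc (- j%:~R * t + j%:~R * phi))); last exact: rcont_ecirc.
  by move=> t; rewrite mulrBr mulNr addrC.
rewrite (@CI_eq _ _ (fun t => \sum_(k < N) \sum_(l < N)
   f (cexp (s +i* t)%C) * ecirc (((k : nat)%:Z - (l : nat)%:Z)%:~R * (phi - t)))); last first.
  by move=> t _; rewrite dirichlet_sqr mulr_sumr; apply: eq_bigr => k _; rewrite mulr_sumr.
rewrite CI_sum ?ltW ?pi2_gt0//; last by move=> k; apply: rcont_sum => l.
rewrite /fejer horner_sum; apply: eq_bigr => k _.
rewrite CI_sum ?ltW ?pi2_gt0// horner_sum; apply: eq_bigr => l _.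
have -> : CI (fun t => f (cexp (s +i* t)%C) * ecirc (((k : nat)%:Z - (l : nat)%:Z)%:~R * (phi - t))) 0 (pi *+ 2)
   = ecirc (((k : nat)%:Z - (l : nat)%:Z)%:~R * phi) * fourier f ((l : nat)%:Z - (k : nat)%:Z) s.
  rewrite /fourier -CIZ; last exact: rcont_fourier.
  apply: CI_eq => t _; rewrite mulrCA; congr (_ * _).
  rewrite -ecircD; congr ecirc; rewrite !rmorphB /=; ring.
case: leqP => lk.
  rewrite hornerZ hornerXn (fourierE _ s)//.
  rewrite (_ : (l : nat)%:Z - (k : nat)%:Z = - (k - l)%N%:Z); last by rewrite -subzn// opprB.
  rewrite subzn// cexp_exp; move: (fourier f _ 0) => F.
  have -> : - ((- (k - l)%N%:Z)%:~R * s) = s *+ (k - l) by rewrite mulrNz mulNr opprK mulr_natl.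
  by rewrite mulr_natl mulrC -mulrA mulrCA.
rewrite horner0.
have -> : (l : nat)%:Z - (k : nat)%:Z = ((l - k).-1.+1 : int).
  by rewrite prednK ?subn_gt0// subzn// ltnW.
by rewrite fourier_pos// mulr0.
Qed.

Lemma rcont_dirichlet N phi : rcont (fun t => dirichlet N (phi - t)).
Proof.
apply: rcont_sum => k.
apply: (@rcont_eq _ (fun t => ecirc (- k%:R * t + k%:R * phi))); last exact: rcont_ecirc.
by move=> t; rewrite -ecircMn -[(phi - t) *+ k]mulr_natl mulrBr addrC mulNr.
Qed.

Lemma cont_dirichlet2 N phi : continuous (fun t => cn (dirichlet N (phi - t)) ^+ 2).
Proof.
move=> x; apply: (@continuous_comp _ _ _ (fun t => cn (dirichlet N (phi - t))) (fun y => y ^+ 2)).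
  exact: (rcont_cn (@rcont_dirichlet N phi)).
exact: exprn_continuous.
Qed.

(** The mass of the kernel is read off from the Fejer mean of the constant 1, where only the
    diagonal terms k = l remain. *)
Lemma RI_dirichlet N phi :
  RI (fun t => cn (dirichlet N (phi - t)) ^+ 2) 0 (pi *+ 2) = N%:R * (pi *+ 2).
Proof.
have e1 : entire (fun _ : C => 1 : C) by exact: entire_cst.
have E := @fejerE (fun _ => 1) N 0 phi e1.
have <- : complex.Re (fejer (fun _ => 1 : C) N).[cexp (0 +i* phi)%C] =
    RI (fun t => cn (dirichlet N (phi - t)) ^+ 2) 0 (pi *+ 2).
  by rewrite E; apply: RI_eq => t _; rewrite mul1r.
rewrite /fejer horner_sum.
transitivity (complex.Re (\sum_(k < N) (pi *+ 2)%:C%C : C)).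
  congr complex.Re; apply: eq_bigr => k _; rewrite horner_sum (bigD1 k)//= big1 => [|l lk].
    by rewrite leqnn subnn hornerZ hornerXn expr0 mulr1 addr0 fourier_cst1.
  case: leqP => [lk'|_]; last by rewrite horner0.
  rewrite hornerZ fourier_cst1 oppr_eq0 eqz_nat subn_eq0 leqNgt ltn_neqAle lk' andbT.
  by rewrite val_eqE lk mul0r.
by rewrite sumr_const card_ord -rmorphMn /= mulr_natl.
Qed.

(** This property replaces power series: results on polynomials pass to entire functions through
    it. *)
Definition poly_approximable f := forall rho eps : R, 0 < eps ->
  exists S : {poly C}, forall z, cn z <= rho -> cn (f z - S.[z]) <= eps.

Lemma polarP (z : C) : z != 0 -> exists s t, z = cexp (s +i* t)%C.
Proof.
rewrite -cn_gt0 => z0; pose r := cn z.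
pose a := complex.Re z / r; pose b := complex.Im z / r.
have ab : a ^+ 2 + b ^+ 2 = 1.
  by rewrite /a /b !expr_div_n -mulrDl -cn_sqr divff// expf_neq0// gt_eqF.
have a1 : -1 <= a <= 1.
  rewrite -ler_norml -(@ler_pXn2r _ 2) ?nnegrE// real_normK ?num_real// expr1n -ab.
  by rewrite lerDl sqr_ge0.
have ca : cos (acos a) = a by rewrite acosK// in_itv.
have sb : sin (acos a) ^+ 2 = b ^+ 2.
  by apply: (addrI (a ^+ 2)); rewrite ab -{1}ca cos2Dsin2.
have zE t : cos t = a -> sin t = b -> z = cexp (ln r +i* t)%C.
  move=> ct st; rewrite /cexp /= lnK ?posrE// ct st /a /b ![r * _]mulrC !divfK ?gt_eqF//.
  by case: (z).
exists (ln r); move/eqP: sb; rewrite eqf_sqr => /orP[]/eqP sb.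
  by exists (acos a); apply: zE.
by exists (- acos a); apply: zE; rewrite ?cosN// sinN sb opprK.
Qed.

Lemma square_cover (P : R -> R -> R -> R -> Prop) (rho : R) : 0 < rho ->
  (forall x y a b, 0 < a -> 0 < b -> P x y a b -> P (x + a) y a b ->
     P x (y + b) a b -> P (x + a) (y + b) a b -> P x y (a + a) (b + b)) ->
  (forall x y, exists2 delta, 0 < delta & forall x' y' a b, 0 < a < delta ->
     0 < b < delta -> x' <= x <= x' + a -> y' <= y <= y' + b -> P x' y' a b) ->
  P (- rho) (- rho) (rho + rho) (rho + rho).
Proof. by move=> rho0 h1 h2; apply: dyadic_descent => //; rewrite addr_gt0. Qed.

Lemma disc_in_square (rho : R) (z : C) : cn z <= rho ->
  - rho <= complex.Re z <= - rho + (rho + rho) /\ - rho <= complex.Im z <= - rho + (rho + rho).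
Proof.
move=> zr; have := le_trans (cn_Re z) zr; have := le_trans (cn_Im z) zr.
by rewrite !ler_norml addKr.
Qed.

Lemma entire_bounded f rho : entire f -> 0 < rho ->
  exists M, forall z, cn z <= rho -> cn (f z) <= M.
Proof.
move=> ef rho0; have cf := cderiv_cont (entire_cderiv ef).
have [M hM] : exists M, forall s t, - rho <= s <= - rho + (rho + rho) ->
   - rho <= t <= - rho + (rho + rho) -> cn (f (s +i* t)%C) <= M.
  apply: (@square_cover (fun x y a b => exists M, forall s t, x <= s <= x + a ->
     y <= t <= y + b -> cn (f (s +i* t)%C) <= M)) => //.
  - move=> x y a b a0 b0 [M1 h1] [M2 h2] [M3 h3] [M4 h4].
    exists (Num.max (Num.max M1 M2) (Num.max M3 M4)) => s t /andP[s1 s2] /andP[t1 t2].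
    rewrite !le_max; case: (leP s (x + a)) => sa; case: (leP t (y + b)) => tb.
    + by rewrite h1 ?s1 ?t1.
    + by rewrite h3 ?orbT ?s1 ?(ltW tb)//= -addrA.
    + by rewrite h2 ?orbT ?t1 ?(ltW sa)//= -addrA.
    + by rewrite h4 ?orbT ?(ltW sa) ?(ltW tb)//= -addrA.
  - move=> x y; have [d d0 hd] := cf (x +i* y)%C 1 ltr01.
    exists (d / 4) => [|x' y' a b /andP[a0 ad] /andP[b0 bd] hx hy]; first by rewrite divr_gt0.
    exists (cn (f (x +i* y)%C) + 1) => s t hs ht.
    rewrite -[X in cn X](subrK (f (x +i* y)%C)) addrC; apply: le_trans (cnD _ _) _.
    rewrite lerD2l; have := hd ((s +i* t)%C - (x +i* y)%C).
    rewrite (_ : (x +i* y)%C + _ = (s +i* t)%C); last by ring.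
    apply; apply: le_lt_trans (cn_le_ReIm _) _ => /=.
    have k1 : `|s - x| < d / 4 by rewrite ltr_norml; lra.
    have k2 : `|t - y| < d / 4 by rewrite ltr_norml; lra.
    lra.
exists M => z /disc_in_square[h1 h2].
by case: z h1 h2 => a b /= h1 h2; exact: hM.
Qed.

Lemma entire_unif_cont f rho eps : entire f -> 0 < rho -> 0 < eps ->
  exists2 delta, 0 < delta & forall z w, cn z <= rho -> cn (w - z) < delta ->
    cn (f w - f z) <= eps.
Proof.
move=> ef rho0 eps0; have cf := cderiv_cont (entire_cderiv ef).
have [d d0 hd] : exists2 delta, 0 < delta & forall s t w, - rho <= s <= - rho + (rho + rho) ->
   - rho <= t <= - rho + (rho + rho) -> cn (w - (s +i* t)%C) < delta ->
   cn (f w - f (s +i* t)%C) <= eps.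
  apply: (@square_cover (fun x y a b => exists2 delta, 0 < delta &
     forall s t w, x <= s <= x + a ->
     y <= t <= y + b -> cn (w - (s +i* t)%C) < delta -> cn (f w - f (s +i* t)%C) <= eps)) => //.
  - move=> x y a b a0 b0 [M1 p1 h1] [M2 p2 h2] [M3 p3 h3] [M4 p4 h4].
    exists (Num.min (Num.min M1 M2) (Num.min M3 M4)).
      by rewrite !lt_min p1 p2 p3 p4.
    move=> s t w /andP[s1 s2] /andP[t1 t2].
    rewrite !lt_min => /andP[/andP[q1 q2] /andP[q3 q4]].
    case: (leP s (x + a)) => sa; case: (leP t (y + b)) => tb.
    + by apply: h1; rewrite ?s1 ?t1.
    + by apply: h3; rewrite ?s1 ?(ltW tb)//= -addrA.
    + by apply: h2; rewrite ?t1 ?(ltW sa)//= -addrA.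
    + by apply: h4; rewrite ?(ltW sa) ?(ltW tb)//= -addrA.
  - move=> x y; have e20 : 0 < eps / 2 by rewrite divr_gt0.
    have [d d0 hd] := cf (x +i* y)%C _ e20.
    exists (d / 8) => [|x' y' a b /andP[a0 ad] /andP[b0 bd] hx hy]; first by rewrite divr_gt0.
    exists (d / 8) => [|s t w hs ht hw]; first by rewrite divr_gt0.
    have k3 : cn ((s +i* t)%C - (x +i* y)%C) < d / 2.
      apply: le_lt_trans (cn_le_ReIm _) _ => /=.
      have k1 : `|s - x| < d / 8 by rewrite ltr_norml; lra.
      have k2 : `|t - y| < d / 8 by rewrite ltr_norml; lra.
      lra.
    have k4 : cn (w - (x +i* y)%C) < d.
      rewrite (_ : w - _ = (w - (s +i* t)%C) + ((s +i* t)%C - (x +i* y)%C)); last by ring.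
      by apply: le_lt_trans (cnD _ _) _; lra.
    have := hd _ k4; rewrite (_ : (x +i* y)%C + _ = w); last by ring.
    have := hd ((s +i* t)%C - (x +i* y)%C).
    rewrite (_ : (x +i* y)%C + _ = (s +i* t)%C); last by ring.
    have k5 : cn ((s +i* t)%C - (x +i* y)%C) < d by lra.
    move=> /(_ k5) g1 g2.
    rewrite (_ : f w - _ = (f w - f (x +i* y)%C) - (f (s +i* t)%C - f (x +i* y)%C)); last by ring.
    by apply: le_trans (cnD _ _) _; rewrite cnN; lra.
exists d => // z w /disc_in_square[h1 h2].
by case: z h1 h2 => a b /= h1 h2; exact: hd.
Qed.

(** Points closer than [d] contribute [eps] times the total mass, of order N. At the others the
    chord bound gives a kernel of at most 4 e^(2s)/d^2, whatever [N], against a variation of at most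
    2 M. *)
Lemma fejer_error f (M d eps s phi : R) N : entire f -> 0 < d -> 0 <= M -> 0 < eps ->
  (forall t, cn (f (cexp (s +i* t)%C)) <= M) ->
  (forall t, cn (cexp (s +i* t)%C - cexp (s +i* phi)%C) < d ->
     cn (f (cexp (s +i* t)%C) - f (cexp (s +i* phi)%C)) <= eps) ->
  cn ((fejer f N).[cexp (s +i* phi)%C] - (N%:R * (pi *+ 2))%:C%C * f (cexp (s +i* phi)%C))
    <= 2 * (eps * (N%:R * (pi *+ 2)) + 8 * M / d ^+ 2 * expR s ^+ 2 * (pi *+ 2)).
Proof.
move=> ef d0 M0 e0 hM hd.
pose D t := (cn (dirichlet N (phi - t)) ^+ 2).
have cD : continuous D by exact: cont_dirichlet2.
have rD : rcont (fun t => (D t)%:C%C) by exact: rcont_real.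
pose fz := f (cexp (s +i* phi)%C).
have -> : (fejer f N).[cexp (s +i* phi)%C] - (N%:R * (pi *+ 2))%:C%C * fz =
   CI (fun t => f (cexp (s +i* t)%C) * (D t)%:C%C + (- fz) * (D t)%:C%C) 0 (pi *+ 2).
  rewrite CID; last 2 first.
  - by apply: rcontM => //; exact: rcont_circ.
  - by apply: rcontM => //; exact: rcont_cst.
  rewrite CIZ// fejerE// mulNr; congr (_ - _); rewrite mulrC; congr (_ * _).
  apply/eqP; rewrite eq_complex /= RI_dirichlet RI_cst ?ltW ?pi2_gt0//.
  by rewrite mul0r !eqxx.
have -> : eps * (N%:R * (pi *+ 2)) + 8 * M / d ^+ 2 * expR s ^+ 2 * (pi *+ 2) =
   RI (fun t => eps * D t + 8 * M / d ^+ 2 * expR s ^+ 2) 0 (pi *+ 2).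
  rewrite RID; last 2 first.
  - by move=> x; apply: cvgMr; exact: cD.
  - exact: (@cst_continuous _ _ (8 * M / d ^+ 2 * expR s ^+ 2 : R)).
  by rewrite RIZ// RI_dirichlet RI_cst ?ltW ?pi2_gt0// subr0.
apply: CI_le.
- apply: rcontD; apply: rcontM => //; [exact: rcont_circ|exact: rcont_cst].
- move=> x; apply: cvgD; last exact: cvg_cst.
  by apply: cvgMr; exact: cD.
- by rewrite ltW// pi2_gt0.
move=> t _; rewrite -mulrDl cnM cn_real ger0_norm ?sqr_ge0//.
have D0 : 0 <= D t by rewrite sqr_ge0.
have d20 : 0 < d ^+ 2 by rewrite exprn_gt0.
have K0 : 0 <= 8 * M / d ^+ 2 * expR s ^+ 2.
  by rewrite mulr_ge0 ?sqr_ge0// divr_ge0 ?mulr_ge0// ltW.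
have [lt_d|ge_d] := ltP (cn (cexp (s +i* t)%C - cexp (s +i* phi)%C)) d.
  by have := ler_wpM2r D0 (hd _ lt_d); rewrite /fz; lra.
have h1 : cn (f (cexp (s +i* t)%C) - fz) <= 2 * M.
  apply: le_trans (cnD _ _) _; rewrite cnN; have := hM t; have := hM phi; rewrite /fz; lra.
have chord := ecirc_chord N (phi - t).
have E : cn (cexp (s +i* t)%C - cexp (s +i* phi)%C) = expR s * cn (ecirc (phi - t) - 1).
  rewrite !cexpE -mulrBr cnM cn_real ger0_norm ?expR_ge0//; congr (_ * _).
  rewrite (_ : ecirc t - _ = - ecirc t * (ecirc (phi - t) - 1)).
    by rewrite cnM cnN cn_ecirc mul1r.
  by rewrite ecircD ecircN; field; exact: ecirc_neq0.
have h2 : d ^+ 2 * D t <= 4 * expR s ^+ 2.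
  apply: (@le_trans _ _ ((expR s * cn (ecirc (phi - t) - 1)) ^+ 2 * D t)).
    by apply: ler_wpM2r => //; rewrite ler_pXn2r ?nnegrE ?(ltW d0)// -?E ?cn_ge0.
  by rewrite exprMn -mulrA mulrC; apply: ler_wpM2r; rewrite ?sqr_ge0.
have h3 : D t <= 4 * expR s ^+ 2 / d ^+ 2 by rewrite ler_pdivlMr// mulrC.
apply: le_trans (ler_pM (cn_ge0 _) D0 h1 h3) _.
rewrite (_ : 2 * M * _ = 8 * M / d ^+ 2 * expR s ^+ 2); last by ring.
by rewrite lerDr mulr_ge0// ltW.
Qed.

(** After division by 2 pi N the far contribution is O(1/N), uniformly over the radii e^s <= rho. *)
Lemma entire_poly_approximable f : entire f -> poly_approximable f.
Proof.
move=> ef rho0 eps e0; pose rho := Num.max rho0 1.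
have rho_gt0 : 0 < rho by rewrite lt_max ltr01 orbT.
have [M0 hM0] := entire_bounded ef rho_gt0.
pose M := Num.max M0 0.
have M_ge0 : 0 <= M by rewrite le_max lexx orbT.
have hM z : cn z <= rho -> cn (f z) <= M by move=> /hM0 h; rewrite le_max h.
have e40 : 0 < eps / 8 by rewrite divr_gt0.
have [d d0 hd] := entire_unif_cont ef rho_gt0 e40.
pose K := 16 * M / d ^+ 2 * rho ^+ 2.
have K0 : 0 <= K by rewrite /K mulr_ge0 ?sqr_ge0// mulr_ge0 ?invr_ge0 ?sqr_ge0// mulr_ge0.
pose N := (Num.bound (K / (eps / 4))).+1.
have N0 : 0 < N%:R :> R by rewrite ltr0n.
have KN : K / N%:R <= eps / 4.
  rewrite ler_pdivrMr// mulrC -ler_pdivrMr ?divr_gt0//.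
  apply: (@le_trans _ _ (Num.bound (K / (eps / 4)))%:R).
    by apply/ltW/archi_boundP; rewrite divr_ge0// ltW// divr_gt0.
  by rewrite ler_nat.
pose c : R := N%:R * (pi *+ 2).
have c0 : 0 < c by rewrite mulr_gt0// pi2_gt0.
pose S := (c^-1)%:C%C *: fejer f N.
have main z : z != 0 -> cn z <= rho -> cn (f z - S.[z]) <= eps / 2.
  move=> /polarP[s [phi zE]] zr.
  have sr : expR s <= rho by move: zr; rewrite zE cn_cexp.
  have H := @fejer_error f M d (eps / 8) s phi N ef d0 M_ge0 e40.
  rewrite -cnN opprB hornerZ.
  rewrite -zE in H; set A := (fejer f N).[z]; rewrite -/A in H.
  have -> : (c^-1)%:C%C * A - f z = (c^-1)%:C%C * (A - c%:C%C * f z).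
    by rewrite mulrBr mulrA -rmorphM mulVf ?gt_eqF// mul1r.
  rewrite cnM cn_real ger0_norm ?invr_ge0 ?(ltW c0)// mulrC ler_pdivrMr//.
  apply: le_trans (H _ _) _.
  - by move=> t; apply: hM; rewrite cn_cexp.
  - by move=> t; apply: hd.
  rewrite -/c; have h1 : 8 * M / d ^+ 2 * expR s ^+ 2 <= K / 2.
    rewrite /K (_ : _ / 2 = 8 * M / d ^+ 2 * rho ^+ 2); last by field; rewrite gt_eqF.
    apply: ler_wpM2l; first by rewrite mulr_ge0 ?invr_ge0 ?sqr_ge0// mulr_ge0.
    by rewrite ler_pXn2r ?nnegrE ?expR_ge0 ?(ltW rho_gt0)//.
  have h2 := ler_wpM2r (ltW (@pi2_gt0 R)) h1.
  have h3 : K * (pi *+ 2) <= eps / 4 * c.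
    by rewrite /c mulrA; apply: ler_wpM2r; [exact: ltW (@pi2_gt0 R)|rewrite -ler_pdivrMr].
  lra.
exists S => z zr; have zr' : cn z <= rho by rewrite le_max zr.
(* The origin has no logarithm, so it is reached from a nearby point by continuity; hence the margin
   eps/2 above. *)
have [->|z0] := eqVneq z 0; last by apply: le_trans (main _ z0 zr') _; lra.
have cg : ccont (fun z => f z - S.[z]).
  apply: cderiv_cont; apply: entire_cderiv.
  have e1 := @entireM _ (fun _ => -1) (horner S) (@entire_cst _ (-1)) (@entire_horner _ S).
  have := @entireD _ f (fun z => -1 * S.[z]) ef e1.
  by congr entire; apply/funext => w; rewrite mulN1r.
have e20 : 0 < eps / 2 by rewrite divr_gt0.
have [r r0 hr] := cg 0 _ e20.
pose h : R := Num.min (r / 2) 1.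
have h0 : 0 < h by rewrite lt_min ltr01 divr_gt0.
have hh : cn (h%:C%C : C) = h by rewrite cn_real gtr0_norm.
have := hr h%:C%C; rewrite hh add0r => /(_ _) H1.
have {}H1 := H1 (le_lt_trans (_ : h <= r / 2) _).
have k1 : cn (f h%:C%C - S.[h%:C%C] - (f 0 - S.[0])) <= eps / 2.
  apply: H1; first by rewrite ge_min lexx.
  by rewrite ltr_pdivrMr// mulr_natr mulr2n ltrDl.
have k2 : cn (f h%:C%C - S.[h%:C%C]) <= eps / 2.
  apply: main; first by rewrite -cn_gt0 hh.
  by rewrite hh (@le_trans _ _ 1)//; [rewrite ge_min lexx orbT|rewrite le_max lexx orbT].
rewrite (_ : f 0 - S.[0] = (f h%:C%C - S.[h%:C%C]) - (f h%:C%C - S.[h%:C%C] - (f 0 - S.[0]))); last by ring.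
by apply: le_trans (cnD _ _) _; rewrite cnN; lra.
Qed.

End FejerApproximation.

(** * Maximum principle and Phragmen-Lindelof *)

Section RootsOfUnity.
Context {R : realType}.
Local Notation C := R[i].

Lemma ecirc_eq1 (x : R) : 0 < x < pi *+ 2 -> ecirc x != 1.
Proof.
move=> /andP[x0 xpi]; apply/eqP => /(congr1 (@complex.Re R)).
rewrite /ecirc /cexp /= expR0 mul1r (_ : x = (x / 2) *+ 2); last first.
  by rewrite -mulr_natr divfK.
rewrite cos_mulr2n cos2sin2 => h.
have : 0 < sin (x / 2).
  by apply: sin_gt0_pi; rewrite divr_gt0//= ltr_pdivrMr// mulr_natr.
by move/(exprn_gt0 2); lra.
Qed.

Definition uroot (N : nat) : C := ecirc (pi *+ 2 / N%:R).

Lemma cn_uroot N k : cn (uroot N ^+ k) = 1.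
Proof. by rewrite cnX cn_ecirc expr1n. Qed.

Lemma uroot_neq0 N k : uroot N ^+ k != 0.
Proof. by rewrite expf_neq0// ecirc_neq0. Qed.

Lemma urootN N : (0 < N)%N -> uroot N ^+ N = 1.
Proof.
move=> N0; rewrite /uroot -ecircMn -[(_ / _) *+ N]mulr_natr divfK ?pnatr_eq0 -?lt0n//.
by have := @ecirc_2pi R 1; rewrite mul1r.
Qed.

Lemma uroot_neq1 N m : (0 < m < N)%N -> uroot N ^+ m != 1.
Proof.
move=> /andP[m0 mN]; have N0 : (0 < N)%N by apply: leq_ltn_trans mN.
rewrite /uroot -ecircMn -[(_ / _) *+ m]mulr_natr; apply: ecirc_eq1.
rewrite !mulr_gt0 ?invr_gt0 ?ltr0n ?pi2_gt0//=.
by rewrite mulrAC ltr_pdivrMr ?ltr0n// ltr_pM2l ?pi2_gt0// ltr_nat.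
Qed.

Lemma uroot_inj N i j : (i < N)%N -> (j < N)%N -> uroot N ^+ i = uroot N ^+ j -> i = j.
Proof.
move=> iN jN; wlog ij : i j iN jN / (i < j)%N.
  by move=> H; case: (ltngtP i j) => // ij e; [exact: H|apply/esym/H].
rewrite -(subnK (ltnW ij)) exprD => /esym/eqP.
rewrite -[X in _ == X]mul1r (inj_eq (mulIf (uroot_neq0 N i))).
by rewrite (negbTE (uroot_neq1 _)) // subn_gt0 ij (leq_ltn_trans (leq_subr _ _)).
Qed.

Lemma uroot_ortho N i j : (i < N)%N -> (j < N)%N ->
  \sum_(k < N) (uroot N ^+ j) ^+ k * ((uroot N ^+ i) ^+ k)^-1 = (if i == j then N%:R else 0).
Proof.
move=> iN jN; have N0 : (0 < N)%N by apply: leq_ltn_trans iN.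
case: eqP => [->|ij].
  rewrite (eq_bigr (fun _ => 1)); last by move=> k _; rewrite divff// expf_neq0// uroot_neq0.
  by rewrite sumr_const card_ord.
pose b := uroot N ^+ j / uroot N ^+ i.
have b1 : b != 1.
  apply/eqP => /(congr1 (fun x => x * uroot N ^+ i)); rewrite mul1r /b divfK ?uroot_neq0//.
  by move/(uroot_inj jN iN) => /esym.
rewrite (eq_bigr (fun k : 'I_N => b ^+ k)); last first.
  by move=> k _; rewrite /b exprMn exprVn.
apply: (@mulfI _ (b - 1)); first by rewrite subr_eq0.
rewrite -subrX1 mulr0 /b expr_div_n -!exprM mulnC exprM [(i * N)%N]mulnC exprM urootN//.
by rewrite !expr1n divr1 subrr.
Qed.

(** Cauchy's coefficient formula as a finite sum: discrete Fourier inversion is exact once [N]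
    exceeds the degree. *)
Lemma coef_uroot (q : {poly C}) N (r : C) i : (size q <= N)%N -> (i < N)%N ->
  \sum_(k < N) q.[r * uroot N ^+ k] * ((uroot N ^+ i) ^+ k)^-1 = N%:R * (q`_i * r ^+ i).
Proof.
move=> qN iN.
rewrite (eq_bigr (fun k : 'I_N => \sum_(j < N) q`_j * r ^+ j *
   ((uroot N ^+ j) ^+ k * ((uroot N ^+ i) ^+ k)^-1))); last first.
  move=> k _; rewrite (horner_coef_wide _ qN) mulr_suml; apply: eq_bigr => j _.
  rewrite exprMn -!exprM [(k * j)%N]mulnC; ring.
rewrite exchange_big /= (bigD1 (Ordinal iN))//= [X in _ + X]big1 => [|j ji].
  by rewrite -mulr_sumr uroot_ortho// eqxx addr0 mulrC.
rewrite -mulr_sumr uroot_ortho//; case: eqP => [e|_]; last by rewrite mulr0.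
by case/eqP: ji; apply/val_inj.
Qed.

Lemma cauchy_coef (q : {poly C}) (r B : R) i : 0 <= r ->
  (forall z, cn z = r -> cn q.[z] <= B) -> cn q`_i * r ^+ i <= B.
Proof.
move=> r0 hB; have B0 : 0 <= B.
  by apply: le_trans (cn_ge0 _) (hB r%:C%C _); rewrite cn_real ger0_norm.
have [iq|qi] := ltnP i (size q); last by rewrite nth_default// cn0 mul0r.
have N0 : 0 < (size q)%:R :> R by rewrite ltr0n; apply: leq_ltn_trans iq.
rewrite -(ler_pM2l N0) -[X in X ^+ i](ger0_norm r0) -cn_real -cnX -cnM -cn_nat -cnM.
rewrite -coef_uroot//; apply: le_trans (cn_sum _ _ _) _.
apply: (@le_trans _ _ (\sum_(k < size q) B)).
  apply: ler_sum => k _; rewrite cnM cnV -exprM cn_uroot invr1 mulr1.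
  by apply: hB; rewrite cnM cn_uroot mulr1 cn_real ger0_norm.
by rewrite sumr_const card_ord cn_nat mulr_natl.
Qed.

Lemma mean_value_uroot (q : {poly C}) N (z0 r : C) : (size q <= N)%N -> (0 < N)%N ->
  \sum_(k < N) q.[z0 + r * uroot N ^+ k] = N%:R * q.[z0].
Proof.
move=> qN N0; pose Q := q \Po ('X + z0%:P).
have QN : (size Q <= N)%N by rewrite size_comp_poly2 ?size_XaddC.
have := coef_uroot r QN N0; rewrite expr0 mulr1 -horner_coef0 /Q horner_comp !hornerE => <-.
by apply: eq_bigr => k _; rewrite horner_comp !hornerE expr1n invr1 mulr1 addrC.
Qed.

Lemma sum_Re_uroot N : (1 < N)%N -> \sum_(k < N) complex.Re (uroot N ^+ k) = 0.
Proof.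
move=> N1; have N0 := ltnW N1.
have X2 : (size ('X : {poly C}) <= N)%N by rewrite size_polyX.
have := mean_value_uroot 0 1 X2 N0; rewrite hornerX mulr0.
move=> /(congr1 (@complex.Re R)); rewrite raddf_sum /= => E.
by rewrite -[RHS]E; apply: eq_bigr => k _; rewrite hornerX add0r mul1r.
Qed.

End RootsOfUnity.

(** * The maximum principle for polynomials *)

Section MaximumModulus.
Context {R : realType}.
Local Notation C := R[i].

(** |q|^2 is subharmonic and eta Re^2 strictly so: the average over the N-th roots of unity, scaled
    by [r] and centred at [z0], exceeds the central value by at least eta r^2 / N. The strictness
    excludes interior maxima. *)
Lemma strict_subharmonic (q : {poly C}) (z0 : C) (r eta : R) : 0 < r -> 0 < eta ->
  exists z, cn (z - z0) = r /\
    cn q.[z0] ^+ 2 + eta * complex.Re z0 ^+ 2 < cn q.[z] ^+ 2 + eta * complex.Re z ^+ 2.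
Proof.
move=> r0 eta0; pose N := (size q).+2; apply: contrapT => H.
pose z k := z0 + r%:C%C * uroot N ^+ k.
have zk k : cn q.[z k] ^+ 2 + eta * complex.Re (z k) ^+ 2 <=
    cn q.[z0] ^+ 2 + eta * complex.Re z0 ^+ 2.
  rewrite leNgt; apply/negP => h; apply: H; exists (z k); split => //.
  by rewrite /z addrAC subrr add0r cnM cn_uroot mulr1 cn_real gtr0_norm.
have qN : (size q <= N)%N by rewrite /N leqW// leqW.
pose m := cn q.[z0].
have S1 : N%:R * m ^+ 2 <= \sum_(k < N) cn q.[z k] ^+ 2.
  have h1 : N%:R * m <= \sum_(k < N) cn q.[z k].
    rewrite /m -cn_nat -cnM -(mean_value_uroot z0 r%:C%C qN)//; exact: cn_sum.
  (* This is the sum of the inequalities (|q(z_k)| - m)^2 >= 0. *)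
  have h2 : 2 * m * \sum_(k < N) cn q.[z k] - N%:R * m ^+ 2 <= \sum_(k < N) cn q.[z k] ^+ 2.
    have -> : N%:R * m ^+ 2 = \sum_(k < N) m ^+ 2 by rewrite sumr_const card_ord mulr_natl.
    rewrite mulr_sumr -sumrB.
    apply: ler_sum => k _; rewrite -subr_ge0.
    by rewrite (_ : _ - _ = (cn q.[z k] - m) ^+ 2) ?sqr_ge0//; ring.
  apply: le_trans h2; have := ler_wpM2l (mulr_ge0 (ler0n R 2) (cn_ge0 q.[z0])) h1.
  rewrite -/m; lra.
have S2 : N%:R * complex.Re z0 ^+ 2 + r ^+ 2 <= \sum_(k < N) complex.Re (z k) ^+ 2.
  pose c k : R := complex.Re (uroot N ^+ k).
  have zE k : complex.Re (z k) = complex.Re z0 + r * c k.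
    by rewrite /z /c raddfD /=; case: (uroot N ^+ k) => a b /=; rewrite mul0r subr0.
  rewrite (eq_bigr (fun k : 'I_N => complex.Re z0 ^+ 2 + (2 * complex.Re z0 * r) * c k + r ^+ 2 * c k ^+ 2)); last first.
    by move=> k _; rewrite zE; ring.
  rewrite !big_split /= -!mulr_sumr sum_Re_uroot// mulr0 addr0 sumr_const card_ord mulr_natl.
  rewrite mulrnAr -expr2 lerD2l -[X in X <= _]mulr1; apply: ler_wpM2l; first exact: sqr_ge0.
  (* The root 1 alone already contributes 1 to the sum of the squared real parts. *)
  rewrite (bigD1 ord0)//= /c expr0 /= expr1n lerDl.
  by apply: sumr_ge0 => k _; exact: sqr_ge0.
have S3 : \sum_(k < N) (cn q.[z k] ^+ 2 + eta * complex.Re (z k) ^+ 2) <=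
   \sum_(k < N) (m ^+ 2 + eta * complex.Re z0 ^+ 2).
  by apply: ler_sum => k _; exact: zk.
rewrite sumr_const card_ord big_split /= -mulr_sumr -mulr_natl in S3.
have e1 := ler_wpM2l (ltW eta0) S2.
have e2 : 0 < eta * r ^+ 2 by rewrite mulr_gt0// exprn_gt0.
lra.
Qed.

Lemma horner_ccont (q : {poly C}) : ccont (horner q).
Proof. apply: cderiv_cont; apply: entire_cderiv; exact: entire_horner. Qed.

(** The maximum of |q|^2 + eta Re^2 over the square cannot be interior, since a small circle around
    it would carry a larger value; then [eta] tends to 0. *)
Lemma max_mod_square (q : {poly C}) (rho B : R) : 0 < rho ->
  (forall x y, 0 <= x <= rho -> 0 <= y <= rho ->
     [\/ x = 0, x = rho, y = 0 | y = rho] -> cn q.[(x +i* y)%C] <= B) ->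
  forall x y, 0 <= x <= rho -> 0 <= y <= rho -> cn q.[(x +i* y)%C] <= B.
Proof.
move=> rho0 hB x1 y1 hx1 hy1.
have B0 : 0 <= B.
  apply: le_trans (cn_ge0 _) (hB 0 0 _ _ _); rewrite ?lexx ?ltW//.
  by constructor 1.
suff H (eta : R) : 0 < eta -> cn q.[(x1 +i* y1)%C] ^+ 2 <= B ^+ 2 + eta * rho ^+ 2.
  rewrite -(@ler_pXn2r _ 2) ?nnegrE ?cn_ge0//; apply/ler_addgt0Pr => e e0.
  have r20 : 0 < rho ^+ 2 by rewrite exprn_gt0.
  by have := H _ (divr_gt0 e0 r20); rewrite divfK ?gt_eqF.
move=> eta0.
pose phi (p : R * R) : R := cn q.[(p.1 +i* p.2)%C] ^+ 2 + eta * p.1 ^+ 2.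
have cphi : continuous phi.
  have c1 : continuous (fun p : R * R => p.1) by move=> p; exact: cvg_fst.
  move=> p; apply: cvgD.
    apply: (@continuous_comp _ _ _ (fun p : R * R => cn q.[(p.1 +i* p.2)%C]) (fun y => y ^+ 2)).
      apply/cvgrPdist_le => eps /(horner_ccont q (p.1 +i* p.2)%C)[d d0 hd].
      have d20 : 0 < d / 2 by rewrite divr_gt0.
      have nb : nbhs p (ball p (d / 2)) by apply: (@nbhsx_ballx R (R * R)%type).
      apply: filterS nb => p' [/= b1 b2].
      rewrite distrC; apply: le_trans (cn_dist _ _) _.
      have := hd ((p'.1 +i* p'.2)%C - (p.1 +i* p.2)%C).
      rewrite (_ : (p.1 +i* p.2)%C + _ = (p'.1 +i* p'.2)%C); last by ring.
      apply; apply: le_lt_trans (cn_le_ReIm _) _ => /=.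
      by rewrite (splitr d) distrC ltrD// distrC.
    exact: exprn_continuous.
  apply: cvgMr.
  by apply: (@continuous_comp _ _ _ (fun p : R * R => p.1) (fun y => y ^+ 2)); [exact: c1|exact: exprn_continuous].
have cK : compact (`[0, rho]%classic `*` `[0, rho]%classic : set (R * R)).
  by apply: compact_setX; exact: segment_compact.
have K0 : (`[0, rho]%classic `*` `[0, rho]%classic : set (R * R)) !=set0.
  by exists (0, 0); split => /=; rewrite in_itv /= lexx ltW.
have [[a b] /set_mem[/= + +] hmax] := compact_EVT_max K0 cK (continuous_subspaceT cphi).
rewrite !in_itv /= => ha hb.
have {}hmax x y : 0 <= x <= rho -> 0 <= y <= rho -> phi (x, y) <= phi (a, b).
  by move=> hx hy; apply: hmax; apply/mem_set; split => /=; rewrite in_itv.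
have bnd x y : 0 <= x <= rho -> cn q.[(x +i* y)%C] <= B -> phi (x, y) <= B ^+ 2 + eta * rho ^+ 2.
  move=> /andP[x0 xr] h; rewrite /phi /=; apply: lerD.
    by rewrite ler_pXn2r ?nnegrE ?cn_ge0.
  by apply: ler_wpM2l; [exact: ltW|rewrite ler_pXn2r ?nnegrE// ltW].
apply: (@le_trans _ _ (phi (x1, y1))).
  by rewrite /phi /= lerDl mulr_ge0 ?sqr_ge0// ltW.
apply: le_trans (hmax _ _ hx1 hy1) _.
have [a0|a0] := eqVneq a 0; first by apply/bnd/hB => //; constructor 1.
have [b0|b0] := eqVneq b 0; first by apply/bnd/hB => //; constructor 3.
have [ar|ar] := eqVneq a rho; first by apply/bnd/hB => //; constructor 2.
have [br|br] := eqVneq b rho; first by apply/bnd/hB => //; constructor 4.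
case/andP: ha => ha1 ha2; case/andP: hb => hb1 hb2; exfalso.
have a0' : 0 < a by rewrite lt_def a0.
have b0' : 0 < b by rewrite lt_def b0.
have ar' : a < rho by rewrite lt_neqAle ar.
have br' : b < rho by rewrite lt_neqAle br.
pose r := Num.min (Num.min a (rho - a)) (Num.min b (rho - b)).
have r0 : 0 < r by rewrite !lt_min a0' b0' !subr_gt0 ar' br'.
have [z [zr]] := strict_subharmonic q (a +i* b)%C r0 eta0.
have ra : r <= a /\ r <= rho - a by rewrite /r !ge_min !lexx ?orbT.
have rb : r <= b /\ r <= rho - b by rewrite /r !ge_min !lexx ?orbT.
have := cn_Re (z - (a +i* b)%C); have := cn_Im (z - (a +i* b)%C); rewrite zr.
case: z {zr} => x y /=; rewrite !ler_norml => /andP[i1 i2] /andP[i3 i4] h.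
have hx : 0 <= x <= rho by apply/andP; lra.
have hy : 0 <= y <= rho by apply/andP; lra.
by move: (hmax x y hx hy); rewrite /phi /= leNgt h.
Qed.

End MaximumModulus.

(** * Phragmen-Lindelof for even functions *)

Section PhragmenLindelof.
Context {R : realType}.
Local Notation C := R[i].

Lemma le_expR_limit (a b : R) : 0 <= b -> (forall d, 0 < d -> a <= b * expR d) -> a <= b.
Proof.
move=> b0 H; apply/ler_addgt0Pr => e e0.
have b1 : 0 < b + 1 by rewrite ltr_wpDl.
have y0 : 0 < e / (b + 1) by rewrite divr_gt0.
have := H (ln (1 + e / (b + 1))); rewrite lnK ?posrE ?addr_gt0// => /(_ _) H1.
have := H1 _; rewrite ln_gt0 ?ltrDl// => /(_ isT) H2; apply: le_trans H2 _.
rewrite mulrDr mulr1 lerD2l mulrCA; apply: ler_piMr; first exact: ltW.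
by rewrite ler_pdivrMr// mul1r lerDl.
Qed.

(** The inequality 1 + v <= e^v at v = - u/(1 + u) gives e^(u/(1+u)) <= 1 + u. *)
Lemma expR_quad_lower (u : R) : `|u| <= 2^-1 -> expR (u - 2 * u ^+ 2) <= 1 + u.
Proof.
rewrite ler_norml => /andP[u1 u2].
have u0 : 0 < 1 + u by lra.
have h1 : u - 2 * u ^+ 2 <= u / (1 + u).
  rewrite ler_pdivlMr// -subr_ge0.
  rewrite (_ : _ - _ = u ^+ 2 * (1 + 2 * u)); last by ring.
  by rewrite mulr_ge0 ?sqr_ge0//; lra.
apply: (@le_trans _ _ (expR (u / (1 + u)))); first by rewrite ler_expR.
have h2 := expR_ge1Dx (- (u / (1 + u))).
rewrite -ler_pV2 ?inE ?unitfE ?gt_eqF ?expR_gt0//= -expRN.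
apply: le_trans h2; rewrite le_eqVlt; apply/orP; left; apply/eqP; field.
by rewrite gt_eqF.
Qed.

Lemma cn_1D (w : C) : cn (1 + w) ^+ 2 = 1 + 2 * complex.Re w + cn w ^+ 2.
Proof. by rewrite !cn_sqr; case: w => a b /=; ring. Qed.

(* Polynomial form of the maximum principle for [S * exp W]: [exp W] is replaced
   by [(1 + W / m) ^ m], whose modulus is controlled by that of [exp W]. *)
Lemma max_mod_exp (S W : {poly C}) (rho B : R) : 0 < rho -> 0 <= B ->
  (forall x y, 0 <= x <= rho -> 0 <= y <= rho ->
     [\/ x = 0, x = rho, y = 0 | y = rho] ->
     cn S.[(x +i* y)%C] * expR (complex.Re W.[(x +i* y)%C]) <= B) ->
  forall x y, 0 <= x <= rho -> 0 <= y <= rho ->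
    cn S.[(x +i* y)%C] * expR (complex.Re W.[(x +i* y)%C]) <= B.
Proof.
move=> rho0 B0 hB x1 y1 hx1 hy1.
have [K0 hK0] := entire_bounded (@entire_horner _ W) (mulr_gt0 (ltr0n R 2 : 0 < 2) rho0).
pose K := Num.max K0 1.
have K1 : 1 <= K by rewrite le_max lexx orbT.
have hK x y : 0 <= x <= rho -> 0 <= y <= rho -> cn W.[(x +i* y)%C] <= K.
  move=> hx hy; rewrite le_max hK0//; apply: le_trans (cn_le_ReIm _) _ => /=.
  by case/andP: hx => ? ?; case/andP: hy => ? ?; rewrite !ger0_norm//; lra.
have K2 : 0 < K ^+ 2 by rewrite exprn_gt0// (lt_le_trans ltr01).
(* Of the 9 K^2/m, one unit is lost on the boundary, where |1 + W/m|^(2m) is bounded above, and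
   eight at the interior point, where it is bounded below; m >= 4 K makes [expR_quad_lower]
   applicable there. *)
suff H (m : nat) : 4 * K <= m%:R -> cn S.[(x1 +i* y1)%C] ^+ 2 * expR (2 * complex.Re W.[(x1 +i* y1)%C]) <=
    B ^+ 2 * expR (9 * K ^+ 2 / m%:R).
  rewrite -(@ler_pXn2r _ 2) ?nnegrE ?mulr_ge0 ?cn_ge0 ?expR_ge0//.
  rewrite exprMn -expRM_natl; apply: le_expR_limit; first exact: sqr_ge0.
  move=> d d0.
  have dd : 0 <= 9 * K ^+ 2 / d.
    by rewrite divr_ge0 ?(ltW d0)// mulr_ge0 ?(ltW K2).
  have [m hm] : exists m : nat, 4 * K + 9 * K ^+ 2 / d < m%:R.
    by exists (Num.bound (4 * K + 9 * K ^+ 2 / d)); apply: archi_boundP; lra.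
  apply: le_trans (H m _) _; first by lra.
  apply: ler_wpM2l; first exact: sqr_ge0.
  rewrite ler_expR; have m0 : 0 < m%:R :> R by lra.
  by rewrite ler_pdivrMr// [d * _]mulrC -ler_pdivrMr//; lra.
move=> mK; have m0 : 0 < m%:R :> R by lra.
pose g : {poly C} := S * (1 + (m%:R^-1)%:C%C *: W) ^+ m.
have gE z : cn g.[z] ^+ 2 = cn S.[z] ^+ 2 *
    (1 + 2 * complex.Re W.[z] / m%:R + cn W.[z] ^+ 2 / m%:R ^+ 2) ^+ m.
  rewrite /g hornerM horner_exp cnM exprMn cnX -exprM mulnC exprM; congr (_ * _ ^+ _).
  rewrite hornerD hornerC hornerZ cn_1D cnM exprMn cn_real real_normK ?num_real//.
  rewrite (_ : complex.Re (_ * _) = m%:R^-1 * complex.Re W.[z]); last first.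
    by case: (W.[z]) => a b /=; rewrite mul0r subr0.
  by rewrite -exprVn; ring.
have main : cn g.[(x1 +i* y1)%C] <= B * expR (K ^+ 2 / m%:R / 2).
  apply: (@max_mod_square _ g rho) => // x y hx hy hxy.
  rewrite -(@ler_pXn2r _ 2) ?nnegrE ?mulr_ge0 ?cn_ge0 ?expR_ge0//.
  rewrite gE exprMn -expRM_natl.
  apply: (@le_trans _ _ (cn S.[(x +i* y)%C] ^+ 2 * expR (2 * complex.Re W.[(x +i* y)%C] + K ^+ 2 / m%:R))).
    apply: ler_wpM2l; first exact: sqr_ge0.
    rewrite (_ : 2 * _ + _ = m%:R * (2 * complex.Re W.[(x +i* y)%C] / m%:R + K ^+ 2 / m%:R ^+ 2)); last first.
      by field; rewrite gt_eqF.
    rewrite expRM_natl; apply: lerXn2r; rewrite ?nnegrE ?expR_ge0//.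
      rewrite -addrA; set u := complex.Re _; rewrite (_ : _ + _ = (1 + u / m%:R) ^+ 2 + (cn W.[(x +i* y)%C] ^+ 2 - u ^+ 2) / m%:R ^+ 2); last by field; rewrite gt_eqF.
      rewrite addr_ge0 ?sqr_ge0// divr_ge0 ?sqr_ge0// subr_ge0 -real_normK ?num_real//.
      by rewrite ler_pXn2r ?nnegrE ?cn_ge0// cn_Re.
    apply: le_trans (expR_ge1Dx _); rewrite -addrA lerD2l lerD2l ler_pM2r ?invr_gt0 ?exprn_gt0//.
    by rewrite ler_pXn2r ?nnegrE ?cn_ge0 ?hK//; lra.
  rewrite expRD mulrA (_ : 2 * (_ / 2) = K ^+ 2 / m%:R); last by field; rewrite gt_eqF.
  apply: ler_wpM2r; first exact: expR_ge0.
  rewrite expRM_natl -exprMn ler_pXn2r ?nnegrE ?mulr_ge0 ?cn_ge0 ?expR_ge0//.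
  exact: hB.
have {main} : cn g.[(x1 +i* y1)%C] ^+ 2 <= B ^+ 2 * expR (K ^+ 2 / m%:R).
  rewrite (_ : K ^+ 2 / m%:R = 2 * (K ^+ 2 / m%:R / 2)); last by field; rewrite gt_eqF.
  rewrite expRM_natl -exprMn ler_pXn2r ?nnegrE ?mulr_ge0 ?cn_ge0 ?expR_ge0//.
rewrite gE => main; set u := complex.Re W.[_] in main *.
have uK : `|u| <= K by apply: le_trans (cn_Re _) _; exact: hK.
have h1 : expR (2 * u - 8 * K ^+ 2 / m%:R) <=
   (1 + 2 * u / m%:R + cn W.[(x1 +i* y1)%C] ^+ 2 / m%:R ^+ 2) ^+ m.
  rewrite (_ : 2 * u - _ = m%:R * (2 * u / m%:R - 8 * K ^+ 2 / m%:R ^+ 2)); last first.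
    by field; rewrite gt_eqF.
  rewrite expRM_natl.
  have v1 : `|2 * u / m%:R| <= 2^-1.
    rewrite normrM normfV (ger0_norm (ltW m0)) ler_pdivrMr// normrM ger0_norm//.
    lra.
  have v2 := expR_quad_lower v1.
  apply: lerXn2r; rewrite ?nnegrE ?expR_ge0//.
    apply: addr_ge0; last by rewrite divr_ge0 ?sqr_ge0.
    by apply: le_trans v2; exact: expR_ge0.
  apply: (@le_trans _ _ (expR (2 * u / m%:R - 2 * (2 * u / m%:R) ^+ 2))).
    rewrite ler_expR lerD2l lerN2 (_ : 2 * _ ^+ 2 = 8 * u ^+ 2 / m%:R ^+ 2); last first.
      by field; rewrite gt_eqF.
    rewrite ler_pM2r ?invr_gt0 ?exprn_gt0// ler_pM2l//.
    by rewrite -real_normK ?num_real// ler_pXn2r ?nnegrE//; lra.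
  by apply: le_trans v2 _; rewrite lerDl divr_ge0 ?sqr_ge0.
have h2 := ler_wpM2l (sqr_ge0 (cn S.[(x1 +i* y1)%C])) h1.
have h3 := ler_wpM2r (expR_ge0 (8 * K ^+ 2 / m%:R)) (le_trans h2 main).
have E1 : expR (2 * u - 8 * K ^+ 2 / m%:R) * expR (8 * K ^+ 2 / m%:R) = expR (2 * u).
  by rewrite -expRD subrK.
have E2 : expR (K ^+ 2 / m%:R) * expR (8 * K ^+ 2 / m%:R) = expR (9 * K ^+ 2 / m%:R).
  by rewrite -expRD; congr expR; ring.
by move: h3; rewrite -[X in X <= _]mulrA -[X in _ <= X]mulrA E1 E2.
Qed.

(** On the imaginary axis the growth bound is itself the boundary bound: |exp(i sigma z)| cancels it
    exactly. Hence the constant [Num.max M K] and the same [sigma] in the conclusion. *)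
Lemma phragmen_quadrant (f : C -> C) (sigma M K : R) : poly_approximable f ->
  0 < sigma -> 0 <= M ->
  (forall z, cn (f z) <= K * expR (sigma * cn z)) ->
  (forall x : R, 0 <= x -> cn (f x%:C%C) <= M) ->
  forall x y, 0 <= x -> 0 <= y -> cn (f (x +i* y)%C) <= Num.max M K * expR (sigma * y).
Proof.
move=> fS sigma0 M0 fK fM x y x0 y0; pose B := Num.max M K.
have B0 : 0 <= B by rewrite le_max M0.
have MB : M <= B by rewrite le_max lexx.
have KB : K <= B by rewrite le_max lexx orbT.
rewrite -/B; apply: le_expR_limit; first by rewrite mulr_ge0 ?expR_ge0.
move=> d d0.
(* At the point considered, the damping exponent is at most c / rho; taking rho beyond c / d makes
   its cost at most [d]. *)
pose c := sigma * ((x ^+ 2 + y ^+ 2) ^+ 2 + 6 * x * y).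
have c0 : 0 <= c.
  by rewrite mulr_ge0 ?(ltW sigma0)// addr_ge0 ?sqr_ge0// !mulr_ge0.
pose rho := 1 + x + y + c / d.
have cd0 : 0 <= c / d by rewrite divr_ge0// ltW.
have rho1 : 1 <= rho by rewrite /rho -!addrA lerDl !addr_ge0.
have rho0 : 0 < rho by exact: lt_le_trans rho1.
(* On the square of side rho, Re w <= 0 on the real side, Re w <= - sigma t on the
   imaginary side and Re w <= - sigma (rho + t) or - sigma (rho + s) on the outer
   sides, which beats the growth of f; and w tends to i sigma z as rho grows. *)
pose w : {poly C} := (sigma%:C%C * 'i%C) *: 'X
   - ((sigma / rho ^+ 3)%:C%C *: 'X^4 - (3 * (sigma / rho))%:C%C * 'i%C *: 'X^2).
pose H s t := (s ^+ 4 - 6 * s ^+ 2 * t ^+ 2 + t ^+ 4) / rho ^+ 3 + 6 * s * t / rho.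
have wE s t : complex.Re w.[(s +i* t)%C] = - sigma * t - sigma * H s t.
  rewrite /w !hornerE /H; rewrite [_ ^+ 4]exprS [_ ^+ 3]exprS [_ ^+ 2]expr2 /=.
  by field; rewrite gt_eqF.
have main eps : 0 < eps -> cn (f (x +i* y)%C) * expR (complex.Re w.[(x +i* y)%C]) <=
    B + eps * (1 + expR (complex.Re w.[(x +i* y)%C])).
  move=> eps0; have [S hS] := fS (2 * rho) eps eps0.
  have hz s t : 0 <= s <= rho -> 0 <= t <= rho -> cn (s +i* t)%C <= s + t /\ cn (s +i* t)%C <= 2 * rho.
    move=> /andP[s0 s1] /andP[t0 t1]; have := cn_le_ReIm (s +i* t)%C.
    by rewrite /= !ger0_norm// => h; split => //; lra.
  have hxr : 0 <= x <= rho.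
    by rewrite x0 /= /rho; lra.
  have hyr : 0 <= y <= rho.
    by rewrite y0 /= /rho; lra.
  have bS : cn S.[(x +i* y)%C] * expR (complex.Re w.[(x +i* y)%C]) <= B + eps.
    apply: (@max_mod_exp S w rho) => //; first by rewrite addr_ge0// ltW.
    move=> s t hs ht hst; have [z1 z2] := hz s t hs ht.
    have Ss : cn S.[(s +i* t)%C] <= cn (f (s +i* t)%C) + eps.
      have -> : S.[(s +i* t)%C] = f (s +i* t)%C - (f (s +i* t)%C - S.[(s +i* t)%C]) by ring.
      by apply: le_trans (cnD _ _) _; rewrite cnN lerD2l; exact: hS.
    case/andP: hs => s0 s1; case/andP: ht => t0 t1.
    have r3 : 0 < rho ^+ 3 by rewrite exprn_gt0.
    have H0 : 0 <= H s t.
      (* In the scaled variables a b <= 1, so 6 a^2 b^2 is absorbed by 6 a b. *)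
      pose a := s / rho; pose b := t / rho.
      have HE : H s t = rho * (a ^+ 4 - 6 * a ^+ 2 * b ^+ 2 + b ^+ 4 + 6 * a * b).
        by rewrite /H /a /b; field; rewrite gt_eqF.
      have a0 : 0 <= a by rewrite divr_ge0// ltW.
      have b0 : 0 <= b by rewrite divr_ge0// ltW.
      have a1 : a <= 1 by rewrite ler_pdivrMr// mul1r.
      have b1 : b <= 1 by rewrite ler_pdivrMr// mul1r.
      rewrite HE mulr_ge0 ?(ltW rho0)//.
      have a4 : 0 <= a ^+ 4 by rewrite exprn_ge0.
      have b4 : 0 <= b ^+ 4 by rewrite exprn_ge0.
      have ab0 := mulr_ge0 a0 b0.
      have ab1 : a * b <= 1 by rewrite mulr_ile1.
      have : 6 * a ^+ 2 * b ^+ 2 <= 6 * a * b.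
        rewrite (_ : 6 * a ^+ 2 * b ^+ 2 = (6 * (a * b)) * (a * b)); last by ring.
        by rewrite -[leRHS]mulr1 -[6 * a * b]mulrA; apply: ler_wpM2l => //; rewrite mulr_ge0.
      lra.
    have w0 : complex.Re w.[(s +i* t)%C] <= 0.
      rewrite wE; have := mulr_ge0 (ltW sigma0) t0; have := mulr_ge0 (ltW sigma0) H0; lra.
    have e1 : expR (complex.Re w.[(s +i* t)%C]) <= 1 by rewrite -expR0 ler_expR.
    have h1 : cn (f (s +i* t)%C) * expR (complex.Re w.[(s +i* t)%C]) <= B.
      have K0 : 0 <= K.
        have := fK 0; rewrite cn0 mulr0 expR0 mulr1; exact: le_trans (cn_ge0 _).
      have big : rho <= H s t -> cn (f (s +i* t)%C) * expR (complex.Re w.[(s +i* t)%C]) <= B.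
        move=> hH; apply: le_trans KB.
        apply: le_trans (ler_wpM2r (expR_ge0 _) (fK _)) _.
        rewrite -mulrA -expRD ler_piMr// -expR0 ler_expR wE.
        have := ler_wpM2l (ltW sigma0) z1; have := ler_wpM2l (ltW sigma0) hH.
        have := ler_wpM2l (ltW sigma0) s1; lra.
      have side a : 0 <= a <= 1 -> rho <= rho * (1 - 6 * a ^+ 2 + a ^+ 4 + 6 * a).
        move=> /andP[a0 a1]; rewrite -[leLHS]mulr1; apply: ler_wpM2l; first exact: ltW.
        have a4 : 0 <= a ^+ 4 by rewrite exprn_ge0.
        have : a ^+ 2 <= a by rewrite expr2 ler_piMr.
        lra.
      have tr : 0 <= t / rho <= 1 by rewrite divr_ge0 ?(ltW rho0)//= ler_pdivrMr// mul1r.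
      have sr : 0 <= s / rho <= 1 by rewrite divr_ge0 ?(ltW rho0)//= ler_pdivrMr// mul1r.
      case: hst => [s00|s00|t00|t00].
      - rewrite s00; apply: le_trans KB.
        apply: le_trans (ler_wpM2r (expR_ge0 _) (fK _)) _.
        rewrite -mulrA -expRD ler_piMr// -expR0 ler_expR -s00 wE.
        have := ler_wpM2l (ltW sigma0) z1; have := mulr_ge0 (ltW sigma0) H0.
        by rewrite s00; lra.
      - apply: big; apply: le_trans (side _ tr) _; rewrite /H s00 le_eqVlt; apply/orP; left.
        by apply/eqP; field; rewrite gt_eqF.
      - apply: le_trans MB.
        apply: le_trans (ler_wpM2l (cn_ge0 _) e1) _; rewrite mulr1 t00.
        exact: fM.
      - apply: big; apply: le_trans (side _ sr) _; rewrite /H t00 le_eqVlt; apply/orP; left.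
        by apply/eqP; field; rewrite gt_eqF.
    apply: le_trans (ler_wpM2r (expR_ge0 _) Ss) _.
    rewrite mulrDl; apply: lerD => //.
    by rewrite ler_piMr// ltW.
  have fS2 : cn (f (x +i* y)%C) <= cn S.[(x +i* y)%C] + eps.
    have -> : f (x +i* y)%C = S.[(x +i* y)%C] + (f (x +i* y)%C - S.[(x +i* y)%C]) by ring.
    apply: le_trans (cnD _ _) _; rewrite lerD2l; apply: hS.
    by have [] := hz x y hxr hyr.
  apply: le_trans (ler_wpM2r (expR_ge0 _) fS2) _.
  by rewrite mulrDl mulrDr mulr1 addrA; apply: lerD.
have {}main : cn (f (x +i* y)%C) * expR (complex.Re w.[(x +i* y)%C]) <= B.
  apply/ler_addgt0Pr => e e0.
  have q0 : 0 < 1 + expR (complex.Re w.[(x +i* y)%C]) by rewrite addr_gt0// expR_gt0.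
  by have := main _ (divr_gt0 e0 q0); rewrite divfK// gt_eqF.
have Hd : sigma * H x y <= d.
  apply: (@le_trans _ _ (c / rho)).
    rewrite /c -mulrA; apply: ler_wpM2l; first exact: ltW.
    rewrite mulrDl /H; apply: lerD => //.
    apply: (@le_trans _ _ ((x ^+ 2 + y ^+ 2) ^+ 2 / rho ^+ 3)).
      rewrite ler_pM2r ?invr_gt0 ?exprn_gt0// -subr_ge0.
      rewrite (_ : _ - _ = 8 * (x * y) ^+ 2); last by ring.
      by rewrite mulr_ge0 ?sqr_ge0.
    apply: ler_wpM2l; first exact: sqr_ge0.
    rewrite lef_pV2 ?posrE ?exprn_gt0// -[leLHS]expr1.
    exact: ler_weXn2l.
  rewrite ler_pdivrMr// mulrC -ler_pdivrMr//.
  by rewrite /rho; lra.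
move: main; rewrite wE (_ : - sigma * y - sigma * H x y = - (sigma * y + sigma * H x y)); last by ring.
rewrite expRN -ler_pdivlMr ?invr_gt0 ?expR_gt0// invrK expRD.
move=> h; apply: le_trans h _; rewrite mulrA; apply: ler_wpM2l.
  by rewrite mulr_ge0 ?expR_ge0.
by rewrite ler_expR.
Qed.

Lemma conj_horner (q : {poly C}) (z : C) :
  (map_poly (@conjc R) q).[z] = (q.[z^*%C])^*%C.
Proof. by rewrite -[z in LHS]conjcK horner_map. Qed.

(** Conjugation turns the fourth quadrant into the first, and evenness turns the left half-plane
    into the right one. *)
Lemma phragmen_lindelof_even (f : C -> C) (sigma M K : R) : poly_approximable f ->
  (forall z, f (- z) = f z) -> 0 < sigma -> 0 <= M ->
  (forall z, cn (f z) <= K * expR (sigma * cn z)) ->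
  (forall x : R, 0 <= x -> cn (f x%:C%C) <= M) ->
  forall z, cn (f z) <= Num.max M K * expR (sigma * `|complex.Im z|).
Proof.
move=> fS fe sigma0 M0 fK fM.
pose g z := (f (z^*%C))^*%C.
have gS : poly_approximable g.
  move=> rho eps eps0; have [S hS] := fS rho eps eps0.
  exists (map_poly (@conjc R) S) => z zr.
  by rewrite conj_horner /g -rmorphB cn_conj; apply: hS; rewrite cn_conj.
have gK z : cn (g z) <= K * expR (sigma * cn z) by rewrite /g cn_conj -(cn_conj z); exact: fK.
have gM (x : R) : 0 <= x -> cn (g x%:C%C) <= M by rewrite /g cn_conj conjc_real; exact: fM.
have right x y : 0 <= x -> cn (f (x +i* y)%C) <= Num.max M K * expR (sigma * `|y|).
  move=> x0; have [y0|y0] := leP 0 y.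
    by rewrite ger0_norm//; exact: (phragmen_quadrant fS).
  rewrite ltr0_norm//; have := phragmen_quadrant gS sigma0 M0 gK gM x0 (_ : 0 <= - y).
  by rewrite /g cn_conj /= opprK; apply; rewrite oppr_ge0 ltW.
case=> x y /=; have [x0|x0] := leP 0 x; first exact: right.
rewrite -fe (_ : - (x +i* y)%C = ((- x) +i* (- y))%C)//.
by rewrite -normrN; apply: right; rewrite oppr_ge0 ltW.
Qed.

End PhragmenLindelof.

(** * Chebyshev expansions *)

Section Chebyshev.
Context {A : comNzRingType}.

Fixpoint cheb (n : nat) : {poly A} :=
  if n is n'.+1 then
    if n' is n''.+1 then 'X *+ 2 * cheb n' - cheb n'' else 'X
  else 1.

Lemma chebSS n : cheb n.+2 = 'X *+ 2 * cheb n.+1 - cheb n. Proof. by []. Qed.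

Lemma nat_ind2 (P : nat -> Prop) : P 0 -> P 1%N -> (forall n, P n -> P n.+1 -> P n.+2) ->
  forall n, P n.
Proof.
move=> P0 P1 PS n; suff : P n /\ P n.+1 by case.
by elim: n => [|n [h1 h2]]; split => //; exact: PS.
Qed.

Lemma size_cheb n : (size (cheb n) <= n.+1)%N.
Proof.
elim/nat_ind2: n => [||n IH1 IH2]; first by rewrite size_poly1.
  by rewrite size_polyX.
rewrite chebSS; apply: leq_trans (size_polyD _ _) _; rewrite size_polyN geq_max.
apply/andP; split; last by rewrite (leq_trans IH1)// leqW.
rewrite mulrnAl mulr2n.
apply: leq_trans (size_polyD _ _) _; rewrite maxnn mulrC.
apply: leq_trans (size_polyMleq _ _) _; rewrite size_polyX addn2 /=.
by rewrite ltnS.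
Qed.

Lemma coef_cheb_lead n : (cheb n.+1)`_n.+1 = 2 ^+ n.
Proof.
elim: n => [|n IH]; first by rewrite coefX expr0.
rewrite chebSS coefB mulrnAl coefMn coefXM /= IH.
rewrite [X in _ - X]nth_default ?subr0; last exact: leq_trans (size_cheb _) _.
by rewrite exprS mulr_natl.
Qed.

(** The identity T_n((z + 1/z)/2) = (z^n + z^-n)/2, stated without division so as to hold in any
    commutative ring. *)
Lemma cheb_half (z : A) w c n : z * w = 1 -> c *+ 2 = z + w ->
  (cheb n).[c] *+ 2 = z ^+ n + w ^+ n.
Proof.
move=> zw cE; elim/nat_ind2: n => [||n IH1 IH2].
- by rewrite hornerC !expr0.
- by rewrite hornerX !expr1.
rewrite chebSS hornerD hornerN mulrnBl IH1 mulrnAl hornerMn hornerM hornerX.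
rewrite (_ : c * _ *+ 2 *+ 2 = (c *+ 2) * ((cheb n.+1).[c] *+ 2)); last by ring.
rewrite cE IH2.
rewrite !mulrDl !mulrDr -!exprS.
have -> : z * w ^+ n.+1 = w ^+ n by rewrite exprS mulrA zw mul1r.
have -> : w * z ^+ n.+1 = z ^+ n by rewrite exprS mulrA [w * z]mulrC zw mul1r.
ring.
Qed.

End Chebyshev.
Arguments cheb {A} n.

Section ChebyshevTruncation.
Context {R : realType}.
Local Notation C := R[i].

Lemma cheb_joukowski (z : C) n : z != 0 ->
  (cheb n).[(z + z^-1) / 2] = (z ^+ n + z ^- n) / 2.
Proof.
move=> z0; have zw : z * z^-1 = 1 by rewrite divff.
have cE : ((z + z^-1) / 2) *+ 2 = z + z^-1.
  by rewrite -mulr_natr divfK// pnatr_eq0.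
have := cheb_half n zw cE; rewrite exprVn => <-.
by rewrite -[_.[_] *+ 2]mulr_natr mulfK// pnatr_eq0.
Qed.

Lemma ecirc_cos (t : R) : (ecirc t + (ecirc t)^-1) / 2 = (cos t)%:C%C.
Proof.
rewrite -ecircN -ecirc_conj addcJ mulrC mulKf ?pnatr_eq0//.
by rewrite /ecirc /cexp /= expR0 mul1r.
Qed.

Lemma cheb_cos (t : R) n : (cheb n).[(cos t)%:C%C] = (cos (t *+ n))%:C%C :> C.
Proof.
rewrite -ecirc_cos cheb_joukowski ?ecirc_neq0// -exprVn -ecircN -!ecircMn mulNrn ecircN.
exact: ecirc_cos.
Qed.

Lemma cheb_bound (x : R) n : -1 <= x <= 1 -> cn ((cheb n).[x%:C%C] : C) <= 1.
Proof.
move=> x1; rewrite -[x]acosK ?in_itv//= cheb_cos cn_real.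
by rewrite ler_norml cos_geN1 cos_le1.
Qed.

Lemma cheb_basis (q : {poly C}) D : (size q <= D)%N ->
  exists c : nat -> C, q = \sum_(k < D) c k *: cheb k.
Proof.
elim: D q => [|D IH] q qD.
  exists (fun _ => 0); rewrite big_ord0; apply/eqP; rewrite -size_poly_eq0.
  by move: qD; rewrite leqn0.
have lead0 : (cheb D : {poly C})`_D != 0.
  case: D {IH qD} => [|D]; first by rewrite coefC oner_eq0.
  by rewrite coef_cheb_lead expf_neq0// pnatr_eq0.
pose d := q`_D / (cheb D)`_D.
have q'D : (size (q - d *: cheb D)%R <= D)%N.
  apply/leq_sizeP => j; rewrite leq_eqVlt => /predU1P[<-|Dj].
    by rewrite coefB coefZ /d divfK// subrr.
  rewrite coefB coefZ !nth_default ?mulr0 ?subr0//; [exact: leq_trans (size_cheb _) _|].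
  exact: leq_trans qD _.
have [c hc] := IH _ q'D.
exists (fun k => if k == D then d else c k).
rewrite big_ord_recr /= eqxx -[LHS](subrK (d *: cheb D)) hc; congr (_ + _).
by apply: eq_bigr => k _; rewrite ltn_eqF.
Qed.

(** After the substitution (z + 1/z)/2 and multiplication by z^D, the expansion is a palindromic
    polynomial with coefficient c_k / 2 at D + k, to which Cauchy's estimate applies. For k = 0 the
    two monomials coincide, hence k > 0. *)
Lemma cheb_coef_bound (c : nat -> C) D (rho B : R) : 0 < rho ->
  (forall z, cn z = rho -> cn (\sum_(k < D) c k *: cheb k).[(z + z^-1) / 2] <= B) ->
  forall k, (0 < k < D)%N -> cn (c k) <= 2 * B / rho ^+ k.
Proof.
move=> rho0 hB k /andP[k0 kD].
pose p : {poly C} := \sum_(j < D) (c j / 2) *: ('X^(D + j) + 'X^(D - j)).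
have pE z : z != 0 -> p.[z] = z ^+ D * (\sum_(k < D) c k *: cheb k).[(z + z^-1) / 2].
  move=> z0; rewrite /p !horner_sum mulr_sumr; apply: eq_bigr => j _.
  rewrite !hornerZ hornerD !hornerXn cheb_joukowski// exprD expfB_cond ?(ltnW (ltn_ord j))//.
    by field; rewrite expf_neq0.
  by rewrite (negbTE z0) add0n ltnW.
have pk : p`_(D + k) = c k / 2.
  rewrite /p coef_sum (bigD1 (Ordinal kD))//= big1 => [|j jk].
    rewrite coefZ coefD !coefXn eqxx (_ : (D + k == D - k)%N = false) ?addr0 ?mulr1//.
    by apply/negbTE; lia.
  rewrite coefZ coefD !coefXn eqn_add2l (_ : (k == j)%N = false).
    by rewrite (_ : (D + k == D - j)%N = false) ?addr0 ?mulr0//; apply/negbTE; lia.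
  by apply/negbTE; apply: contra jk => /eqP e; apply/eqP/val_inj.
have := @cauchy_coef R p rho (rho ^+ D * B) (D + k)%N (ltW rho0).
rewrite pk cnM cnV cn_nat => H.
have {}H : cn (c k) / 2 * rho ^+ (D + k) <= rho ^+ D * B.
  apply: H => z zr; have z0 : z != 0 by rewrite -cn_gt0 zr.
  rewrite pE// cnM cnX zr; apply: ler_wpM2l; first by rewrite exprn_ge0// ltW.
  exact: hB.
move: H; rewrite exprD mulrCA ler_pM2l ?exprn_gt0// => H.
by rewrite ler_pdivlMr ?exprn_gt0//; lra.
Qed.

Lemma geom_tail (x : R) n D : 0 < x < 1 -> \sum_(k < D | (n < k)%N) x ^+ k <= x ^+ n * x / (1 - x).
Proof.
move=> /andP[x0 x1]; have x1' : 0 < 1 - x by rewrite subr_gt0.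
(* With the remaining tail added, the induction on [D] compares sums of constant value. *)
suff H : \sum_(k < D | (n < k)%N) x ^+ k + x ^+ maxn D n.+1 / (1 - x) <= x ^+ n.+1 / (1 - x).
  rewrite -exprSr; apply: le_trans H; rewrite lerDl divr_ge0 ?exprn_ge0// ltW//.
elim: D => [|D IH]; first by rewrite big_ord0 max0n add0r.
apply: le_trans IH; rewrite [in leLHS]big_mkcond [in leRHS]big_mkcond big_ord_recr /=.
rewrite -addrA lerD2l; case: ltnP => nD.
  rewrite (maxn_idPl _) ?leqW// (maxn_idPl _)// exprS.
  by rewrite le_eqVlt; apply/orP; left; apply/eqP; field; rewrite gt_eqF.
by rewrite add0r (maxn_idPr _)// (maxn_idPr _)// leqW.
Qed.

(** The discarded coefficients decay like rho^-k and |T_k| <= 1 on the segment. The error involves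
    only [B] and [rho], not the degree of [q]. *)
Lemma cheb_truncate (q : {poly C}) (rho B : R) n : 1 < rho ->
  (forall z, cn z = rho -> cn q.[(z + z^-1) / 2] <= B) ->
  exists2 P : {poly C}, (size P <= n.+1)%N &
    forall x : R, -1 <= x <= 1 ->
      cn (q.[x%:C%C] - P.[x%:C%C]) <= 2 * B / (rho ^+ n * (rho - 1)).
Proof.
move=> rho1 hB; have rho0 : 0 < rho by exact: lt_trans rho1.
have B0 : 0 <= B.
  by apply: le_trans (cn_ge0 _) (hB rho%:C%C _); rewrite cn_real gtr0_norm.
have [c hc] := cheb_basis (leqnn (size q)).
set D := size q in hc.
have cb k : (0 < k < D)%N -> cn (c k) <= 2 * B / rho ^+ k.
  by apply: cheb_coef_bound => // z /hB; rewrite hc.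
exists (\sum_(k < D | ~~ (n < k)%N) c k *: cheb k).
  apply: leq_trans (size_sum _ _ _) _; apply/bigmax_leqP => k.
  rewrite -leqNgt => kn; apply: leq_trans (size_scale_leq _ _) _.
  exact: leq_trans (size_cheb _) _.
move=> x hx; rewrite [in X in cn (X - _)]hc (bigID (fun k : 'I_D => (n < k)%N)) /= hornerD addrK.
rewrite horner_sum; apply: le_trans (cn_sum _ _ _) _.
have r1 : 0 < rho^-1 < 1 by rewrite invr_gt0 rho0 invf_lt1.
apply: (@le_trans _ _ (\sum_(k < D | (n < k)%N) 2 * B * rho^-1 ^+ k)).
  apply: ler_sum => k nk; rewrite hornerZ cnM -[leRHS]mulr1.
  apply: ler_pM; rewrite ?cn_ge0// ?cheb_bound//.
  by rewrite exprVn; apply: cb; rewrite ltn_ord (leq_ltn_trans _ nk).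
rewrite -mulr_sumr; have B2 : 0 <= 2 * B by rewrite mulr_ge0.
apply: le_trans (ler_wpM2l B2 (geom_tail n D r1)) _.
rewrite le_eqVlt; apply/orP; left; apply/eqP; rewrite exprVn; field.
by rewrite !gt_eqF ?exprn_gt0// subr_gt0.
Qed.

(* For zeta = v^2 and t = i a (v - 1/v), one has 1 - t^2/(2 a^2) = (zeta + 1/zeta)/2: the
   bound on the image of the circle of radius r is a bound on a Bernstein ellipse. *)
Lemma even_approx (f : C -> C) (a r G eps : R) n : poly_approximable f ->
  (forall z, f (- z) = f z) -> 0 < a -> 1 < r -> 0 < eps ->
  (forall v, cn v = r -> cn (f (a%:C%C * (v - v^-1) * 'i%C)) <= G) ->
  exists2 P : {poly C}, (size P <= n.+1)%N &
    forall t : R, 0 <= t <= 2 * a ->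
      cn (P.[(1 - t ^+ 2 / (2 * a ^+ 2))%:C%C] - f t%:C%C) <=
        2 * (G + eps) / (r ^+ (2 * n) * (r ^+ 2 - 1)) + eps.
Proof.
move=> fS fe a0 r1 eps0 hG; have r0 : 0 < r by exact: lt_trans r1.
(* The radius covers both the image of the circle |v| = r and the segment [0, 2 a]. *)
have [S hS] := fS (a * (r + r^-1) + 2 * a) eps eps0.
(* s(u^2) is the even part of S(u), still within [eps] of the even function [f], and u^2 = 2 a^2 (1
   - x) makes it a polynomial in x. *)
pose s := even_poly S.
have sE u : s.[u ^+ 2] = (S.[u] + S.[- u]) / 2.
  rewrite -[in RHS](poly_even_odd S) !hornerD !hornerM !horner_comp !hornerX !hornerXn sqrrN.
  by rewrite /s; field.
have hs u : cn u <= a * (r + r^-1) + 2 * a -> cn (s.[u ^+ 2] - f u) <= eps.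
  move=> hu; have h1 := hS _ hu; have h2 : cn (f (- u) - S.[- u]) <= eps by apply: hS; rewrite cnN.
  rewrite sE (_ : _ - _ = (- (f u - S.[u]) - (f (- u) - S.[- u])) / 2); last first.
    by rewrite fe; field.
  rewrite cnM cnV cn_nat ler_pdivrMr//; apply: le_trans (cnD _ _) _.
  by rewrite !cnN; lra.
pose q : {poly C} := s \Po ((2 * a ^+ 2)%:C%C *: (1 - 'X)).
have qE x : q.[x] = s.[(2 * a ^+ 2)%:C%C * (1 - x)].
  by rewrite /q horner_comp !hornerE.
have r21 : 1 < r ^+ 2 by rewrite exprn_egt1.
have [|P Pn hP] := @cheb_truncate q (r ^+ 2) (G + eps) n r21.
  move=> z zr; pose v := sqrtc z.
  have vz : v ^+ 2 = z by rewrite sqr_sqrtc.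
  have vr : cn v = r.
    apply/eqP; rewrite -(@eqrXn2 _ 2) ?cn_ge0 ?(ltW r0)//.
    by rewrite -cnX vz zr.
  have v0 : v != 0 by rewrite -cn_gt0 vr.
  pose u := a%:C%C * (v - v^-1) * 'i%C.
  have uE : (2 * a ^+ 2)%:C%C * (1 - (z + z^-1) / 2) = u ^+ 2.
    rewrite /u !exprMn sqr_i -vz rmorphM rmorphXn rmorph_nat /=; field.
    by rewrite v0.
  rewrite qE uE; have -> : s.[u ^+ 2] = (s.[u ^+ 2] - f u) + f u by ring.
  apply: le_trans (cnD _ _) _; rewrite addrC; apply: lerD; first exact: hG.
  apply: hs; rewrite /u !cnM cn_i mulr1 cn_real gtr0_norm//.
  apply: (@le_trans _ _ (a * (r + r^-1))); last by rewrite lerDl mulr_ge0// ltW.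
  apply: ler_wpM2l; first exact: ltW.
  by apply: le_trans (cnD _ _) _; rewrite cnN cnV vr.
exists P => // t /andP[t0 t2a].
pose x := 1 - t ^+ 2 / (2 * a ^+ 2).
have aa : 0 < 2 * a ^+ 2 by rewrite mulr_gt0// exprn_gt0.
have hx : -1 <= x <= 1.
  rewrite /x; apply/andP; split; last by rewrite gerBl divr_ge0 ?sqr_ge0// ltW.
  rewrite lerBrDr -lerBrDl opprK ler_pdivrMr//.
  have : t ^+ 2 <= (2 * a) ^+ 2 by rewrite ler_pXn2r ?nnegrE ?mulr_ge0// ltW.
  by rewrite exprMn; lra.
have := hP x hx; rewrite qE.
have -> : (2 * a ^+ 2)%:C%C * (1 - x%:C%C) = t%:C%C ^+ 2.
  have -> : 1 - x%:C%C = (1 - x)%:C%C :> C by apply/eqP; rewrite eq_complex /= oppr0 addr0 !eqxx.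
  rewrite -rmorphXn -rmorphM /x.
  by congr (_%:C%C); field; rewrite gt_eqF.
rewrite -exprM => h1.
have h2 : cn (s.[t%:C%C ^+ 2] - f t%:C%C) <= eps.
  apply: hs; rewrite cn_real ger0_norm//.
  apply: le_trans t2a _; rewrite lerDr mulr_ge0 ?addr_ge0 ?invr_ge0 ?ltW//.
rewrite (_ : P.[_] - _ = (s.[t%:C%C ^+ 2] - f t%:C%C) - (s.[t%:C%C ^+ 2] - P.[x%:C%C])); last by ring.
by apply: le_trans (cnD _ _) _; rewrite cnN addrC; apply: lerD.
Qed.

End ChebyshevTruncation.

(** * Generalized translation of polynomials *)

Section Bernstein.
Context {R : realType}.
Implicit Types (phi psi : nat -> R).

(* The Bernstein polynomial of the values phi 0, ..., phi n, by de Casteljau's recursion. *)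
Fixpoint bern (n : nat) phi : {poly R} :=
  if n is n'.+1 then (1 - 'X) * bern n' phi + 'X * bern n' (fun k => phi k.+1)
  else (phi 0)%:P.

Lemma bern_le n phi psi (x : R) : 0 <= x <= 1 ->
  (forall k, (k <= n)%N -> phi k <= psi k) -> (bern n phi).[x] <= (bern n psi).[x].
Proof.
move=> /andP[x0 x1]; elim: n phi psi => [|n IH] phi psi h /=.
  by rewrite !hornerC h.
rewrite !hornerE; apply: lerD; apply: ler_wpM2l => //; rewrite ?subr_ge0//.
  by apply: IH => k kn; apply: h; rewrite leqW.
by apply: IH => k kn; apply: h.
Qed.

(** The shift [d] closes the induction: the second branch of the recursion evaluates the same
    quadratic at k + 1, that is, with d + 1. *)
Lemma bern_moments n (a b c d : R) (x : R) :
  (bern n (fun k => a + b * (k%:R + d) + c * (k%:R + d) ^+ 2)).[x] =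
  a + b * (n%:R * x + d) + c * ((n%:R * x + d) ^+ 2 + n%:R * x * (1 - x)).
Proof.
elim: n d => [|n IH] d /=; first by rewrite hornerC !mul0r !add0r addr0.
rewrite !hornerE IH.
rewrite (_ : (fun k => _) = (fun k => a + b * (k%:R + (d + 1)) + c * (k%:R + (d + 1)) ^+ 2)); last first.
  by apply/funext => k; rewrite -natr1; ring.
rewrite IH -natr1; ring.
Qed.

Lemma real_unif_cont (u : R -> R) (a eps : R) : continuous u -> 0 < a -> 0 < eps ->
  exists2 d : R, 0 < d & forall s t : R, 0 <= s <= a -> `|t - s| < d -> `|u t - u s| <= eps.
Proof.
move=> cu a0 e0.
have [d d0 hd] : exists2 d : R, 0 < d & forall s t : R, 0 <= s <= 0 + a -> `|t - s| < d -> `|u t - u s| <= eps.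
  (* Bisection of an interval: the second coordinate is a dummy. *)
  apply: (@dyadic_descent R (fun x y a b => exists2 d : R, 0 < d &
    forall s t, x <= s <= x + a -> `|t - s| < d -> `|u t - u s| <= eps) _ _ 0 0 a 1) => //.
    move=> x y b c b0 c0 [d1 d10 h1] [d2 d20 h2] _ _.
    exists (Num.min d1 d2) => [|s t /andP[s1 s2]]; first by rewrite lt_min d10.
    rewrite lt_min => /andP[t1 t2]; case: (leP s (x + b)) => sb.
      by apply: h1 => //; rewrite s1.
    by apply: h2 => //; rewrite (ltW sb) -addrA.
  move=> x y; have e20 : 0 < eps / 2 by rewrite divr_gt0.
  have [d d0 hd] := eps_continuous cu x e20.
  exists (d / 2) => [|x' y' b c /andP[b0 bd] _ hx _]; first by rewrite divr_gt0.
  exists (d / 2) => [|s t hs ht]; first by rewrite divr_gt0.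
  have ks : `|s - x| < d by rewrite ltr_norml; lra.
  have kt : `|t - x| < d by move: ht; rewrite !ltr_norml; lra.
  have := hd _ ks; have := hd _ kt; rewrite ![x + _]addrC !subrK => h1 h2.
  rewrite (_ : u t - u s = (u t - u x) - (u s - u x)); last by ring.
  by apply: le_trans (ler_normB _ _) _; lra.
by exists d => // s t; rewrite -[X in _ <= s <= X]add0r; exact: hd.
Qed.

(** The values v(k/N) lie between the quadratics v(x) -/+ (eps/2 + K (k/N - x)^2) in k. Monotonicity
    of [bern] and its explicit moments then leave an error eps/2 + K x (1 - x)/N at x. *)
Lemma weierstrass01 (v : R -> R) (eps : R) : continuous v -> 0 < eps ->
  exists q : {poly R}, forall x : R, 0 <= x <= 1 -> `|v x - q.[x]| <= eps.
Proof.
move=> cv e0; have e20 : 0 < eps / 2 by rewrite divr_gt0.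
have [M hM] : exists M : R, forall t : R, 0 <= t <= 1 -> `|v t| <= M.
  have cav : continuous (fun t => `|v t|).
    by move=> t; apply: (@continuous_comp _ _ _ v (fun z => `|z|)); [exact: cv|exact: norm_continuous].
  have [c _ hc] := @EVT_max R (fun t => `|v t|) 0 1 ler01 (continuous_subspaceT cav).
  by exists `|v c| => t ht; apply: hc; rewrite in_itv.
have M0 : 0 <= M by apply: le_trans (normr_ge0 _) (hM 0 _); rewrite lexx ler01.
have [d d0 hd] := real_unif_cont cv (ltr01 : 0 < 1 :> R) e20.
have d20 : 0 < d ^+ 2 by rewrite exprn_gt0.
pose K : R := 2 * M / d ^+ 2.
have K0 : 0 <= K by rewrite divr_ge0 ?mulr_ge0// ltW.
have hK (s t : R) : 0 <= s <= 1 -> 0 <= t <= 1 -> `|v t - v s| <= eps / 2 + K * (t - s) ^+ 2.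
  move=> hs ht; have [lt_d|ge_d] := ltP `|t - s| d.
    by apply: le_trans (hd _ _ hs lt_d) _; rewrite lerDl mulr_ge0 ?sqr_ge0.
  apply: (@le_trans _ _ (2 * M)).
    by apply: le_trans (ler_normB _ _) _; have := hM _ hs; have := hM _ ht; lra.
  apply: (@le_trans _ _ (K * d ^+ 2)); first by rewrite /K divfK// gt_eqF.
  apply: ler_wpDl; first exact: ltW.
  apply: ler_wpM2l => //; rewrite -[leRHS]real_normK ?num_real//.
  by rewrite ler_pXn2r ?nnegrE// ltW.
have [N hN] : exists N : nat, K / eps < N.+1%:R.
  exists (Num.bound (K / eps)); apply: (@lt_trans _ _ (Num.bound (K / eps))%:R).
    by apply: archi_boundP; rewrite divr_ge0// ltW.
  by rewrite ltr_nat.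
have N0 : 0 < N.+1%:R :> R by rewrite ltr0n.
exists (bern N.+1 (fun k => v (k%:R / N.+1%:R))) => x hx.
have kN k : (k <= N.+1)%N -> 0 <= (k%:R / N.+1%:R : R) <= 1.
  by move=> kN; rewrite divr_ge0//= ler_pdivrMr// mul1r ler_nat.
have E (k : nat) : K * (k%:R / N.+1%:R - x : R) ^+ 2 = K / N.+1%:R ^+ 2 * (k%:R + (- (N.+1%:R * x)) : R) ^+ 2.
  by field; rewrite gt_eqF.
have B1 : K / N.+1%:R ^+ 2 * (N.+1%:R * x * (1 - x)) <= eps / 2.
  rewrite (_ : _ * _ = K / N.+1%:R * (x * (1 - x))); last by field; rewrite gt_eqF.
  have x4 : x * (1 - x) <= 2^-1.
    have := sqr_ge0 (x - 2^-1); rewrite -subr_ge0 => h.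
    by rewrite -subr_ge0 (_ : _ - _ = (x - 2^-1) ^+ 2 + 4^-1) ?addr_ge0 ?sqr_ge0//; field.
  have x0 : 0 <= x * (1 - x) by case/andP: hx => ? ?; rewrite mulr_ge0// subr_ge0.
  have KN : K / N.+1%:R <= eps by rewrite ler_pdivrMr// mulrC -ler_pdivrMr// ltW.
  apply: ler_pM => //; first by rewrite divr_ge0// ltW.
pose c := K / N.+1%:R ^+ 2; pose e := - (N.+1%:R * x).
pose up (k : nat) : R := (v x + eps / 2) + 0 * (k%:R + e) + c * (k%:R + e) ^+ 2.
pose lo (k : nat) : R := (v x - eps / 2) + 0 * (k%:R + e) + (- c) * (k%:R + e) ^+ 2.
have U0 : (bern N.+1 (fun k => v (k%:R / N.+1%:R))).[x] <= (bern N.+1 up).[x].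
  apply: bern_le => // k /kN hk; rewrite /up mul0r addr0 /c /e -E.
  by have := hK _ _ hx hk; rewrite ler_norml => /andP[_]; rewrite lerBlDl addrA.
have L0 : (bern N.+1 lo).[x] <= (bern N.+1 (fun k => v (k%:R / N.+1%:R))).[x].
  apply: bern_le => // k /kN hk; rewrite /lo mul0r addr0 mulNr /c /e -E.
  have := hK _ _ hx hk; rewrite ler_norml => /andP[+ _].
  by rewrite lerBrDl opprD addrA.
move: U0 L0; rewrite /up /lo !bern_moments /e subrr !mul0r !addr0 expr0n /= !add0r mulNr.
rewrite /c => U0 L0.
have {}U0 := le_trans U0 (lerD (lexx _) B1).
have {}L0 : v x - eps / 2 - eps / 2 <= (bern N.+1 (fun k => v (k%:R / N.+1%:R))).[x].
  by apply: le_trans L0; rewrite lerD2l lerN2.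
move: (bern _ _).[x] U0 L0 => b U0 L0.
by rewrite ler_norml; lra.
Qed.

Lemma weierstrass (u : R -> R) (eps : R) : continuous u -> 0 < eps ->
  exists q : {poly R}, forall x : R, -1 <= x <= 1 -> `|u x - q.[x]| <= eps.
Proof.
move=> cu e0.
have cv : continuous (fun t : R => u (2 * t - 1)).
  move=> t; apply: (@continuous_comp _ _ _ (fun t : R => 2 * t - 1) u); last exact: cu.
  by apply: cvgB; [apply: cvgMr; exact: cvg_id|exact: cvg_cst].
have [q hq] := weierstrass01 cv e0.
exists (q \Po (2^-1 *: ('X + 1))) => x hx.
have := hq ((x + 1) / 2); rewrite (_ : 2 * ((x + 1) / 2) - 1 = x); last by field.
rewrite horner_comp !hornerE mulrC; apply.
by lra.
Qed.

End Bernstein.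

(** * Convexity of powers *)

Section Powers.
Context {R : realType}.
Implicit Types (p a m x y : R).

(** Young's inequality for a and m^(p-1), with exponents p and p/(p - 1), is the tangent line
    inequality at m. *)
Lemma powR_tangent p a m : 1 <= p -> 0 <= a -> 0 <= m ->
  m `^ p + p * m `^ (p - 1) * (a - m) <= a `^ p.
Proof.
move=> p1 a0 m0; have p0 : 0 < p by lra.
have [->|pn1] := eqVneq p 1; first by rewrite subrr powRr0 !powRr1//; lra.
have p1' : 0 < p - 1 by rewrite subr_gt0 lt_neqAle eq_sym pn1.
pose q := p / (p - 1).
have q0 : 0 < q by rewrite divr_gt0.
have pq : p^-1 + q^-1 = 1 by rewrite /q; field; rewrite !gt_eqF.
have := conjugate_powR a0 (powR_ge0 m (p - 1)) p0 q0 pq.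
rewrite -powRrM (_ : (p - 1) * q = p); last by rewrite /q; field; rewrite gt_eqF.
have mE : m * m `^ (p - 1) = m `^ p by rewrite mulr_powRB1.
have -> : m `^ p / q = (1 - p^-1) * m `^ p by rewrite -pq addrAC subrr add0r mulrC.
move=> /(ler_wpM2l (ltW p0)).
rewrite !mulrDr mulrA mulrCA divff ?gt_eqF// mulr1 mulrA mulrBr mulr1 divff ?gt_eqF//.
rewrite -mE; lra.
Qed.

Lemma powR_jensen p (I : finType) (w a : I -> R) : 1 <= p ->
  (forall i, 0 <= w i) -> \sum_i w i = 1 -> (forall i, 0 <= a i) ->
  (\sum_i w i * a i) `^ p <= \sum_i w i * a i `^ p.
Proof.
move=> p1 w0 w1 a0; set m := \sum_i w i * a i.
have m0 : 0 <= m by apply: sumr_ge0 => i _; rewrite mulr_ge0.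
have H : \sum_i w i * (m `^ p + p * m `^ (p - 1) * (a i - m)) <= \sum_i w i * a i `^ p.
  by apply: ler_sum => i _; apply: ler_wpM2l => //; exact: powR_tangent.
apply: le_trans H; rewrite le_eqVlt; apply/orP; left; apply/eqP.
rewrite (eq_bigr (fun i => w i * (m `^ p - p * m `^ (p - 1) * m) + p * m `^ (p - 1) * (w i * a i))); last first.
  by move=> i _; ring.
rewrite big_split /= -mulr_suml w1 -mulr_sumr -/m; ring.
Qed.

(** Convexity for x + y = l (x/l) + (1 - l) (y/(1 - l)). With l near 1 it plays the role of
    Minkowski's inequality: the main term has a factor near 1 and the error term a fixed one. *)
Lemma powR_split p x y l : 1 <= p -> 0 <= x -> 0 <= y -> 0 < l < 1 ->
  (x + y) `^ p <= l `^ (1 - p) * x `^ p + (1 - l) `^ (1 - p) * y `^ p.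
Proof.
move=> p1 x0 y0 /andP[l0 l1]; have l1' : 0 < 1 - l by rewrite subr_gt0.
have p0 : 0 < p by lra.
pose w (b : bool) := if b then l else 1 - l.
pose a (b : bool) := if b then x / l else y / (1 - l).
have := @powR_jensen p bool w a p1; rewrite !big_bool /w /a /=.
rewrite ![_ * (_ / _)]mulrC !divfK ?gt_eqF// => H.
apply: le_trans (H _ _ _) _.
- by case; rewrite ltW.
- by rewrite addrC subrK.
- by case; rewrite divr_ge0// ltW.
have E u v : 0 < u -> 0 <= v -> u * (v / u) `^ p = u `^ (1 - p) * v `^ p.
  move=> u0 v0; rewrite powRM ?invr_ge0 ?(ltW u0)// -powR_inv1 ?(ltW u0)//.
  rewrite -powRrM mulN1r mulrCA -{1}[u]powRr1 ?(ltW u0)// -powRD; last first.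
    by rewrite (gt_eqF u0) implybT.
  by rewrite mulrC.
by rewrite !E.
Qed.

Lemma continuous_powR p : 1 <= p -> continuous (fun x : R => `|x| `^ p).
Proof.
move=> p1; have p0 : 0 < p by lra.
apply: continuous_eps => x e e0; have [x0|x0] := eqVneq x 0.
  exists (e `^ p^-1); first by rewrite powR_gt0.
  move=> h hlt; rewrite x0 add0r normr0 powR0 ?gt_eqF// subr0 ger0_norm ?powR_ge0//.
  have : `|h| `^ p <= (e `^ p^-1) `^ p.
    by apply: ge0_ler_powR; rewrite ?nnegrE ?powR_ge0 ?normr_ge0 ?(ltW p0) ?(ltW hlt).
  by rewrite -powRrM mulVf ?gt_eqF// powRr1 ?(ltW e0).
have ax0 : 0 < `|x| by rewrite normr_gt0.
have cx : {for `|x|, continuous (fun z : R => z `^ p)}.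
  apply/differentiable_continuous/derivable1_diffP.
  by apply: derivable_powR; rewrite in_itv /= andbT.
have cn' : {for x, continuous (fun x : R => `|x| `^ p)}.
  by apply: (@continuous_comp _ _ _ (fun z : R => `|z|) (fun z : R => z `^ p)); [exact: norm_continuous|].
have /cvgrPdist_le/(_ _ e0)/nbhs_ballP[d /= d0 hd] := cn'.
exists d => // h hlt; have := hd (x + h); rewrite /ball /= opprD addNKr normrN.
by move=> /(_ hlt); rewrite distrC.
Qed.

Lemma powR_ge0_cont p (u : R -> R) : 1 <= p -> continuous u -> (forall t, 0 <= u t) ->
  continuous (fun t => u t `^ p).
Proof.
move=> p1 cu u0; rewrite (_ : (fun _ => _) = (fun x => `|x| `^ p) \o u).
  move=> t; apply: continuous_comp; [exact: cu|exact: continuous_powR].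
by apply/funext => t /=; rewrite ger0_norm.
Qed.

End Powers.

(** * Integrals of polynomials over [-1, 1] *)

Section PolynomialIntegral.
Context {R : realType}.
Implicit Types q : {poly R}.

Definition ipoly q : R := RI (horner q) (-1) 1.

Lemma m1_le1 : -1 <= 1 :> R. Proof. lra. Qed.

Lemma ipolyD q1 q2 : ipoly (q1 + q2) = ipoly q1 + ipoly q2.
Proof.
rewrite /ipoly -RID; try exact: continuous_horner.
by apply: RI_eq => x _; rewrite hornerD.
Qed.

Lemma ipolyZ k q : ipoly (k *: q) = k * ipoly q.
Proof.
rewrite /ipoly -RIZ; try exact: continuous_horner.
by apply: RI_eq => x _; rewrite hornerZ.
Qed.

Lemma ipoly0 : ipoly 0 = 0. Proof. by rewrite -[0 in LHS](scale0r (0 : {poly R})) ipolyZ mul0r. Qed.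

Lemma ipoly_sum (I : Type) (r : seq I) (F : I -> {poly R}) :
  ipoly (\sum_(i <- r) F i) = \sum_(i <- r) ipoly (F i).
Proof. by elim/big_rec2: _ => [|i y q _ IH]; rewrite ?ipoly0// ipolyD IH. Qed.

Lemma ipoly_deriv q : ipoly q^`() = q.[1] - q.[-1].
Proof.
by apply: RI_FTC; [exact: m1_le1|exact: continuous_horner].
Qed.

Definition ibeta (m j : nat) : R := ipoly ('X^m * (1 - 'X^2) ^+ j).

Lemma deriv_1X2 j : ((1 - 'X^2 : {poly R}) ^+ j.+1)^`() =
  - (2 * j.+1%:R) *: ('X * (1 - 'X^2) ^+ j).
Proof.
rewrite deriv_exp derivB derivXn /= (_ : 1^`() = 0); last by rewrite -polyC1 derivC.
rewrite sub0r expr1 scaleNr -scalerA scaler_nat scaler_nat mulNr mulNrn mulrnAl -!mulrnA.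
by rewrite mulnC.
Qed.

(** The derivative of x^(m+1) (1 - x^2)^(j+1) has integral zero, since that polynomial vanishes at
    both endpoints. *)
Lemma ibeta_rec m j : m.+1%:R * ibeta m j.+1 = 2 * j.+1%:R * ibeta m.+2 j.
Proof.
have := ipoly_deriv ('X^(m.+1) * (1 - 'X^2) ^+ j.+1).
rewrite !hornerE /= sqrrN !expr1n subrr !expr0n /= !mulr0 subrr derivM deriv_1X2 derivXn /=.
rewrite -scalerAr (_ : 'X^(m.+1) * ('X * _) = 'X^(m.+2) * (1 - 'X^2) ^+ j); last first.
  by rewrite mulrA -exprSr.
rewrite (_ : ('X^m *+ m.+1 : {poly R}) * _ = (m.+1%:R : R) *: ('X^m * (1 - 'X^2) ^+ j.+1)); last first.
  by rewrite scaler_nat mulrnAl.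
rewrite ipolyD !ipolyZ -/(ibeta _ _) -/(ibeta _ _); lra.
Qed.

Lemma ipolyXn k : ipoly 'X^k = if odd k then 0 else 2 / k.+1%:R.
Proof.
have k0 : k.+1%:R != 0 :> R by rewrite pnatr_eq0.
have := ipoly_deriv (k.+1%:R^-1 *: 'X^(k.+1)).
rewrite derivZ derivXn /= -scalerMnr scalerMnl -[k.+1%:R^-1 *+ k.+1]mulr_natr mulVf// scale1r => ->.
rewrite !hornerE expr1n -signr_odd /=; move: (k.+1%:R) k0 => c c0.
by case: odd => /=; rewrite ?expr0 ?expr1; field.
Qed.

Lemma ibeta_odd m j : odd m -> ibeta m j = 0.
Proof.
move=> om; rewrite -(odd_double_half m) om add1n; move: (m./2) => {om}m.
elim: m j => [|m IH] j.
  rewrite /ibeta double0 expr1; have := ipoly_deriv ((1 - 'X^2) ^+ j.+1); rewrite deriv_1X2 ipolyZ.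
  rewrite !hornerE /= ?sqrrN ?expr1n ?subrr ?expr0n /= ?subrr => /eqP.
  by rewrite mulf_eq0 oppr_eq0 mulf_eq0 !pnatr_eq0 /= => /eqP.
have -> : ibeta m.+1.*2.+1 j = ibeta m.*2.+1 j + (-1) * ibeta m.*2.+1 j.+1.
  rewrite /ibeta -ipolyZ -ipolyD; congr ipoly.
  rewrite doubleS !exprS scaleN1r; ring.
by rewrite !IH mulr0 addr0.
Qed.

End PolynomialIntegral.

(** * Legendre translation of monomials *)

Section GeneralizedTranslation.
Context {R : realType}.
Local Notation C := R[i].

(* The mean of cos^i over the circle. *)
Definition arcsine_moment (i : nat) : R :=
  if odd i then 0 else 'C(i, i./2)%:R / 2 ^+ i.
Local Notation mu := arcsine_moment.

Lemma arcsine_moment_rec j :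
  (2 * j.+1%:R) * mu j.+1.*2 = (2 * j%:R + 1) * mu j.*2.
Proof.
rewrite /mu !odd_double !half_double.
have h1 := mul_bin_diag j.*2.+2 j; have h2 := mul_bin_diag j.*2.+1 j.
rewrite /= in h1 h2.
have h3 : 'C(j.*2.+1, j) = 'C(j.*2.+1, j.+1).
  by rewrite -bin_sub; [congr 'C(_, _); lia|lia].
move: h1 h2 => /(congr1 (fun n => n%:R : R)) h1 /(congr1 (fun n => n%:R : R)) h2.
rewrite !natrM h3 in h1 h2.
have e1 : j.*2.+2%:R = 2 * (j%:R + 1) :> R by rewrite -mul2n -natr1 -natr1 natrM; ring.
have e2 : j.*2.+1%:R = 2 * j%:R + 1 :> R by rewrite -mul2n -natr1 natrM.
have e3 : j.+1%:R = j%:R + 1 :> R by rewrite natr1.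
have j0 : j%:R + 1 != 0 :> R by rewrite natr1 pnatr_eq0.
rewrite e1 e3 in h1; rewrite e2 e3 in h2; rewrite e3 doubleS.
have p0 : 2 ^+ j.*2 != 0 :> R by rewrite expf_neq0// pnatr_eq0.
apply: (mulfI j0); rewrite !exprS.
have h4 : (j%:R + 1) * 'C(j.*2.+2, j.+1)%:R = 2 * ((2 * j%:R + 1) * 'C(j.*2, j)%:R) :> R.
  by rewrite -h1 h2; ring.
rewrite (_ : (j%:R + 1) * _ = 2 * (j%:R + 1) * ((j%:R + 1) * 'C(j.*2.+2, j.+1)%:R) / (2 * (2 * 2 ^+ j.*2))); last by ring.
rewrite h4; field; exact: p0.
Qed.

(** In the binomial expansion of ((w + 1/w)/2)^k only the middle term survives averaging: k < N
    excludes any other coincidence of exponents modulo N. *)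
Lemma avg_Re_uroot N k : (k < N)%N ->
  \sum_(j < N) complex.Re (uroot N ^+ j) ^+ k = N%:R * mu k.
Proof.
move=> kN; have N0 : (0 < N)%N by apply: leq_ltn_trans kN.
apply: (@complexI R); rewrite rmorph_sum rmorphM /= rmorph_nat.
have -> : \sum_(j < N) (complex.Re (uroot N ^+ j) ^+ k)%:C%C =
    \sum_(j < N) \sum_(l < k.+1) (2 ^- k * 'C(k, l)%:R) *
      ((uroot N ^+ (k - l)) ^+ j * ((uroot N ^+ l) ^+ j)^-1) :> C.
  apply: eq_bigr => j _; rewrite rmorphXn /=.
  have -> : (complex.Re (uroot N ^+ j))%:C%C = (uroot N ^+ j + (uroot N ^+ j)^-1) / 2 :> C.
    by rewrite /uroot -!ecircMn ecirc_cos /ecirc /cexp /= expR0 mul1r.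
  rewrite expr_div_n exprDn mulr_suml; apply: eq_bigr => l _.
  rewrite -[_ *+ 'C(_, _)]mulr_natr !exprVn -!exprM [(j * (k - l))%N]mulnC [(j * l)%N]mulnC; ring.
rewrite exchange_big /= (eq_bigr (fun l : 'I_k.+1 => if (l == k - l :> nat)%N then 2 ^- k * 'C(k, l)%:R * N%:R else 0)); last first.
  move=> l _; rewrite -mulr_sumr uroot_ortho; last 2 first.
  - by apply: leq_ltn_trans kN; rewrite -ltnS.
  - by apply: leq_ltn_trans kN; rewrite leq_subr.
  by case: ifP => // _; rewrite mulr0.
rewrite /mu; case: ifPn => [ok|ek].
  rewrite mulr0 big1// => l _; case: eqP => // e; exfalso.
  have lk := ltn_ord l; have ek : k = (nat_of_ord l).*2 by lia.
  by move: ok; rewrite [X in odd X]ek odd_double.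
have hk : (k./2 < k.+1)%N by lia.
rewrite (bigD1 (Ordinal hk))//= big1 => [|l lk].
  rewrite ifT; last by apply/eqP; lia.
  by rewrite addr0 rmorphM fmorphV rmorphXn /= !rmorph_nat; ring.
case: eqP => // e; case/eqP: lk; apply/val_inj => /=; lia.
Qed.

(* The translate of 'X^k: the mean over the circle, as a polynomial in y, of
   (x y + sqrt(1 - x^2) sqrt(1 - y^2) cos t)^k. *)
Definition tmono (x : R) (k : nat) : {poly R} :=
  \sum_(i < k.+1) ('C(k, i)%:R * x ^+ (k - i) * mu i * (1 - x ^+ 2) ^+ i./2) *:
     ('X^(k - i) * (1 - 'X^2) ^+ i./2).

Lemma size_tmono x k : (size (tmono x k) <= k.+1)%N.
Proof.
apply: leq_trans (size_sum _ _ _) _; apply/bigmax_leqP => i _.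
apply: leq_trans (size_scale_leq _ _) _.
apply: leq_trans (size_polyMleq _ _) _.
have h : (size ((1 - 'X^2 : {poly R}) ^+ i./2) <= (i./2).*2.+1)%N.
  apply: leq_trans (size_poly_exp_leq _ _) _.
  have : (size (1 - 'X^2 : {poly R})%R <= 3)%N.
    apply: leq_trans (size_polyD _ _) _.
    by rewrite size_poly1 size_polyN size_polyXn.
  case: (size _) => [|d] h3; rewrite /= -?mul2n; first by rewrite mul0n.
  by rewrite ltnS leq_mul2r -ltnS h3 orbT.
have ik := ltn_ord i; rewrite size_polyXn; move: (size _) h => d h.
have hi : ((nat_of_ord i)./2.*2 <= i)%N by rewrite -[X in (_ <= X)%N](odd_double_half i) leq_addl.
move: (nat_of_ord i) h ik hi => j h jk hj; move: (j./2.*2) h hj => e h hj; lia.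
Qed.

Lemma tmono1 x k : (tmono x k).[1] = x ^+ k.
Proof.
rewrite /tmono horner_sum big_ord_recl big1 => [|i _].
  by rewrite hornerZ hornerM hornerXn horner_exp /mu /= bin0 subn0 expr1n !expr0 divr1 !mulr1 mul1r addr0.
rewrite hornerZ hornerM hornerXn horner_exp hornerD hornerN hornerC !hornerXn !expr1n subrr.
rewrite lift0 /mu expr0n; case: i => [[|i]] ik /=; first by rewrite mulr0 !mul0r.
by rewrite !mulr0.
Qed.

Lemma tmono_avg x k N y : (k < N)%N -> -1 <= x <= 1 -> -1 <= y <= 1 ->
  (tmono x k).[y] = N%:R^-1 * \sum_(j < N)
    (x * y + Num.sqrt (1 - x ^+ 2) * Num.sqrt (1 - y ^+ 2) * complex.Re (uroot N ^+ j : C)) ^+ k.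
Proof.
move=> kN hx hy.
have N0 : N%:R != 0 :> R by rewrite pnatr_eq0 -lt0n (leq_ltn_trans _ kN).
have sq (z : R) : -1 <= z <= 1 -> 0 <= 1 - z ^+ 2.
  by rewrite -ler_norml => h; rewrite subr_ge0 -real_normK ?num_real// expr_le1.
rewrite (eq_bigr (fun j : 'I_N => \sum_(i < k.+1) (('C(k, i)%:R * (x * y) ^+ (k - i) *
   (Num.sqrt (1 - x ^+ 2) * Num.sqrt (1 - y ^+ 2)) ^+ i) * complex.Re (uroot N ^+ j : C) ^+ i))); last first.
  move=> j _; rewrite exprDn; apply: eq_bigr => i _.
  by rewrite -[_ *+ 'C(_, _)]mulr_natr [(_ * complex.Re _) ^+ i]exprMn; ring.
rewrite exchange_big /= mulr_sumr /tmono horner_sum; apply: eq_bigr => i _.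
rewrite -mulr_sumr avg_Re_uroot; last by apply: leq_ltn_trans kN; rewrite -ltnS.
rewrite hornerZ hornerM hornerXn horner_exp hornerD hornerN hornerC !hornerXn.
have [oi|ei] := boolP (odd i); first by rewrite /mu oi !mulr0 !mul0r ?mulr0.
have -> : (Num.sqrt (1 - x ^+ 2) * Num.sqrt (1 - y ^+ 2)) ^+ i =
   (1 - x ^+ 2) ^+ i./2 * (1 - y ^+ 2) ^+ i./2.
  rewrite -[in LHS](odd_double_half i) (negbTE ei) add0n -mul2n exprM [(Num.sqrt _ * _) ^+ 2]exprMn.
  by rewrite !sqr_sqrtr ?sq// exprMn.
rewrite exprMn; field; exact: N0.
Qed.

Lemma sum_even_index (F : nat -> R) K : (forall i, odd i -> F i = 0) ->
  \sum_(i < K.*2.+1) F i = \sum_(j < K.+1) F j.*2.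
Proof.
move=> F0; elim: K => [|K IH]; first by rewrite !big_ord1.
by rewrite doubleS big_ord_recr big_ord_recr /= IH [RHS]big_ord_recr /= F0 ?addr0//= odd_double.
Qed.

(** By induction on [j]: both sides are multiplied by (K - j)/(j + 1) from one step to the next. The
    binomial coefficients on the right are what lets the sum in [ipoly_tmono] collapse. *)
Lemma moment_identity K j : (j <= K)%N ->
  'C(K.*2, j.*2)%:R * mu j.*2 * ibeta (K - j).*2 j = 'C(K, j)%:R * (2 / K.*2.+1%:R) :> R.
Proof.
elim: j => [|j IH] jK.
  rewrite /mu /= !bin0 divr1 !mul1r subn0 /ibeta expr0 mulr1 ipolyXn odd_double.
  by [].
have {IH} := IH (ltnW jK).
have h1 := mul_bin_left K.*2 j.*2; have h2 := mul_bin_left K.*2 j.*2.+1.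
have h3 := mul_bin_left K j; have h4 := arcsine_moment_rec j.
set m := (K - j.+1)%N; have Km : (K - j)%N = m.+1 by rewrite /m; lia.
have h5 := @ibeta_rec R m.*2 j.
have k1 : (K.*2 - j.*2)%N = m.*2.+2 by rewrite /m; lia.
have k2 : (K.*2 - j.*2.+1)%N = m.*2.+1 by rewrite /m; lia.
rewrite Km doubleS; rewrite k1 in h1; rewrite k2 in h2; rewrite Km in h3.
move: h1 h2 h3 => /(congr1 (fun n => n%:R : R)) h1 /(congr1 (fun n => n%:R : R)) h2 /(congr1 (fun n => n%:R : R)) h3.
rewrite !natrM in h1 h2 h3; rewrite doubleS in h4 *.
have nS (n : nat) : n.*2%:R = 2 * n%:R :> R by rewrite -mul2n natrM.
have n1 (n : nat) : n.*2.+1%:R = 2 * n%:R + 1 :> R by rewrite -natr1 nS.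
have n2 (n : nat) : n.*2.+2%:R = 2 * n%:R + 1 + 1 :> R by rewrite -natr1 n1.
have n3 (n : nat) : n.+1%:R = n%:R + 1 :> R by rewrite -natr1.
move: h1 h2 h3 h4 h5; rewrite !n2 !n1 [j.+1%:R]n3 [m.+1%:R]n3.
have j0 : 0 <= j%:R :> R by exact: ler0n.
have m0 : 0 <= m%:R :> R by exact: ler0n.
have kk0 : 0 <= K%:R :> R by exact: ler0n.
move: (j%:R) (m%:R) (K%:R) j0 m0 kk0 => J M KK J0 M0 KK0.
move: ('C(K.*2, j.*2)%:R) ('C(K.*2, j.*2.+1)%:R) ('C(K.*2, j.*2.+2)%:R) => c0 c1 c2.
move: ('C(K, j)%:R) ('C(K, j.+1)%:R) (mu j.*2) (mu j.*2.+2) => b0 b1 u0 u2.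
move: (ibeta m.*2.+2 j) (ibeta m.*2 j.+1) => B0 B1.
move=> h1 h2 h3 h4 h5 h6.
have J1 : J + 1 != 0 by rewrite gt_eqF//; lra.
have J2 : 2 * J + 1 != 0 by rewrite gt_eqF//; lra.
have M2 : 2 * M + 1 != 0 by rewrite gt_eqF//; lra.
have K2 : 2 * KK + 1 != 0 by rewrite gt_eqF//; lra.
have e2 : c2 = (2 * M + 1) * (2 * M + 1 + 1) * c0 / ((2 * J + 1 + 1) * (2 * J + 1)).
  have -> : c0 = (2 * J + 1) * c1 / (2 * M + 1 + 1).
    by rewrite h1; field; rewrite gt_eqF//; lra.
  have -> : c1 = (2 * J + 1 + 1) * c2 / (2 * M + 1) by rewrite h2; field.
  by field; rewrite !gt_eqF//; lra.
have e4 : u2 = (2 * J + 1) * u0 / (2 * (J + 1)) by rewrite -h4; field.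
have e5 : B1 = 2 * (J + 1) * B0 / (2 * M + 1) by rewrite -h5; field.
have e3 : b1 = (M + 1) * b0 / (J + 1) by rewrite -h3; field.
rewrite e2 e4 e5 e3.
have J3 : 2 * J + 1 + 1 != 0 by rewrite gt_eqF//; lra.
apply: (@eq_trans _ _ ((M + 1) / (J + 1) * (c0 * u0 * B0))).
  by field; rewrite J1 J2 J3 M2.
by rewrite h6; field; rewrite J1 K2.
Qed.

End GeneralizedTranslation.

Section TranslationContraction.
Context {R : realType}.
Local Notation C := R[i].

(** For k = 2 K the terms add up to (x^2 + (1 - x^2))^K times 2/(2K + 1); for odd k every term
    vanishes. *)
Lemma ipoly_tmono (x : R) k : ipoly (tmono x k) = ipoly 'X^k.
Proof.
rewrite /tmono ipoly_sum.
rewrite (eq_bigr (fun i : 'I_k.+1 => 'C(k, i)%:R * x ^+ (k - i) * arcsine_moment i *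
   (1 - x ^+ 2) ^+ i./2 * ibeta (k - i) i./2)); last by move=> i _; rewrite ipolyZ.
have [ok|ek] := boolP (odd k).
  rewrite ipolyXn ok big1// => i _; have [oi|ei] := boolP (odd i).
    by rewrite /arcsine_moment oi mulr0 !mul0r.
  rewrite ibeta_odd ?mulr0// oddB; last by rewrite -ltnS.
  by rewrite ok (negbTE ei).
have kE : k = k./2.*2 by rewrite -[LHS]odd_double_half (negbTE ek).
move: (k./2) kE => K -> {k ek}.
rewrite (@sum_even_index _ (fun i => 'C(K.*2, i)%:R * x ^+ (K.*2 - i) * arcsine_moment i *
   (1 - x ^+ 2) ^+ i./2 * ibeta (K.*2 - i) i./2)); last first.
  by move=> i oi; rewrite /arcsine_moment oi mulr0 !mul0r.
rewrite (eq_bigr (fun j : 'I_K.+1 => ((x ^+ 2) ^+ (K - j) * (1 - x ^+ 2) ^+ j *+ 'C(K, j)) * (2 / K.*2.+1%:R))); last first.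
  move=> j _; rewrite half_double -doubleB.
  rewrite (_ : _ * ibeta _ _ = x ^+ (K - j).*2 * (1 - x ^+ 2) ^+ j *
     ('C(K.*2, j.*2)%:R * arcsine_moment j.*2 * ibeta (K - j).*2 j)); last by ring.
  rewrite moment_identity; last by rewrite -ltnS.
  by rewrite -mul2n exprM -[_ *+ 'C(_, _)]mulr_natr; ring.
rewrite -mulr_suml -exprDn addrCA subrr addr0 expr1n mul1r ipolyXn odd_double.
by [].
Qed.

(** The real version is applied to polynomial majorants of |P|^p, the complex version below to [P]
    itself. *)
Definition rtrans (x : R) (g : {poly R}) : {poly R} :=
  \sum_(k < size g) g`_k *: tmono x k.

Definition ctrans (x : R) (P : {poly C}) : {poly C} :=
  \sum_(k < size P) P`_k *: map_poly (real_complex R) (tmono x k).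

Lemma ipoly_rtrans (x : R) (g : {poly R}) : ipoly (rtrans x g) = ipoly g.
Proof.
rewrite /rtrans ipoly_sum -[g in RHS]coefK poly_def ipoly_sum.
by apply: eq_bigr => k _; rewrite !ipolyZ ipoly_tmono.
Qed.

(* Averaging over the N-th roots of unity, N > k, gives the same moments as the circle. *)
Definition tnode (x y : R) N j : R :=
  x * y + Num.sqrt (1 - x ^+ 2) * Num.sqrt (1 - y ^+ 2) * complex.Re (uroot N ^+ j : C).

(** With x = cos alpha and y = cos beta, the node lies between cos(alpha + beta) and cos(alpha -
    beta). *)
Lemma tnode_itv (x y : R) N j : -1 <= x <= 1 -> -1 <= y <= 1 -> -1 <= tnode x y N j <= 1.
Proof.
have sq (z : R) : -1 <= z <= 1 -> 0 <= 1 - z ^+ 2.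
  by rewrite -ler_norml => h; rewrite subr_ge0 -real_normK ?num_real// expr_le1.
move=> /sq hx /sq hy; rewrite /tnode.
set a := Num.sqrt (1 - x ^+ 2); set b := Num.sqrt (1 - y ^+ 2).
have a2 : a ^+ 2 = 1 - x ^+ 2 by rewrite sqr_sqrtr.
have b2 : b ^+ 2 = 1 - y ^+ 2 by rewrite sqr_sqrtr.
set c := complex.Re _.
have c1 : `|c| <= 1 by apply: le_trans (cn_Re _) _; rewrite cn_uroot.
have a0 : 0 <= a by exact: sqrtr_ge0.
have b0 : 0 <= b by exact: sqrtr_ge0.
have abc : `|a * b * c| <= a * b.
  by rewrite normrM ger0_norm ?mulr_ge0// ler_piMr// mulr_ge0.
have h1 := sqr_ge0 (x - y); have h2 := sqr_ge0 (x + y); have h3 := sqr_ge0 (a - b).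
move: abc; rewrite ler_norml => /andP[k1 k2].
have e1 : (x - y) ^+ 2 + (a - b) ^+ 2 = 2 - 2 * (x * y + a * b).
  by rewrite !sqrrB a2 b2; ring.
have e2 : (x + y) ^+ 2 + (a - b) ^+ 2 = 2 + 2 * (x * y - a * b).
  by rewrite sqrrB sqrrD a2 b2; ring.
lra.
Qed.

Lemma rtrans_avg (x y : R) (g : {poly R}) N : (size g <= N)%N -> (0 < N)%N -> -1 <= x <= 1 -> -1 <= y <= 1 ->
  (rtrans x g).[y] = N%:R^-1 * \sum_(j < N) g.[tnode x y N j].
Proof.
move=> gN N0 hx hy; rewrite /rtrans horner_sum.
rewrite (eq_bigr (fun k : 'I_(size g) => N%:R^-1 * \sum_(j < N) g`_k * tnode x y N j ^+ k)); last first.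
  move=> k _; rewrite hornerZ (@tmono_avg _ _ _ N) ?(leq_trans (ltn_ord k))//.
  by rewrite mulrCA -mulr_sumr.
rewrite -mulr_sumr; congr (_ * _); rewrite exchange_big /=; apply: eq_bigr => j _.
by rewrite horner_coef.
Qed.

Lemma ctrans_avg (x y : R) (P : {poly C}) N : (size P <= N)%N -> (0 < N)%N -> -1 <= x <= 1 -> -1 <= y <= 1 ->
  (ctrans x P).[y%:C%C] = N%:R^-1 * \sum_(j < N) P.[(tnode x y N j)%:C%C].
Proof.
move=> PN N0 hx hy; rewrite /ctrans horner_sum.
rewrite (eq_bigr (fun k : 'I_(size P) => N%:R^-1 * \sum_(j < N) P`_k * (tnode x y N j)%:C%C ^+ k)); last first.
  move=> k _; rewrite hornerZ horner_map /= (@tmono_avg _ _ _ N) ?(leq_trans (ltn_ord k))//.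
  rewrite rmorphM rmorph_sum fmorphV rmorph_nat /= mulrCA mulr_sumr; congr (_ * _).
  by apply: eq_bigr => j _; rewrite rmorphXn.
rewrite -mulr_sumr; congr (_ * _); rewrite exchange_big /=; apply: eq_bigr => j _.
by rewrite horner_coef.
Qed.

Definition Apoly (p : R) (P : {poly C}) : R :=
  RI (fun t => cn P.[t%:C%C] `^ p) (-1) 1.

Lemma cont_cn_horner (P : {poly C}) : continuous (fun t : R => cn P.[t%:C%C]).
Proof.
apply: rcont_cn; apply: ccont_comp; first exact: horner_ccont.
by apply: rcont_real; exact: cont_id.
Qed.

Lemma cont_cn_powR (p : R) (P : {poly C}) : 1 <= p -> continuous (fun t : R => cn P.[t%:C%C] `^ p).
Proof.
move=> p1; apply: powR_ge0_cont => //; first exact: cont_cn_horner.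
by move=> t; exact: cn_ge0.
Qed.

(** The translate is an average of values of [P], so the sup bound is immediate and Jensen's
    inequality bounds |Q|^p by the average of |P|^p. Invariance of the integral is known for
    polynomials, so |P|^p is first replaced by a polynomial majorant. *)
Lemma translation (p x : R) (P : {poly C}) n : 1 <= p -> (size P <= n.+1)%N -> -1 <= x <= 1 ->
  exists Q : {poly C}, [/\ (size Q <= n.+1)%N, Q.[1] = P.[x%:C%C],
    (forall M : R, (forall y : R, -1 <= y <= 1 -> cn P.[y%:C%C] <= M) ->
       forall y : R, -1 <= y <= 1 -> cn Q.[y%:C%C] <= M) &
    Apoly p Q <= Apoly p P].
Proof.
move=> p1 Pn hx; have p0 : 0 < p by lra.
exists (ctrans x P); split.
- apply: leq_trans (size_sum _ _ _) _; apply/bigmax_leqP => k _.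
  apply: leq_trans (size_scale_leq _ _) _.
  rewrite size_map_poly; apply: leq_trans (size_tmono _ _) _.
  exact: leq_trans Pn.
- rewrite /ctrans horner_sum [in RHS]horner_coef; apply: eq_bigr => k _.
  rewrite hornerZ -[1 in LHS](rmorph1 (real_complex R)) horner_map /= tmono1.
  by rewrite rmorphXn.
- move=> M hM y hy; pose N := (size P).+1.
  have N0 : 0 < N%:R :> R by rewrite ltr0n.
  have PN : (size P <= N)%N by exact: leqnSn.
  rewrite (ctrans_avg PN)// cnM cnV cn_nat mulrC ler_pdivrMr//.
  apply: le_trans (cn_sum _ _ _) _.
  apply: (@le_trans _ _ (\sum_(j < N) M)); last by rewrite sumr_const card_ord mulr_natr.
  by apply: ler_sum => j _; apply: hM; exact: tnode_itv.
apply/ler_addgt0Pr => e e0.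
have e40 : 0 < e / 4 by rewrite divr_gt0.
have [g hg] := weierstrass (@cont_cn_powR p P p1) e40.
(* Raising the approximant by its error puts it above |P|^p, at a distance of at most e/2. *)
pose G := g + (e / 4)%:P.
have GE (y : R) : G.[y] = g.[y] + e / 4 by rewrite /G hornerD hornerC.
have GP (y : R) : -1 <= y <= 1 -> cn P.[y%:C%C] `^ p <= G.[y].
  by move=> /hg; rewrite GE ler_norml => /andP[_]; rewrite lerBlDl addrC.
have GPe (y : R) : -1 <= y <= 1 -> G.[y] <= cn P.[y%:C%C] `^ p + e / 2.
  by move=> /hg; rewrite GE ler_norml => /andP[+ _]; lra.
apply: (@le_trans _ _ (ipoly (rtrans x G))); last first.
  rewrite ipoly_rtrans (_ : e = e / 2 * (1 - -1)); last by field.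
  rewrite /ipoly /Apoly -RI_cst ?m1_le1// -RID; last 2 first.
  - exact: cont_cn_powR.
  - exact: (@cst_continuous _ _ (e / 2 : R)).
  apply: RI_le => //; first exact: continuous_horner.
  move=> t; apply: cvgD; last exact: cvg_cst.
  exact: (@cont_cn_powR p P p1).
apply: RI_le; [exact: cont_cn_powR|exact: continuous_horner|].
move=> y hy; pose N := (maxn (size P) (size G)).+1.
have N0 : 0 < N%:R :> R by rewrite ltr0n.
have PN : (size P <= N)%N by rewrite leqW// leq_maxl.
have GN : (size G <= N)%N by rewrite leqW// leq_maxr.
rewrite (ctrans_avg PN)// (rtrans_avg GN)// cnM cnV cn_nat.
have N1 : \sum_(j < N) N%:R^-1 = 1 :> R.
  by rewrite sumr_const card_ord -[_ *+ N]mulr_natr mulVf// gt_eqF.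
apply: (@le_trans _ _ ((\sum_(j < N) N%:R^-1 * cn P.[(tnode x y N j)%:C%C]) `^ p)).
  apply: ge0_ler_powR; rewrite ?nnegrE ?(ltW p0) ?mulr_ge0 ?cn_ge0 ?invr_ge0//.
    by apply: sumr_ge0 => j _; rewrite mulr_ge0 ?cn_ge0 ?invr_ge0.
  by rewrite -mulr_sumr; apply: ler_wpM2l; [rewrite invr_ge0 ler0n|exact: cn_sum].
apply: (le_trans (@powR_jensen _ p _ (fun _ => N%:R^-1) (fun j : 'I_N => cn P.[(tnode x y N j)%:C%C]) p1 _ N1 _)).
- by move=> j; rewrite invr_ge0.
- by move=> j; exact: cn_ge0.
rewrite mulr_sumr; apply: ler_sum => j _; apply: ler_wpM2l; first by rewrite invr_ge0.
by apply: GP; exact: tnode_itv.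
Qed.

End TranslationContraction.

(** * Polynomials near the endpoint *)

Section EndpointMarkov.
Context {R : realType}.
Local Notation C := R[i].

(** Odd binomial terms cancel and even ones are nonnegative; the term of index 2 gives the bound. *)
Lemma second_difference (x : R) m : 0 <= x ->
  (m.+2 * m.+1)%:R * x ^+ m <= (x + 1) ^+ m.+2 + (x - 1) ^+ m.+2 - 2 * x ^+ m.+2.
Proof.
move=> x0; rewrite !exprDn -big_split /=.
rewrite (eq_bigr (fun i : 'I_m.+3 => x ^+ (m.+2 - i) * (1 + (-1) ^+ i) * 'C(m.+2, i)%:R)); last first.
  move=> i _; rewrite -[_ *+ 'C(_, _)]mulr_natr -[X in _ + X]mulr_natr expr1n; ring.
rewrite !big_ord_recl /= !bin0 bin1 subn0 !expr0.
have B : 'C(m.+2, 2)%:R * 2 = (m.+2 * m.+1)%:R :> R.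
  by rewrite -natrM mulnC -(mul_bin_diag m.+2 1) bin1.
have S0 : 0 <= \sum_(i < m) x ^+ (m.+2 - bump 0 (bump 0 (bump 0 i))) *
    (1 + (-1) ^+ bump 0 (bump 0 (bump 0 i))) * 'C(m.+2, bump 0 (bump 0 (bump 0 i)))%:R :> R.
  apply: sumr_ge0 => i _; rewrite !mulr_ge0 ?exprn_ge0//.
  by rewrite -signr_odd; case: odd; rewrite ?expr0 ?expr1; lra.
rewrite -[bump 0 0]/1%N -[bump 0 1]/2%N !subSS !subn0 -B expr1 expr2.
move: S0; set S := \sum_(i < m) _ => S0.
set a := x ^+ m.+2; set b := x ^+ m; set d := x ^+ m.+1.
lra.
Qed.

Definition cheb1 n : {poly R} := cheb n \Po ('X + 1).

Lemma cheb1_rec n k : (cheb1 n.+2)`_k =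
  2 * (cheb1 n.+1)`_k + 2 * (if k is k'.+1 then (cheb1 n.+1)`_k' else 0) - (cheb1 n)`_k.
Proof.
have -> : cheb1 n.+2 = ('X + 1) * cheb1 n.+1 *+ 2 - cheb1 n.
  by rewrite /cheb1 chebSS comp_polyB comp_polyM raddfMn /= comp_polyX mulrnAl.
rewrite coefB coefMn mulrDl mul1r coefD coefXM.
by case: k => [|k] /=; ring.
Qed.

(** The coefficient of x^k in cosh(n sqrt(2 x)), the model of T_n(1 + x) near the endpoint. *)
Definition chebbound (n k : nat) : R := 2 ^+ k * n%:R ^+ (2 * k) / (2 * k)`!%:R.

Lemma factR_gt0 n : 0 < n`!%:R :> R. Proof. by rewrite ltr0n fact_gt0. Qed.

(** In [n], the second difference of the k-th coefficient is twice the coefficient k - 1, and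
    [chebbound] has at least that second difference. The induction therefore carries both the values
    and the first differences. *)
Lemma cheb1_coef_bound n k : (cheb1 n)`_k <= chebbound n k.
Proof.
suff [] : (cheb1 n)`_k <= chebbound n k /\
  (cheb1 n.+1)`_k - (cheb1 n)`_k <= chebbound n.+1 k - chebbound n k by [].
elim: n k => [|n IH] k.
  rewrite /chebbound /cheb1 /= comp_polyX -[1 \Po _]/(1 \Po _) (rmorph1 (comp_poly ('X + 1))).
  rewrite coefD coefX !coefC expr1n.
  case: k => [|[|k]] /=; rewrite ?muln0 ?expr0 ?expr0n /=; first by rewrite fact0 divr1; split; lra.
    rewrite muln1 expr1 (_ : 2`! = 2%N)//; split; lra.
  rewrite !mulr0 !mul0r !mulr1 addr0 !subr0; split => //.
  by rewrite divr_ge0 ?exprn_ge0 ?ler0n.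
have [h1 h2] := IH k; split; first by lra.
have h3 : 2 * (if k is k'.+1 then (cheb1 n.+1)`_k' else 0) <=
    chebbound n.+2 k + chebbound n k - 2 * chebbound n.+1 k.
  case: k {h1 h2} => [|k]; first by rewrite /chebbound muln0 !expr0; lra.
  have [k1 k2] := IH k.
  have k3 : (cheb1 n.+1)`_k <= chebbound n.+1 k by lra.
  apply: le_trans (ler_wpM2l (ler0n R 2) k3) _.
  have := @second_difference n.+1%:R (2 * k)%N (ler0n _ _).
  rewrite natr1 -[X in X - 1]natr1 addrK => h.
  rewrite /chebbound mulnS add2n exprS.
  have F : (2 * k).+2`!%:R = ((2 * k).+2 * (2 * k).+1)%:R * (2 * k)`!%:R :> R.
    by rewrite -natrM !factS mulnA.
  have c0 : 0 < ((2 * k).+2 * (2 * k).+1)%:R :> R by rewrite ltr0n.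
  rewrite F.
  have F0 := factR_gt0 (2 * k).
  move: (((2 * k).+2 * (2 * k).+1)%:R) c0 h => c c0 h.
  have h' := ler_wpM2l (_ : 0 <= 2 * 2 ^+ k / (c * (2 * k)`!%:R)) h.
  have p0 : 0 <= 2 * 2 ^+ k / (c * (2 * k)`!%:R).
    by rewrite divr_ge0 ?mulr_ge0 ?exprn_ge0 ?(ltW F0) ?(ltW c0).
  have {}h' := h' p0.
  apply: (@le_trans _ _ (2 * 2 ^+ k / (c * (2 * k)`!%:R) * (c * n.+1%:R ^+ (2 * k)))).
    by rewrite le_eqVlt; apply/orP; left; apply/eqP; field; rewrite !gt_eqF.
  apply: le_trans h' _; rewrite le_eqVlt; apply/orP; left; apply/eqP; field.
  by rewrite !gt_eqF.
rewrite cheb1_rec; lra.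
Qed.

Lemma cos_node_decr n i j : (i < j <= n)%N -> cos (pi *+ j / n%:R) < cos (pi *+ i / n%:R) :> R.
Proof.
move=> /andP[ij jn]; have n0 : 0 < n%:R :> R by rewrite ltr0n; lia.
have H k : (k <= n)%N -> pi *+ k / n%:R \in `[0 : R, pi].
  move=> kn; have := pi_gt0 R; move: pi => c c0.
  rewrite in_itv /= divr_ge0 ?mulrn_wge0 ?ler0n ?(ltW c0)//=.
  by rewrite ler_pdivrMr// -[c *+ k]mulr_natr ler_pM2l// ler_nat.
have inn : (i <= n)%N by lia.
rewrite (ltr_cos (H i inn) (H j jn)).
by rewrite ltr_pM2r ?invr_gt0// ltr_pMn2l ?pi_gt0.
Qed.

End EndpointMarkov.

(** * Lagrange interpolation at the Chebyshev extrema *)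

Section LagrangeEndpoint.
Context {R : realType}.
Local Notation C := R[i].
Context (n : nat) (n_gt0 : (0 < n)%N).

Definition node (j : nat) : R := cos (pi *+ j / n%:R).

Definition lnum (j : 'I_n.+1) : {poly R} := \prod_(i < n.+1 | i != j) ('X - (node i)%:P).

Lemma node_itv j : -1 <= node j <= 1.
Proof. by rewrite cos_geN1 cos_le1. Qed.

Lemma node_inj (i j : 'I_n.+1) : node i = node j -> i = j.
Proof.
move=> e; apply/val_inj => /=; case: (ltngtP i j) => // ij; exfalso.
  have := @cos_node_decr R n i j; rewrite ij -ltnS ltn_ord => /(_ isT).
  by rewrite -/(node _) -/(node _) e ltxx.
have := @cos_node_decr R n j i; rewrite ij -ltnS ltn_ord => /(_ isT).
by rewrite -/(node _) -/(node _) e ltxx.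
Qed.

Lemma lnum_root (i j : 'I_n.+1) : i != j -> (lnum j).[node i] = 0.
Proof.
move=> ij; rewrite /lnum horner_prod (bigD1 i)//= hornerXsubC subrr mul0r//.
Qed.

(** The nodes decrease, so exactly the factors with i < j are negative. *)
Lemma lnum_sign (j : 'I_n.+1) : 0 < (-1) ^+ j * (lnum j).[node j].
Proof.
have -> : (-1) ^+ j = \prod_(i < n.+1 | i != j) (if (i < j)%N then -1 else 1) :> R.
  rewrite -big_mkcondr /=.
  have H := @big_ord_widen R 1 *%R (nat_of_ord j) n.+1 (fun _ => -1) (ltnW (ltn_ord j)).
  have -> : (-1) ^+ j = \prod_(i < j) -1 :> R by rewrite prodr_const card_ord.
  rewrite H; apply: eq_bigl => i.
  by case: (ltngtP i j) => //=; rewrite ?andbT ?andbF// => h; apply/esym; rewrite -val_eqE /= ltn_eqF.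
rewrite /lnum horner_prod -big_split /=; apply: prodr_gt0 => i ij.
rewrite hornerXsubC; case: (ltngtP i j) => h.
- rewrite mulN1r opprB subr_gt0; apply: cos_node_decr.
  by rewrite h -ltnS ltn_ord.
- rewrite mul1r subr_gt0; apply: cos_node_decr.
  by rewrite h -ltnS ltn_ord.
- by case/eqP: ij; apply/val_inj.
Qed.

Lemma lnum_den j : (lnum j).[node j] != 0.
Proof. by apply/eqP => e; have := lnum_sign j; rewrite e mulr0 ltxx. Qed.

Lemma prod_coef_ge0 (I : Type) (r : seq I) (Q : pred I) (F : I -> {poly R}) :
  (forall i k, 0 <= (F i)`_k) -> forall k, 0 <= (\prod_(i <- r | Q i) F i)`_k.
Proof.
move=> F0; elim/big_rec: _ => [|i q _ IH] k; first by rewrite coefC; case: ifP.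
by rewrite coefM sumr_ge0// => l _; rewrite mulr_ge0.
Qed.

(** Shifted to 1, every factor is X + (1 - node i) with node i <= 1. *)
Lemma lnum_coef_ge0 j k : 0 <= (lnum j \Po ('X + 1))`_k.
Proof.
rewrite /lnum rmorph_prod /=; apply: prod_coef_ge0 => i l.
rewrite comp_polyB comp_polyX comp_polyC coefB coefD coefX !coefC.
have /andP[_ x1] := node_itv i.
by case: l => [|[|l]] /=; lra.
Qed.

Lemma size_lnum j : (size (lnum j) <= n.+1)%N.
Proof.
rewrite /lnum; have := @size_prod_leq _ _ (fun i : 'I_n.+1 => i != j) (fun i => 'X - (node i)%:P).
move=> h; apply: leq_trans h _.
rewrite (eq_bigr (fun=> 2)) => [|i _]; last by rewrite size_XsubC.
have cE : #|[pred i : 'I_n.+1 | i != j]| = n.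
  by have := cardC1 j; rewrite card_ord.
by rewrite sum_nat_const cE; lia.
Qed.

Lemma interpolation_unique (q : {poly C}) : (size q <= n.+1)%N ->
  (forall j : 'I_n.+1, q.[(node j)%:C%C] = 0) -> q = 0.
Proof.
move=> qn q0.
pose rs : seq C := [seq (node (nat_of_ord j))%:C%C | j <- enum 'I_n.+1].
apply: (@roots_geq_poly_eq0 C q rs).
- by apply/allP => _ /mapP[j _ ->]; rewrite /root q0.
- rewrite map_inj_uniq ?enum_uniq// => i j /complexI; exact: node_inj.
- by rewrite size_map size_enum_ord.
Qed.

Lemma lagrange (q : {poly C}) : (size q <= n.+1)%N ->
  q = \sum_(j < n.+1) (q.[(node j)%:C%C] / ((lnum j).[node j])%:C%C) *:
        map_poly (real_complex R) (lnum j).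
Proof.
move=> qn; apply/eqP; rewrite -subr_eq0; apply/eqP; apply: interpolation_unique.
  apply: leq_trans (size_polyD _ _) _; rewrite geq_max qn size_polyN.
  apply: leq_trans (size_sum _ _ _) _; apply/bigmax_leqP => j _.
  by apply: leq_trans (size_scale_leq _ _) _; rewrite size_map_poly size_lnum.
move=> i; rewrite hornerD hornerN horner_sum (bigD1 i)//= big1 => [|j ji].
  rewrite hornerZ horner_map /= divfK ?addr0 ?subrr//.
  by rewrite fmorph_eq0 lnum_den.
have ij : i != j by rewrite eq_sym.
rewrite hornerZ horner_map /= (lnum_root ij) -[(0)%:C%C]/(0 : C).
by rewrite mulr0.
Qed.

Lemma comp_map1 (q : {poly R}) :
  map_poly (real_complex R) q \Po ('X + 1) = map_poly (real_complex R) (q \Po ('X + 1)).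
Proof. by rewrite map_comp_poly rmorphD /= map_polyX rmorph1. Qed.

Lemma lagrange_coef1 (q : {poly C}) k : (size q <= n.+1)%N ->
  (q \Po ('X + 1))`_k = \sum_(j < n.+1) (q.[(node j)%:C%C] / ((lnum j).[node j])%:C%C) *
     ((lnum j \Po ('X + 1))`_k)%:C%C.
Proof.
move=> qn; rewrite [in LHS](lagrange qn) rmorph_sum /= coef_sum.
by apply: eq_bigr => j _; rewrite comp_polyZ coefZ comp_map1 coef_map.
Qed.

Lemma cheb_node (j : nat) : (cheb n).[(node j)%:C%C] = (-1) ^+ j :> C.
Proof.
rewrite /node cheb_cos -[X in cos X](_ : pi *+ j = _); last first.
  by rewrite -[_ *+ n]mulr_natr divfK// pnatr_eq0 -lt0n.
have -> : cos (pi *+ j) = (-1) ^+ j :> R.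
  elim: j => [|j IH]; first by rewrite cos0.
  by rewrite mulrS addrC cosDpi IH exprS mulN1r.
by rewrite rmorphXn rmorphN1.
Qed.

Lemma map_cheb m : map_poly (real_complex R) (cheb m) = cheb m.
Proof.
elim/nat_ind2: m => [||m IH1 IH2]; first by rewrite rmorph1.
  by rewrite map_polyX.
by rewrite !chebSS rmorphB rmorphM rmorphMn /= map_polyX IH1 IH2.
Qed.

(* Expanding at 1 the Lagrange formula on the extrema of T_n, the weights of the values
   at the nodes alternate in sign, like the values of T_n: T_n is extremal. *)
Lemma endpoint_markov (q : {poly C}) (M : R) k : (size q <= n.+1)%N ->
  (forall x : R, -1 <= x <= 1 -> cn q.[x%:C%C] <= M) ->
  cn (q \Po ('X + 1))`_k <= M * chebbound n k.
Proof.
move=> qn hM.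
have M0 : 0 <= M by apply: le_trans (cn_ge0 _) (hM 1 _); lra.
apply: le_trans (ler_wpM2l M0 (@cheb1_coef_bound R n k)).
have E : ((cheb1 n)`_k)%:C%C = \sum_(j < n.+1) ((-1) ^+ j / ((lnum j).[node j])%:C%C) *
     ((lnum j \Po ('X + 1))`_k)%:C%C :> C.
  rewrite -coef_map -comp_map1 map_cheb lagrange_coef1; last exact: size_cheb.
  by apply: eq_bigr => j _; rewrite cheb_node.
have {}E : (cheb1 n)`_k = \sum_(j < n.+1) ((-1) ^+ j / (lnum j).[node j]) * (lnum j \Po ('X + 1))`_k.
  apply: (@complexI R); rewrite E rmorph_sum /=; apply: eq_bigr => j _.
  by rewrite !rmorphM fmorphV rmorphXn rmorphN1.
rewrite E lagrange_coef1// mulr_sumr; apply: le_trans (cn_sum _ _ _) _.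
apply: ler_sum => j _; rewrite !cnM cnV !cn_real mulrA.
rewrite (ger0_norm (lnum_coef_ge0 j k)); apply: ler_wpM2r; first exact: lnum_coef_ge0.
have -> : (-1) ^+ j / (lnum j).[node j] = `|(lnum j).[node j]|^-1.
  have s := lnum_sign j; have e : `|(-1) ^+ j * (lnum j).[node j]| = `|(lnum j).[node j]|.
    by rewrite normrM normrX normrN1 expr1n mul1r.
  by rewrite -e gtr0_norm// invfM -exprVn invrN1.
by apply: ler_wpM2r; [rewrite invr_ge0|apply: hM; exact: node_itv].
Qed.

End LagrangeEndpoint.

(** * A Nikolskii inequality *)

Section Nikolskii.
Context {R : realType}.
Local Notation C := R[i].

Lemma horner_shift1 (Q : {poly C}) n (z : C) : (size Q <= n.+1)%N ->
  Q.[1 + z] = \sum_(k < n.+1) (Q \Po ('X + 1))`_k * z ^+ k.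
Proof.
move=> Qn; have -> : Q.[1 + z] = (Q \Po ('X + 1)).[z].
  by rewrite horner_comp !hornerE addrC.
apply: horner_coef_wide; rewrite size_comp_poly2 //.
by rewrite -polyC1 size_XaddC.
Qed.

Lemma chebbound_pow (n k : nat) (s : R) :
  chebbound n k * s ^+ k = (2 * n%:R ^+ 2 * s) ^+ k / (2 * k)`!%:R.
Proof. by rewrite /chebbound exprM [(2 * _ * s) ^+ k]exprMn [(2 * _) ^+ k]exprMn; ring. Qed.

Lemma sum_half n : \sum_(k < n) (2^-1 : R) ^+ k.+1 <= 1.
Proof.
suff -> : \sum_(k < n) (2^-1 : R) ^+ k.+1 = 1 - 2^-1 ^+ n.
  by rewrite gerBl exprn_ge0.
elim: n => [|n IH]; first by rewrite big_ord0 expr0 subrr.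
by rewrite big_ord_recr /= IH exprS; field.
Qed.

(** Once the maximum M is moved to 1, the endpoint bound on Taylor coefficients keeps the modulus
    above M/2 on [1 - d, 1], so the integral is at least (M/2)^p d. *)
Lemma nikolskii (p : R) n (P : {poly C}) (x : R) : 1 <= p -> (0 < n)%N ->
  (size P <= n.+1)%N -> -1 <= x <= 1 ->
  cn P.[x%:C%C] `^ p <= 2 `^ p * (4 * n%:R ^+ 2) * Apoly p P.
Proof.
move=> p1 n0 Pn hx; have p0 : 0 < p by lra.
have n0' : 0 < n%:R :> R by rewrite ltr0n.
have [x0 hx0 hmax] := EVT_max (@m1_le1 R) (continuous_subspaceT (@cont_cn_horner R P)).
rewrite in_itv /= in hx0.
set M := cn P.[x0%:C%C] in hmax.
have hM (y : R) : -1 <= y <= 1 -> cn P.[y%:C%C] <= M by move=> hy; apply: hmax; rewrite in_itv.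
have M0 : 0 <= M by exact: cn_ge0.
have [Q [Qn Q1 QM QA]] := translation p1 Pn hx0.
have {}QM := QM M hM.
(* For s <= d the k-th Taylor term is at most M (2 n^2 s)^k/(2k)! <= (M/2) 2^-k, because (2k)! >= 2
   for k >= 1; these add up to at most M/2. *)
have [d dE] : exists d : R, d = (4 * n%:R ^+ 2)^-1 by exists (4 * n%:R ^+ 2)^-1.
have nn1 : 1 <= n%:R ^+ 2 :> R by rewrite -natrX ler1n expn_gt0 n0.
have d0 : 0 < d by rewrite dE invr_gt0 mulr_gt0// exprn_gt0.
have d1 : d <= 1.
  have h4 : 1 <= 4 * n%:R ^+ 2 :> R by apply: (le_trans nn1); rewrite ler_peMl ?exprn_ge0// ler1n.
  by rewrite dE invf_le1// (lt_le_trans ltr01).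
have half (t : R) : 1 - d <= t <= 1 -> M / 2 <= cn Q.[t%:C%C].
  move=> /andP[t0 t1]; pose s := 1 - t.
  have hs : 0 <= s <= d by rewrite /s subr_ge0 t1 /= lerBlDr addrC -lerBlDr.
  have -> : t%:C%C = 1 + (- s)%:C%C :> C.
    by rewrite /s opprB; apply/eqP; rewrite eq_complex /= addr0 eqxx andbT; apply/eqP; ring.
  rewrite (horner_shift1 _ Qn) big_ord_recl /= expr0 mulr1.
  have -> : (Q \Po ('X + 1))`_0 = Q.[1].
    by rewrite -horner_coef0 horner_comp !hornerE.
  set S := \sum_(i < n) _.
  have hS : cn S <= M / 2.
    rewrite /S; apply: le_trans (cn_sum _ _ _) _.
    apply: (@le_trans _ _ (\sum_(k < n) M / 2 * 2^-1 ^+ k.+1)); last first.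
      by rewrite -mulr_sumr -[leRHS]mulr1 ler_wpM2l ?divr_ge0// sum_half.
    apply: ler_sum => k _; rewrite -[bump 0 k]/(k.+1) cnM cnX cn_real normrN.
    have [s0 sd] := andP hs; rewrite (ger0_norm s0).
    have h1 := endpoint_markov n0 k.+1 Qn QM.
    apply: le_trans (ler_wpM2r (exprn_ge0 _ s0) h1) _.
    rewrite -![M * _ * _]mulrA; apply: ler_wpM2l => //.
    rewrite chebbound_pow mulrC; apply: ler_pM.
    - by rewrite invr_ge0.
    - by rewrite exprn_ge0// mulr_ge0// mulr_ge0// exprn_ge0.
    - rewrite lef_pV2 ?posrE ?ltr0n ?fact_gt0// ler_nat mulnS.
      by apply: leq_trans (fact_geq _); rewrite leq_addr.
    - apply: lerXn2r; rewrite ?nnegrE ?mulr_ge0 ?exprn_ge0//.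
      apply: le_trans (ler_wpM2l _ sd) _; first by rewrite mulr_ge0 ?exprn_ge0.
      by rewrite dE le_eqVlt; apply/orP; left; apply/eqP; field; rewrite gt_eqF.
  apply: le_trans (_ : M - cn S <= _); last by have := cnB_ge Q.[1] (- S); rewrite opprK cnN Q1.
  by rewrite lerBrDr (le_trans (lerD (lexx _) hS))// -splitr.
have A1 : (M / 2) `^ p * d <= Apoly p Q.
  have cQ := @cont_cn_powR R p Q p1.
  have m1d : -1 <= 1 - d by rewrite lerBrDr (le_trans (lerD (lexx _) d1))// addNr.
  have d11 : 1 - d <= 1 by rewrite gerBl ltW.
  rewrite /Apoly (@RI_split _ _ (-1) (1 - d) 1)//.
  have h1 : 0 <= RI (fun t => cn Q.[t%:C%C] `^ p) (-1) (1 - d).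
    by apply: RI_ge0 => t _; exact: powR_ge0.
  suff h2 : (M / 2) `^ p * d <= RI (fun t => cn Q.[t%:C%C] `^ p) (1 - d) 1.
    by rewrite (le_trans h2)// lerDr.
  have -> : (M / 2) `^ p * d = RI (fun _ : R => (M / 2) `^ p) (1 - d) 1.
    by rewrite RI_cst//; congr (_ * _); ring.
  apply: RI_le => //; first exact: (@cst_continuous _ _ ((M / 2) `^ p)).
  move=> t ht; apply: ge0_ler_powR; rewrite ?nnegrE ?divr_ge0 ?cn_ge0 ?(ltW p0)//.
  exact: half.
have A2 : (M / 2) `^ p * d <= Apoly p P := le_trans A1 QA.
apply: (@le_trans _ _ (M `^ p)).
  by apply: ge0_ler_powR; rewrite ?nnegrE ?cn_ge0 ?(ltW p0)// hM.
have -> : M `^ p = 2 `^ p * (4 * n%:R ^+ 2) * ((M / 2) `^ p * d).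
  rewrite dE -{1}[M](divfK (_ : 2 != 0)) ?pnatr_eq0// powRM ?divr_ge0//.
  by field; rewrite gt_eqF.
by apply: ler_wpM2l => //; rewrite !mulr_ge0 ?powR_ge0 ?exprn_ge0.
Qed.

Lemma Apoly_subst (p a : R) (P : {poly C}) : 1 <= p -> 0 < a ->
  Apoly p P = (a ^+ 2)^-1 *
    RI (fun v => cn P.[(1 - v ^+ 2 / (2 * a ^+ 2))%:C%C] `^ p * v) 0 (2 * a).
Proof.
move=> p1 a0; have a2 : a ^+ 2 != 0 by rewrite expf_neq0// gt_eqF.
pose h (v : R) : R := 1 - v ^+ 2 / (2 * a ^+ 2).
pose h' (v : R) : R := - (a ^+ 2)^-1 * v.
have dh (x : R) : is_derive x 1 h (h' x).
  have -> : h = horner (1 - (2 * a ^+ 2)^-1 *: 'X^2).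
    by apply/funext => v; rewrite /h hornerD hornerN hornerC hornerZ hornerXn mulrC.
  apply: is_derive_eq; rewrite derivB derivZ derivXn (_ : 1^`() = 0); last by rewrite -polyC1 derivC.
  rewrite /h' sub0r hornerN hornerZ hornerMn hornerXn /= expr1; field.
  by rewrite gt_eqF.
have ch : continuous h.
  move=> x; apply/differentiable_continuous/derivable1_diffP.
  exact: (@ex_derive _ _ _ _ _ _ _ (dh x)).
have ch' : continuous h' by move=> x; apply: cvgMr; exact: cvg_id.
have aa : 0 <= 2 * a by rewrite mulr_ge0// ltW.
have [_ H] := @RI_subst R (fun t => cn P.[t%:C%C] `^ p) h h' 0 (2 * a) aa (@cont_cn_powR R p P p1) ch ch' (fun x _ => dh x).
have h0 : h 0 = 1 by rewrite /h expr0n /= mul0r subr0.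
have h2 : h (2 * a) = -1 by rewrite /h; field; rewrite gt_eqF.
move: H; rewrite h0 h2 => /(_ (@m1_le1 R)) H.
rewrite /Apoly -[LHS]opprK -H -mulN1r -!RIZ; last 2 first.
- move=> x; apply: cvgM; last exact: cvg_id.
  apply: (@continuous_comp _ _ _ h (fun t => cn P.[t%:C%C] `^ p)); first exact: ch.
  exact: cont_cn_powR.
- move=> x; apply: cvgM; last exact: ch'.
  apply: (@continuous_comp _ _ _ h (fun t => cn P.[t%:C%C] `^ p)); first exact: ch.
  exact: cont_cn_powR.
by apply: RI_eq => v _; rewrite /h'; ring.
Qed.

End Nikolskii.

(** * Approximation of entire functions near the endpoint *)

Section ApproximationRate.
Context {R : realType}.
Local Notation C := R[i].

Lemma cube_le_expR (d x : R) : 0 < d -> 0 <= x -> x ^+ 3 <= (3 / d) ^+ 3 * expR (d * x).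
Proof.
move=> d0 x0; have y0 : 0 <= d * x / 3 by rewrite divr_ge0 ?mulr_ge0// ltW.
have h : (d * x / 3) ^+ 3 <= expR (d * x).
  rewrite (_ : d * x = 3 * (d * x / 3)); last by field.
  rewrite expRM_natl; apply: lerXn2r; rewrite ?nnegrE ?expR_ge0//.
    by rewrite (_ : 3 * _ / 3 = d * x / 3)//; field.
  rewrite (_ : 3 * _ / 3 = d * x / 3); last by field.
  by apply: le_trans (expR_ge1Dx _); rewrite lerDr.
have -> : x ^+ 3 = (3 / d) ^+ 3 * (d * x / 3) ^+ 3 by field; rewrite gt_eqF.
by apply: ler_wpM2l => //; rewrite exprn_ge0// divr_ge0// ltW.
Qed.

(** The exponentially small error is weakened to n^-3: its p-th power, integrated against the weight
    over a length of order n, is then O(1/n). *)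
Lemma approx_rate (f : C -> C) (kappa r K omega : R) : poly_approximable f ->
  (forall z, f (- z) = f z) -> 0 < kappa -> 1 < r -> 0 <= K -> omega < 2 * ln r ->
  (forall (n : nat) v, cn v = r ->
     cn (f ((kappa * n%:R)%:C%C * (v - v^-1) * 'i%C)) <= K * expR (omega * n%:R)) ->
  exists2 D : R, 0 <= D & forall n, (0 < n)%N -> exists2 P : {poly C}, (size P <= n.+1)%N &
    forall t : R, 0 <= t <= 2 * (kappa * n%:R) ->
      cn (P.[(1 - t ^+ 2 / (2 * (kappa * n%:R) ^+ 2))%:C%C] - f t%:C%C) <= D / n%:R ^+ 3.
Proof.
move=> fS fe k0 r1 K0 om hG; have r0 : 0 < r by exact: lt_trans r1.
pose d := 2 * ln r - omega; have d0 : 0 < d by rewrite subr_gt0.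
have q0 : 0 < r ^+ 2 - 1 by rewrite subr_gt0 exprn_egt1.
pose E := (3 / d) ^+ 3.
have E0 : 0 <= E by rewrite exprn_ge0// divr_ge0// ltW.
pose D := 2 * (K * E + 1) / (r ^+ 2 - 1) + 1.
have KE : 0 <= K * E by rewrite mulr_ge0.
exists D => [|n n0].
  by rewrite addr_ge0// divr_ge0 ?(ltW q0)// mulr_ge0// addr_ge0.
have n0' : 0 < n%:R :> R by rewrite ltr0n.
have n3 : 0 < n%:R ^+ 3 :> R by rewrite exprn_gt0.
have a0 : 0 < kappa * n%:R by rewrite mulr_gt0.
have e0 : 0 < (n%:R ^+ 3)^-1 :> R by rewrite invr_gt0.
have [P Pn hP] := even_approx n fS fe a0 r1 e0 (hG n).
exists P => // t /hP h; apply: le_trans h _.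
have rE : r ^+ (2 * n) = expR (d * n%:R) * expR (omega * n%:R).
  rewrite -expRD -mulrDl /d subrK -mulrA expRM_natl [ln r * _]mulrC expRM_natl lnK ?posrE//.
  by rewrite exprAC exprM.
have X1 : 1 <= r ^+ (2 * n) by rewrite exprn_ege1// ltW.
have X0 : 0 < r ^+ (2 * n) by exact: lt_le_trans X1.
have h1 : K * expR (omega * n%:R) <= K * E * r ^+ (2 * n) / n%:R ^+ 3.
  have h := cube_le_expR d0 (ltW n0'); rewrite -/E in h.
  rewrite ler_pdivlMr// rE; have o0 := expR_ge0 (omega * n%:R).
  have := ler_wpM2l (mulr_ge0 K0 o0) h.
  move: (expR (omega * _)) (expR (d * _)) (n%:R ^+ 3) => x y z h'.
  have -> : K * E * (y * x) = K * x * (E * y) by ring.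
  exact: h'.
have h2 : (n%:R ^+ 3)^-1 <= r ^+ (2 * n) / n%:R ^+ 3 :> R.
  by rewrite -[leLHS]mul1r; apply: ler_wpM2r => //; rewrite ltW.
rewrite /D [leRHS]mulrDl mul1r; apply: lerD => //.
rewrite ler_pdivrMr ?mulr_gt0//.
apply: (@le_trans _ _ (2 * (K * E * r ^+ (2 * n) / n%:R ^+ 3 + r ^+ (2 * n) / n%:R ^+ 3))).
  by apply: ler_wpM2l => //; exact: lerD.
rewrite le_eqVlt; apply/orP; left; apply/eqP; field.
by rewrite !gt_eqF.
Qed.

Lemma int_id (L : R) : 0 <= L -> RI (fun v : R => v) 0 L = L ^+ 2 / 2.
Proof.
move=> L0; have -> : RI (fun v : R => v) 0 L = 2^-1 * L ^+ 2 - 2^-1 * 0 ^+ 2.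
  apply: (@RI_FTC _ _ (fun x : R => 2^-1 * x ^+ 2)) => //; first exact: cont_id.
  by move=> x _; apply: is_derive_eq => /=; rewrite /GRing.scale /=; field.
by rewrite expr0n /= mulr0 subr0 mulrC.
Qed.

Lemma Apoly_approx (p a e l I0 : R) (P : {poly C}) (f : C -> C) : 1 <= p -> 0 < a ->
  0 <= e -> 0 < l < 1 -> ccont f ->
  (forall t : R, 0 <= t <= 2 * a ->
     cn (P.[(1 - t ^+ 2 / (2 * a ^+ 2))%:C%C] - f t%:C%C) <= e) ->
  RI (fun v : R => cn (f v%:C%C) `^ p * v) 0 (2 * a) <= I0 ->
  a ^+ 2 * Apoly p P <= l `^ (1 - p) * I0 + (1 - l) `^ (1 - p) * (e `^ p * (2 * a ^+ 2)).
Proof.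
move=> p1 a0 e0 l01 cf hP hI; have p0 : 0 < p by lra.
have a20 : a ^+ 2 != 0 by rewrite expf_neq0// gt_eqF.
rewrite (Apoly_subst P p1 a0) [leLHS]mulrA divff// mul1r.
have cfv : continuous (fun v : R => cn (f v%:C%C) `^ p * v).
  move=> x; apply: cvgM; last exact: cvg_id.
  apply: (@powR_ge0_cont _ _ (fun v : R => cn (f v%:C%C)) p1) => [|t]; last exact: cn_ge0.
  by apply: rcont_cn; apply: ccont_comp => //; apply: rcont_real; exact: cont_id.
have cPv : continuous (fun v : R => cn P.[(1 - v ^+ 2 / (2 * a ^+ 2))%:C%C] `^ p * v).
  move=> x; apply: cvgM; last exact: cvg_id.
  apply: (@continuous_comp _ _ _ (fun v : R => 1 - v ^+ 2 / (2 * a ^+ 2)) (fun t => cn P.[t%:C%C] `^ p)).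
    apply: cvgB; first exact: cvg_cst.
    by apply: cvgMl; exact: exprn_continuous.
  exact: cont_cn_powR.
have aa : 0 <= 2 * a by rewrite mulr_ge0// ltW.
pose c1 := l `^ (1 - p); pose c2 := (1 - l) `^ (1 - p) * e `^ p.
apply: (@le_trans _ _ (RI (fun v : R => c1 * (cn (f v%:C%C) `^ p * v) + c2 * v) 0 (2 * a))).
  apply: RI_le => //.
    move=> x; apply: cvgD; first by apply: cvgMr; exact: cfv.
    by apply: cvgMr; exact: cvg_id.
  move=> v hv; have [v0 _] := andP hv.
  rewrite mulrA -mulrDl; apply: ler_wpM2r => //.
  rewrite /c1 /c2; apply: le_trans (powR_split p1 (cn_ge0 _) e0 l01).
  apply: ge0_ler_powR; rewrite ?nnegrE ?addr_ge0 ?cn_ge0 ?(ltW p0)//.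
  rewrite -[X in cn X <= _](subrK (f v%:C%C)); apply: le_trans (cnD _ _) _.
  by rewrite [leLHS]addrC lerD2l; apply: hP.
rewrite RID; last 2 first.
- by move=> x; apply: cvgMr; exact: cfv.
- by move=> x; apply: cvgMr; exact: cvg_id.
rewrite !RIZ//; last exact: cont_id.
rewrite int_id//; apply: lerD.
  by apply: ler_wpM2l => //; exact: powR_ge0.
by rewrite /c2 -mulrA exprMn (_ : 2 ^+ 2 * a ^+ 2 / 2 = 2 * a ^+ 2)//; field.
Qed.

Lemma powR_cube (p D : R) n : 1 <= p -> 0 <= D -> (0 < n)%N ->
  (D / n%:R ^+ 3) `^ p <= D `^ p / n%:R ^+ 3.
Proof.
move=> p1 D0 n0; have n3 : 0 < n%:R ^+ 3 :> R by rewrite exprn_gt0// ltr0n.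
rewrite powRM ?invr_ge0 ?(ltW n3)//; apply: ler_wpM2l; first exact: powR_ge0.
apply: ge1r_powR => //; rewrite invr_gt0 n3 /= invf_le1//.
by rewrite exprn_ege1// ler1n.
Qed.

(** Crude approximants come from the growth bound alone, with no control on the real line. Their L_p
    integrals are O(1/n^2), so the factor n^2 of the Nikolskii inequality bounds them uniformly in
    [n], on intervals that exhaust the half-line. *)
Lemma even_bounded (p K I0 : R) (f : C -> C) : 1 <= p -> 0 <= K -> entire f ->
  (forall z, f (- z) = f z) ->
  (forall z, cn (f z) <= K * expR (3 / 2 * cn z)) ->
  (forall L, 0 <= L -> RI (fun v : R => cn (f v%:C%C) `^ p * v) 0 L <= I0) ->
  exists2 M : R, 0 <= M & forall x : R, 0 <= x -> cn (f x%:C%C) <= M.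
Proof.
move=> p1 K0 ef fe fK hI; have p0 : 0 < p by lra.
have cf := cderiv_cont (entire_cderiv ef).
(* With kappa = 1/8 and r = 3 the growth exponent is (3/2)(1/8)(3 + 1/3) = 5/8 < 1 < 2 ln 3. *)
have k8 : 0 < 8^-1 :> R by rewrite invr_gt0.
have r3 : 1 < 3 :> R by lra.
have ln3 : 1 < 2 * ln 3 :> R.
  have h : expR (2^-1) < 3 :> R.
    have h := expR_ge1Dx (- 2^-1 : R); rewrite expRN in h.
    have e0 := expR_gt0 (2^-1 : R).
    have : expR (2^-1) * (1 - 2^-1) <= expR (2^-1) * (expR (2^-1))^-1 :> R.
      by apply: ler_wpM2l h; exact: ltW.
    by rewrite divff ?gt_eqF//; lra.
  have : 2^-1 < ln 3 :> R by rewrite -[ltLHS]expRK ltr_ln ?posrE ?expR_gt0.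
  lra.
have hG (n : nat) v : cn v = 3 ->
    cn (f ((8^-1 * n%:R)%:C%C * (v - v^-1) * 'i%C)) <= K * expR (1 * n%:R).
  move=> v3; apply: le_trans (fK _) _; apply: ler_wpM2l => //.
  rewrite ler_expR !cnM cn_i mulr1 cn_real ger0_norm ?mulr_ge0//.
  have : cn (v - v^-1) <= 3 + 3^-1 by apply: le_trans (cnD _ _) _; rewrite cnN cnV v3.
  have : 0 <= n%:R :> R by exact: ler0n.
  move: (n%:R) (cn (v - v^-1)) => N c N0 c1.
  have := ler_wpM2l N0 c1; lra.
have [D D0 hD] := approx_rate (entire_poly_approximable ef) fe k8 r3 K0 ln3 hG.
pose l : R := 2^-1.
have l01 : 0 < l < 1 by rewrite /l; lra.
pose B := 2 `^ p * 4 * 64 * (l `^ (1 - p) * I0 + (1 - l) `^ (1 - p) * D `^ p).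
have I00 : 0 <= I0.
  by apply: le_trans (hI 0 _) => //; rewrite RI_point.
exists (B `^ p^-1 + D); first by rewrite addr_ge0 ?powR_ge0.
move=> x x0.
have [n n0 hn] : exists2 n, (0 < n)%N & x <= 2 * (8^-1 * n%:R).
  exists (Num.bound (4 * x)).+1 => //.
  have := @archi_boundP R (4 * x); rewrite mulr_ge0// => /(_ isT) h.
  rewrite -natr1; lra.
have [P Pn hP] := hD n n0.
have n0' : 0 < n%:R :> R by rewrite ltr0n.
have n1 : 1 <= n%:R :> R by rewrite ler1n.
have a0 : 0 < 8^-1 * n%:R :> R by rewrite mulr_gt0.
have n31 : 1 <= n%:R ^+ 3 :> R by rewrite exprn_ege1.
have e0 : 0 <= D / n%:R ^+ 3 by rewrite divr_ge0 ?exprn_ge0.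
have aa : 0 <= 2 * (8^-1 * n%:R) :> R by rewrite mulr_ge0// ltW.
have H := Apoly_approx p1 a0 e0 l01 cf hP (hI _ aa).
have hx : 0 <= x <= 2 * (8^-1 * n%:R) by rewrite x0.
pose y := 1 - x ^+ 2 / (2 * (8^-1 * n%:R) ^+ 2).
have a2 : 0 < 2 * (8^-1 * n%:R) ^+ 2 :> R by rewrite mulr_gt0// exprn_gt0.
have hy : -1 <= y <= 1.
  rewrite /y; apply/andP; split; last by rewrite gerBl divr_ge0 ?sqr_ge0// ltW.
  rewrite lerBrDr -lerBrDl opprK ler_pdivrMr//.
  have : x ^+ 2 <= (2 * (8^-1 * n%:R)) ^+ 2 by rewrite ler_pXn2r ?nnegrE.
  by rewrite exprMn; lra.
have NK := nikolskii p1 n0 Pn hy.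
have PB : cn P.[y%:C%C] `^ p <= B.
  apply: le_trans NK _.
  have -> : 2 `^ p * (4 * n%:R ^+ 2) * Apoly p P = 2 `^ p * 4 * 64 * ((8^-1 * n%:R) ^+ 2 * Apoly p P) by field.
  rewrite /B; apply: ler_wpM2l; first by rewrite !mulr_ge0 ?powR_ge0.
  apply: le_trans H _; rewrite lerD2l; apply: ler_wpM2l; first exact: powR_ge0.
  apply: (@le_trans _ _ (D `^ p / n%:R ^+ 3 * (2 * (8^-1 * n%:R) ^+ 2))).
    by apply: ler_wpM2r; [exact: ltW|exact: powR_cube].
  rewrite -mulrA; apply: ler_piMr; first exact: powR_ge0.
  rewrite mulrC ler_pdivrMr ?(lt_le_trans ltr01)// mul1r.
  have nn : n%:R ^+ 2 <= n%:R ^+ 3 :> R by apply: ler_weXn2l.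
  rewrite exprMn; have : 0 <= n%:R ^+ 2 :> R by rewrite exprn_ge0.
  lra.
have B0 : 0 <= B by apply: le_trans PB; exact: powR_ge0.
have PB' : cn P.[y%:C%C] <= B `^ p^-1.
  have h : (cn P.[y%:C%C] `^ p) `^ p^-1 <= B `^ p^-1.
    by apply: ge0_ler_powR; rewrite ?nnegrE ?powR_ge0 ?invr_ge0 ?(ltW p0).
  by rewrite -powRrM divff ?gt_eqF// powRr1 ?cn_ge0 in h.
have -> : f x%:C%C = P.[y%:C%C] - (P.[y%:C%C] - f x%:C%C) by ring.
apply: le_trans (cnD _ _) _; rewrite cnN; apply: lerD => //.
apply: le_trans (hP x hx) _; rewrite ler_pdivrMr ?(lt_le_trans ltr01)//.
by rewrite ler_peMr.
Qed.

End ApproximationRate.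

(** * Approximation at every frequency below 1 *)

Section LowerBound.
Context {R : realType}.
Local Notation C := R[i].

(** The factor i turns the imaginary part into Re(v - 1/v) = Re v (1 - r^-2). *)
Lemma Im_joukowski (a r : R) (v : C) : 0 <= a -> 1 <= r -> cn v = r ->
  `|complex.Im (a%:C%C * (v - v^-1) * 'i%C)| <= a * (r - r^-1).
Proof.
move=> a0 r1 vr; have r0 : 0 < r by lra.
have x1 := cn_Re v; have := cn_sqr v; rewrite vr in x1 *.
case: v vr x1 => x y vr x1 e.
rewrite /= in x1 e.
have -> : complex.Im (a%:C%C * ((x +i* y)%C - (x +i* y)%C^-1) * 'i%C) = a * (x * (1 - (r ^+ 2)^-1)).
  rewrite /= -e; simpc => /=; ring.
rewrite normrM ger0_norm//; apply: ler_wpM2l => //.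
have h : 0 <= 1 - (r ^+ 2)^-1 by rewrite subr_ge0 invf_le1 ?exprn_gt0 ?exprn_ege1.
rewrite normrM (ger0_norm h) (_ : r - r^-1 = r * (1 - (r ^+ 2)^-1)); last by field; lra.
exact: ler_wpM2r.
Qed.

(** For r = 1 + e, both r - 1/r and 2 ln r are 2 e to first order, so any fixed loss in frequency is
    enough for small ellipses. This is what makes every kappa < 1 admissible. *)
Lemma ln_gt_rational (e : R) : 0 < e < 1 -> (1 - e) * (1 + e - (1 + e)^-1) < 2 * ln (1 + e).
Proof.
move=> /andP[e0 e1]; have r0 : 0 < 1 + e by lra.
have h : 1 - (1 + e)^-1 <= ln (1 + e).
  have := @le_ln1Dx R ((1 + e)^-1 - 1).
  have i0 : 0 < (1 + e)^-1 by rewrite invr_gt0.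
  rewrite (_ : -1 < (1 + e)^-1 - 1); last lra.
  rewrite addrC subrK lnV ?posrE// => /(_ isT); lra.
apply: (@lt_le_trans _ _ (2 * (1 - (1 + e)^-1))); last by rewrite ler_pM2l.
have -> : (1 - e) * (1 + e - (1 + e)^-1) = (e * (1 + e)^-1) * (2 - e - e ^+ 2).
  by field; lra.
have -> : 2 * (1 - (1 + e)^-1) = (e * (1 + e)^-1) * 2 by field; lra.
rewrite ltr_pM2l ?mulr_gt0 ?invr_gt0//; have : 0 <= e ^+ 2 by exact: sqr_ge0.
lra.
Qed.

Lemma core_lower (p I0 l kappa : R) (f : C -> C) : 1 <= p -> entire f ->
  (forall z, f (- z) = f z) ->
  (forall eps : R, 0 < eps -> exists C0 : R, forall z, cn (f z) <= C0 * expR ((1 + eps) * cn z)) ->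
  (forall L, 0 <= L -> RI (fun v : R => cn (f v%:C%C) `^ p * v) 0 L <= I0) ->
  0 < l < 1 -> 0 < kappa < 1 ->
  exists2 D : R, 0 <= D & forall n, (0 < n)%N -> exists P : {poly C},
    [/\ (size P <= n.+1)%N, cn (P.[1] - f 0) <= D / n%:R ^+ 3 &
        (kappa * n%:R) ^+ 2 * Apoly p P <= l `^ (1 - p) * I0 + D / n%:R].
Proof.
move=> p1 ef fe fK hI l01 /andP[k0 k1].
have fA := entire_poly_approximable ef.
have C00 (eps C0 : R) : (forall z, cn (f z) <= C0 * expR ((1 + eps) * cn z)) -> 0 <= C0.
  by move/(_ 0); rewrite cn0 mulr0 expR0 mulr1; apply: le_trans; exact: cn_ge0.
have [K1 hK1] := fK 2^-1 ltac:(by rewrite invr_gt0).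
have [M M0 hM] : exists2 M : R, 0 <= M & forall x : R, 0 <= x -> cn (f x%:C%C) <= M.
  apply: (even_bounded p1 (C00 _ _ hK1) ef fe _ hI) => z.
  by rewrite (_ : 3 / 2 = 1 + 2^-1) //; field.
(* Half of the room between kappa and 1 goes to the growth exponent: (1 + eps) kappa = 1 - eta, and
   [eta] also fixes the radius 1 + eta. *)
pose eps := (kappa^-1 - 1) / 2.
have e0 : 0 < eps by rewrite divr_gt0// subr_gt0 invf_gt1.
have [K2 hK2] := fK eps e0.
have s0 : 0 < 1 + eps by lra.
have PL := phragmen_lindelof_even fA fe s0 M0 hK2 hM.
pose eta := (1 - kappa) / 2.
have eta0 : 0 < eta < 1 by rewrite /eta; lra.
have sk : (1 + eps) * kappa = 1 - eta by rewrite /eps /eta; field; rewrite gt_eqF.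
have r1 : 1 < 1 + eta by lra.
have hG (n : nat) v : cn v = 1 + eta ->
    cn (f ((kappa * n%:R)%:C%C * (v - v^-1) * 'i%C)) <=
    Num.max M K2 * expR ((1 - eta) * (1 + eta - (1 + eta)^-1) * n%:R).
  move=> vr; apply: le_trans (PL _) _.
  apply: ler_wpM2l; first by rewrite le_max M0.
  rewrite ler_expR.
  have kn : 0 <= kappa * n%:R by rewrite mulr_ge0// ltW.
  have h := Im_joukowski kn (ltW r1) vr.
  apply: le_trans (ler_wpM2l (ltW s0) h) _.
  by rewrite le_eqVlt -sk; apply/orP; left; apply/eqP; ring.
have Km : 0 <= Num.max M K2 by rewrite le_max M0.
have [D1 D10 hD] := approx_rate fA fe k0 r1 Km (ln_gt_rational eta0) hG.
pose c := 2 * ((1 - l) `^ (1 - p) * D1 `^ p).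
have c0 : 0 <= c by rewrite !mulr_ge0 ?powR_ge0.
exists (D1 + c) => [|n n0]; first exact: addr_ge0.
have [P Pn hP] := hD n n0.
have n0' : 0 < n%:R :> R by rewrite ltr0n.
have n3 : 0 < n%:R ^+ 3 :> R by rewrite exprn_gt0.
have a0 : 0 < kappa * n%:R by rewrite mulr_gt0.
have aa : 0 <= 2 * (kappa * n%:R) by rewrite mulr_ge0// ltW.
exists P; split => //.
  have := hP 0; rewrite lexx aa => /(_ isT).
  rewrite expr0n /= mul0r subr0 => /le_trans; apply.
  by apply: ler_wpM2r; [rewrite invr_ge0 ltW|rewrite lerDl].
apply: le_trans (Apoly_approx p1 a0 _ l01 (cderiv_cont (entire_cderiv ef)) hP (hI _ aa)) _.
  by rewrite divr_ge0// ltW.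
rewrite lerD2l.
apply: (@le_trans _ _ ((1 - l) `^ (1 - p) * (D1 `^ p / n%:R ^+ 3 * (2 * n%:R ^+ 2)))).
  apply: ler_wpM2l; first exact: powR_ge0.
  apply: ler_pM; first exact: powR_ge0.
  - by rewrite mulr_ge0// sqr_ge0.
  - exact: powR_cube.
  apply: ler_wpM2l => //; rewrite exprMn; apply: ler_piMl; first exact: sqr_ge0.
  by rewrite exprn_ile1 ?ltW.
have -> : (1 - l) `^ (1 - p) * (D1 `^ p / n%:R ^+ 3 * (2 * n%:R ^+ 2)) = c / n%:R.
  by rewrite /c; field; rewrite gt_eqF.
by apply: ler_wpM2r; [rewrite invr_ge0 ltW|rewrite lerDr].
Qed.

End LowerBound.

(** * Limits of rescaled extremal polynomials *)

Section ExponentialFamily.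
Context {R : realType}.
Local Notation C := R[i].

Lemma exp_sum_le (x : R) n : 0 <= x -> \sum_(k < n) x ^+ k / k`!%:R <= expR x.
Proof.
move=> x0; rewrite -(big_mkord xpredT (fun k => x ^+ k / k`!%:R)).
have := @nondecreasing_cvgn_le R (series (exp_coeff x)) _ (is_cvg_series_exp_coeff x) n.
apply; apply/nondecreasing_seqP => m.
by rewrite /series /= big_nat_recr//= lerDl exp_coeff_ge0.
Qed.

(** The truncated differences j - 1 and j - 2 do no harm: for j <= 1 the factor j (j - 1) is
    zero. *)
Lemma monomial_taylor (z h : C) (j : nat) :
  cn ((z + h) ^+ j - z ^+ j - h * (z ^+ j.-1 *+ j)) <=
  cn h ^+ 2 / 2 * (j%:R * j.-1%:R * (cn z + cn h) ^+ (j - 2)).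
Proof.
have zh : cn (z + h) <= cn z + cn h by exact: cnD.
have zr : cn z <= cn z + cn h by rewrite lerDl cn_ge0.
have r0 : 0 <= cn z + cn h by rewrite addr_ge0 ?cn_ge0.
case: j => [|j]; first by rewrite !expr0 subrr mulr0n mulr0 subrr cn0 !mul0r mulr0.
elim: j => [|j IH].
  rewrite !expr1 expr0 mulr1n mulr1 /= mulr0 mul0r mulr0.
  by rewrite (_ : z + h - z - h = 0) ?cn0//; ring.
have -> : (z + h) ^+ j.+2 - z ^+ j.+2 - h * (z ^+ j.+2.-1 *+ j.+2) =
    (z + h) * ((z + h) ^+ j.+1 - z ^+ j.+1 - h * (z ^+ j.+1.-1 *+ j.+1)) +
    h ^+ 2 * (z ^+ j *+ j.+1).
  by rewrite /= -[_ *+ j.+2]mulr_natr -[_ *+ j.+1]mulr_natr !exprS -natr1; ring.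
apply: le_trans (cnD _ _) _; rewrite cnM [X in _ + X]cnM cnX.
have -> : (j.+2 - 2 = j)%N by lia.
move: IH; rewrite subSS; move: (cn (_ - _ - _)) (cn_ge0 ((z + h) ^+ j.+1 - z ^+ j.+1 - h * (z ^+ j.+1.-1 *+ j.+1))) => E E0 IH.
have h2 : cn h ^+ 2 * cn (z ^+ j *+ j.+1) <= cn h ^+ 2 * (j.+1%:R * (cn z + cn h) ^+ j).
  apply: ler_wpM2l; first exact: sqr_ge0.
  rewrite -mulr_natl cnM cn_nat cnX; apply: ler_wpM2l => //.
  by apply: lerXn2r; rewrite ?nnegrE ?cn_ge0.
have h1 : cn (z + h) * E <=
    (cn z + cn h) * (cn h ^+ 2 / 2 * (j.+1%:R * j%:R * (cn z + cn h) ^+ (j - 1))).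
  by apply: ler_pM; rewrite ?cn_ge0.
apply: le_trans (lerD h1 h2) _; rewrite le_eqVlt; apply/orP; left; apply/eqP.
case: j {IH h1 h2} => [|j] /=; first by rewrite !mulr0 !mul0r !mulr0 expr0; field.
by rewrite subn1 /= !exprS -![j.+3%:R]natr1 -![j.+2%:R]natr1; field.
Qed.

(** Coefficients dominated by those of exp. The class is stable under derivation and its bounds do
    not depend on the degree, so they survive limits. *)
Definition expcoef (S : {poly C}) := forall j, cn S`_j <= (j`!%:R)^-1.

Lemma expcoef_bound S z : expcoef S -> cn S.[z] <= expR (cn z).
Proof.
move=> hS; rewrite horner_coef; apply: le_trans (cn_sum _ _ _) _.
apply: le_trans (exp_sum_le (size S) (cn_ge0 z)); apply: ler_sum => j _.
by rewrite cnM cnX mulrC; apply: ler_wpM2l; rewrite ?exprn_ge0 ?cn_ge0.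
Qed.

Lemma expcoef_deriv S : expcoef S -> expcoef S^`().
Proof.
move=> hS j; rewrite coef_deriv -[_ *+ j.+1]mulr_natr cnM cn_nat.
apply: (@le_trans _ _ ((j.+1`!%:R)^-1 * j.+1%:R)); first by apply: ler_wpM2r.
have f0 : 0 < j`!%:R :> R by exact: factR_gt0.
rewrite factS natrM invfM mulrAC mulVf ?mul1r// pnatr_eq0//.
Qed.

(** Since j (j - 1)/j! = 1/(j - 2)!, the remainders of the monomials sum to an exponential series
    shifted by two. *)
Lemma expcoef_taylor S z h : expcoef S ->
  cn (S.[z + h] - S.[z] - h * S^`().[z]) <= cn h ^+ 2 / 2 * expR (cn z + cn h).
Proof.
move=> hS.
have -> : S.[z + h] - S.[z] - h * S^`().[z] =
    \sum_(j < size S) S`_j * ((z + h) ^+ j - z ^+ j - h * (z ^+ j.-1 *+ j)).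
  have -> : S^`().[z] = \sum_(j < size S) S`_j * (z ^+ j.-1 *+ j).
    rewrite -{1}[S]coefK poly_def raddf_sum horner_sum; apply: eq_bigr => j _ /=.
    by rewrite derivZ derivXn hornerZ hornerMn hornerXn.
  rewrite !horner_coef mulr_sumr -!sumrB; apply: eq_bigr => j _; ring.
apply: le_trans (cn_sum _ _ _) _.
have r0 : 0 <= cn z + cn h by rewrite addr_ge0 ?cn_ge0.
have h0 : 0 <= cn h ^+ 2 / 2 by rewrite divr_ge0 ?sqr_ge0.
have [N hN] : exists N, size S = N by exists (size S).
rewrite hN; case: N hN => [|[|N]] hN.
- by rewrite big_ord0 mulr_ge0 ?expR_ge0.
- rewrite big_ord1 /= !expr0 subrr mulr0n mulr0 subrr mulr0 cn0.
  by rewrite mulr_ge0 ?expR_ge0.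
rewrite !big_ord_recl /= !expr0 subrr mulr0n mulr0 subrr mulr0 cn0 add0r.
rewrite -[bump 0 0]/1%N !expr1 mulr1n mulr1 (_ : z + h - z - h = 0); last by ring.
rewrite mulr0 cn0 add0r.
apply: (@le_trans _ _ (\sum_(i < N) cn h ^+ 2 / 2 * ((cn z + cn h) ^+ i / i`!%:R))); last first.
  by rewrite -mulr_sumr; apply: ler_wpM2l => //; exact: exp_sum_le.
apply: ler_sum => i _; rewrite -[bump 0 (bump 0 i)]/(i.+2).
have f0 : 0 < i`!%:R :> R by exact: factR_gt0.
rewrite cnM; apply: (@le_trans _ _ ((i.+2`!%:R)^-1 * (cn h ^+ 2 / 2 *
    (i.+2%:R * i.+1%:R * (cn z + cn h) ^+ i)))).
  apply: ler_pM; rewrite ?cn_ge0//.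
  by have := monomial_taylor z h i.+2; rewrite subSS subSS subn0.
rewrite !factS !natrM le_eqVlt; apply/orP; left; apply/eqP; field.
by rewrite !gt_eqF ?ltr_wpDr ?f0.
Qed.

Lemma expcoef_lip S z h : expcoef S -> cn h <= 1 -> 
  cn (S.[z + h] - S.[z]) <= cn h * (2 * expR (cn z + 1)).
Proof.
move=> hS h1; have -> : S.[z + h] - S.[z] = (S.[z + h] - S.[z] - h * S^`().[z]) + h * S^`().[z] by ring.
apply: le_trans (cnD _ _) _; rewrite cnM.
have e1 := expcoef_taylor z h hS; have e2 := expcoef_bound z (expcoef_deriv hS).
have e3 : expR (cn z + cn h) <= expR (cn z + 1) by rewrite ler_expR lerD2l.
have e4 : expR (cn z) <= expR (cn z + 1) by rewrite ler_expR lerDl.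
have h0 := cn_ge0 h.
have e5 : cn h ^+ 2 / 2 * expR (cn z + cn h) <= cn h * expR (cn z + 1).
  apply: ler_pM; rewrite ?expR_ge0 ?divr_ge0 ?sqr_ge0//.
  by rewrite ler_pdivrMr// expr2; apply: ler_wpM2l => //; lra.
have e6 : cn h * cn S^`().[z] <= cn h * expR (cn z + 1).
  by apply: ler_wpM2l => //; exact: le_trans e2 e4.
have := lerD (le_trans e1 e5) e6; rewrite mulrCA mulr2n [in X in _ -> X]mulrDl !mul1r.
by apply.
Qed.

End ExponentialFamily.

(** * Limits along an ultrafilter *)

Section UltraLimits.
Context {R : realType}.
Local Notation C := R[i].
Context (U : set_system nat) (UU : UltraFilter U).

(** Compactness of the segment gives a cluster point, and an ultrafilter, which decides every set,
    converges to its cluster points. *)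
Lemma ultra_limit_real (u : nat -> R) (M : R) : (forall n, `|u n| <= M) ->
  exists l : R, forall eps : R, 0 < eps -> U [set n | `|u n - l| <= eps].
Proof.
move=> uM; have UP : ProperFilter U := @ultra_proper _ _ UU.
have FP : ProperFilter (u @ U) by exact: fmap_proper_filter.
have [|l [_ cl]] := @segment_compact R (- M) M (u @ U) FP.
  apply: (@filterE _ U _ (u @^-1` `[- M, M]%classic)) => n; by rewrite /= in_itv /= -ler_norml.
exists l => eps e0.
have [//|h] := in_ultra_setVsetC [set n | `|u n - l| <= eps] UU.
have [y [/= y1 y2]] := cl [set y | ~ `|y - l| <= eps] [set y | `|y - l| <= eps] h
  ltac:(by apply/nbhs_ballP; exists eps => // y /=; rewrite /ball/= distrC => /ltW).
by case: (y1 y2).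
Qed.

Definition ulim (u : nat -> C) (l : C) :=
  forall eps : R, 0 < eps -> U [set n | cn (u n - l) <= eps].

Lemma ultra_limit (u : nat -> C) (M : R) : (forall n, cn (u n) <= M) -> exists l, ulim u l.
Proof.
move=> uM; have UP : ProperFilter U := @ultra_proper _ _ UU.
have [a ha] := ultra_limit_real (fun n => le_trans (cn_Re (u n)) (uM n)).
have [b hb] := ultra_limit_real (fun n => le_trans (cn_Im (u n)) (uM n)).
exists (a +i* b)%C => eps e0.
have e2 : 0 < eps / 2 by rewrite divr_gt0.
apply: filterS2 (ha _ e2) (hb _ e2) => n /= h1 h2.
apply: le_trans (cn_le_ReIm _) _.
by move: h1 h2; case: (u n) => x y /= h1 h2; have := lerD h1 h2; rewrite -splitr.
Qed.

Lemma ulim_le (u : nat -> C) l (M : R) : ulim u l -> (forall n, cn (u n) <= M) -> cn l <= M.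
Proof.
move=> ul uM; have UP : ProperFilter U := @ultra_proper _ _ UU.
apply/ler_addgt0Pr => eps e0; have [n /= hn] := filter_ex (ul _ e0).
have -> : l = u n - (u n - l) by ring.
by apply: le_trans (cnD _ _) _; rewrite cnN; apply: lerD.
Qed.

Lemma ulimB u v a b : ulim u a -> ulim v b -> ulim (fun n => u n - v n) (a - b).
Proof.
move=> ua vb eps e0; have UP : ProperFilter U := @ultra_proper _ _ UU.
have e2 : 0 < eps / 2 by rewrite divr_gt0.
apply: filterS2 (ua _ e2) (vb _ e2) => n /= h1 h2.
have -> : u n - v n - (a - b) = (u n - a) - (v n - b) by ring.
by apply: le_trans (cnD _ _) _; rewrite cnN; have := lerD h1 h2; rewrite -splitr.
Qed.

Lemma ulimZ (c : C) u a : ulim u a -> ulim (fun n => c * u n) (c * a).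
Proof.
move=> ua eps e0; have UP : ProperFilter U := @ultra_proper _ _ UU.
have c0 := cn_ge0 c; have c1 : 0 < cn c + 1 by rewrite ltr_wpDl.
apply: filterS (ua (eps / (cn c + 1)) (divr_gt0 e0 c1)) => n /= h.
rewrite -mulrBr cnM; apply: le_trans (ler_wpM2l c0 h) _.
rewrite mulrCA; apply: ler_piMr; first exact: ltW.
by rewrite ler_pdivrMr// mul1r lerDl.
Qed.

Lemma ulim_cst_eq (u : nat -> C) a b : ulim u a -> (forall n, u n = b) -> a = b.
Proof.
move=> ua ub; apply/eqP; rewrite -subr_eq0 -cn_eq0 eq_le cn_ge0 andbT.
apply/ler_addgt0Pr => eps e0; have UP : ProperFilter U := @ultra_proper _ _ UU.
by have [n /= hn] := filter_ex (ua _ e0); rewrite add0r -opprB cnN -(ub n).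
Qed.

Lemma ultra_forall (A : nat -> nat -> Prop) K :
  (forall i, U [set n | A i n]) -> U [set n | forall i, (i < K)%N -> A i n].
Proof.
move=> hA; have UP : ProperFilter U := @ultra_proper _ _ UU.
elim: K => [|K IH]; first by apply: (@filterE _ U) => n /=.
apply: filterS2 IH (hA K) => n /= h1 h2 i; rewrite ltnS leq_eqVlt => /orP[/eqP->//|].
exact: h1.
Qed.

End UltraLimits.

Section UpperBound.
Context {R : realType}.
Local Notation C := R[i].

Lemma ApolyZ (p : R) (c : C) (Q : {poly C}) : 1 <= p -> Apoly p (c *: Q) = cn c `^ p * Apoly p Q.
Proof.
move=> p1; rewrite /Apoly -RIZ; last exact: cont_cn_powR.
by apply: RI_eq => x _; rewrite hornerZ cnM powRM ?cn_ge0.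
Qed.

(** The translate of [P], divided by its value at 1, has maximum modulus 1 there; S(z) = Q(1 -
    z^2/(2 n^2)) is then even with S(0) = 1, and the weighted integral of |S|^p is n^2 times the
    integral of |Q|^p. *)
Lemma rescaled_extremal (p B x : R) n (P : {poly C}) : 1 <= p -> 0 < B -> (0 < n)%N ->
  (size P <= n.+1)%N -> -1 <= x <= 1 ->
  B * (n%:R ^+ 2 * Apoly p P) < cn P.[x%:C%C] `^ p ->
  exists S : {poly C}, [/\ expcoef S, S.[0] = 1, forall z, S.[- z] = S.[z] &
    RI (fun v : R => cn S.[v%:C%C] `^ p * v) 0 (2 * n%:R) <= B^-1].
Proof.
move=> p1 B0 n0 Pn hx hB; have p0 : 0 < p by lra.
have n0' : 0 < n%:R :> R by rewrite ltr0n.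
have [x0 hx0 hmax] := EVT_max (@m1_le1 R) (continuous_subspaceT (@cont_cn_horner R P)).
rewrite in_itv /= in hx0.
set m := cn P.[x0%:C%C] in hmax.
have hM (y : R) : -1 <= y <= 1 -> cn P.[y%:C%C] <= m by move=> hy; apply: hmax; rewrite in_itv.
have A0 : 0 <= Apoly p P by apply: RI_ge0 => t _; exact: powR_ge0.
have m0 : 0 < m.
  rewrite lt_neqAle cn_ge0 andbT; apply/eqP => m0.
  have Px : cn P.[x%:C%C] = 0 by apply/eqP; rewrite eq_le cn_ge0 andbT m0 hM.
  move: hB; rewrite Px powR0 ?gt_eqF// ltNge => /negP; apply.
  by rewrite mulr_ge0 ?(ltW B0)// mulr_ge0// sqr_ge0.
have [Q0 [Qn Q1 QM QA]] := translation p1 Pn hx0.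
have {}QM := QM m hM.
pose c := P.[x0%:C%C]^-1.
have cm : cn c = m^-1 by rewrite cnV.
pose Q := c *: Q0.
have Qn' : (size Q <= n.+1)%N by exact: leq_trans (size_scale_leq _ _) Qn.
have Q11 : Q.[1] = 1 by rewrite hornerZ Q1 mulVf// -cn_eq0 gt_eqF.
have QM1 (y : R) : -1 <= y <= 1 -> cn Q.[y%:C%C] <= 1.
  move=> hy; rewrite hornerZ cnM cm -(mulVf (lt0r_neq0 m0)).
  by apply: ler_wpM2l (QM _ hy); rewrite invr_ge0 ltW.
(* With this scale, [chebbound] n k times w^k is exactly 1/(2k)!, the coefficient bound of
   [expcoef]. *)
pose w : R := (2 * n%:R ^+ 2)^-1.
have w0 : 0 <= w by rewrite invr_ge0 mulr_ge0// sqr_ge0.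
pose q k := (Q \Po ('X + 1))`_k.
pose S : {poly C} := \sum_(k < n.+1) (q k * (- w%:C%C) ^+ k) *: 'X^(2 * k).
have SE (z : C) : S.[z] = Q.[1 + - w%:C%C * z ^+ 2].
  rewrite (horner_shift1 _ Qn') horner_sum; apply: eq_bigr => k _.
  by rewrite hornerZ hornerXn [in RHS]exprMn -exprM mulrA.
exists S; split.
- move=> j; rewrite coef_sum; case: (boolP (odd j)) => [oj|ej].
    rewrite big1 ?cn0 ?invr_ge0// => k _; rewrite coefZ coefXn.
    case: eqP => [jk|_]; last by rewrite mulr0.
    by rewrite jk mul2n odd_double in oj.
  have jE : j = (2 * j./2)%N by rewrite mul2n even_halfK.
  have [jn|jn] := ltnP j./2 n.+1; last first.
    rewrite big1 ?cn0 ?invr_ge0// => k _; rewrite coefZ coefXn.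
    case: eqP => [jk|_]; last by rewrite mulr0.
    by move: (ltn_ord k) jn; rewrite jk mul2n doubleK ltnNge => /negbTE->.
  rewrite (bigD1 (Ordinal jn))//= [X in _ + X]big1 => [|k kj]; last first.
    rewrite coefZ coefXn; case: eqP => [jk|_]; last by rewrite mulr0.
    move: kj; rewrite -val_eqE /= => /eqP []; rewrite jk mul2n doubleK//.
  rewrite addr0 coefZ coefXn -jE eqxx mulr1 cnM cnX cnN cn_real ger0_norm//.
  have := endpoint_markov n0 j./2 Qn' QM1; rewrite mul1r => h.
  apply: le_trans (ler_wpM2r (exprn_ge0 _ w0) h) _.
  rewrite chebbound_pow -jE /w divff ?expr1n ?mul1r//.
  by rewrite mulf_neq0 ?expf_neq0 ?gt_eqF.
- by rewrite SE expr0n /= mulr0 addr0.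
- by move=> z; rewrite !SE sqrrN.
have -> : RI (fun v : R => cn S.[v%:C%C] `^ p * v) 0 (2 * n%:R) = n%:R ^+ 2 * Apoly p Q.
  rewrite (Apoly_subst Q p1 n0') mulrA divff ?mul1r; last by rewrite expf_neq0 ?gt_eqF.
  apply: RI_eq => v _; rewrite SE; congr (cn Q.[_] `^ p * v).
  by rewrite !rmorphB rmorph1 rmorphM !rmorphXn /= /w mulNr mulrC.
rewrite ApolyZ// mulrCA cm.
have h : n%:R ^+ 2 * Apoly p Q0 <= B^-1 * m `^ p.
  apply: (@le_trans _ _ (n%:R ^+ 2 * Apoly p P)).
    by apply: ler_wpM2l => //; exact: sqr_ge0.
  rewrite ler_pdivlMl//; apply: le_trans (ltW hB) _.
  by apply: ge0_ler_powR; rewrite ?nnegrE ?cn_ge0 ?(ltW p0)//; exact: hM.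
apply: le_trans (ler_wpM2l (powR_ge0 _ _) h) _.
by rewrite mulrCA -powRM ?invr_ge0 ?(ltW m0)// mulVf ?gt_eqF// powR1 mulr1.
Qed.

Lemma grid (L d : R) : 0 < L -> 0 < d -> exists (K : nat) (s : R),
  [/\ 0 < s, s <= d & forall v : R, 0 <= v <= L -> exists2 i, (i < K)%N & 0 <= v - i%:R * s <= d /\ i%:R * s <= L].
Proof.
move=> L0 d0; exists (Num.bound (L / d)).+1, d; split => // v /andP[v0 vL].
have vd : 0 <= v / d by rewrite divr_ge0// ltW.
have /andP[t1 t2] := truncn_itv vd.
have t1' : (Num.truncn (v / d))%:R * d <= v by rewrite -ler_pdivlMr.
exists (Num.truncn (v / d)).
  rewrite ltnS -(ler_nat R); apply: le_trans t1 _.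
  apply: le_trans (_ : v / d <= L / d) _; first by apply: ler_wpM2r => //; rewrite invr_ge0 ltW.
  by apply: ltW; have := @archi_boundP R (L / d); apply; rewrite divr_ge0// ltW.
split; last exact: le_trans vL.
rewrite subr_ge0 t1' /= lerBlDl.
by move: t2; rewrite ltr_pdivrMr// -natr1 mulrDl mul1r => /ltW.
Qed.

(** The quadratic Taylor bound passes to the pointwise limits of the polynomials and of their
    derivatives, which makes the limit entire. A common Lipschitz bound upgrades pointwise
    convergence on a finite grid to uniform closeness on [0, L], enough for the integral bound. *)
Lemma core_upper (p B : R) : 1 <= p -> 0 < B ->
  (forall N, exists n (P : {poly C}) (x : R), [/\ (N <= n)%N, (0 < n)%N, (size P <= n.+1)%N,
     -1 <= x <= 1 & B * (n%:R ^+ 2 * Apoly p P) < cn P.[x%:C%C] `^ p]) ->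
  exists F : C -> C, [/\ exp_type_le1 F, F 0 = 1, forall z, F (- z) = F z &
    forall L : R, 0 <= L -> RI (fun v : R => cn (F v%:C%C) `^ p * v) 0 L <= B^-1].
Proof.
move=> p1 B0 hN; have p0 : 0 < p by lra.
have /choice[nS hS] : forall N, exists nS : nat * {poly C}, [/\ (N <= nS.1)%N, expcoef nS.2,
    nS.2.[0] = 1, forall z, nS.2.[- z] = nS.2.[z] &
    RI (fun v : R => cn nS.2.[v%:C%C] `^ p * v) 0 (2 * nS.1%:R) <= B^-1].
  move=> N; have [n [P [x [Nn n0 Pn hx hB]]]] := hN N.
  have [S [S1 S2 S3 S4]] := rescaled_extremal p1 B0 n0 Pn hx hB.
  by exists (n, S).
pose S n := (nS n).2.
have S1 n : expcoef (S n) by case: (hS n).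
(* Pointwise limits along an ultrafilter stand in for Montel's theorem. *)
have [U [UU Uoo]] := @ultraFilterLemma _ (\oo : set_system nat) _.
have UP : ProperFilter U := @ultra_proper _ _ UU.
have /choice[F hF] z := ultra_limit UU (fun n => expcoef_bound z (S1 n)).
have /choice[F' hF'] z := ultra_limit UU (fun n => expcoef_bound z (expcoef_deriv (S1 n))).
have taylor z h : cn (F (z + h) - F z - h * F' z) <= cn h ^+ 2 / 2 * expR (cn z + cn h).
  apply: (ulim_le UU (ulimB UU (ulimB UU (hF (z + h)) (hF z)) (ulimZ UU h (hF' z)))) => n.
  exact: expcoef_taylor.
have Fder z : cderiv F z (F' z).
  move=> eps e0; have E0 := expR_gt0 (cn z + 1).
  exists (Num.min 1 (eps / expR (cn z + 1))) => [|h].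
    by rewrite lt_min ltr01 divr_gt0.
  rewrite lt_min => /andP[h1 h2]; have h0 := cn_ge0 h.
  apply: le_trans (taylor z h) _.
  rewrite ltr_pdivlMr// in h2.
  have e3 : expR (cn z + cn h) <= expR (cn z + 1) by rewrite ler_expR lerD2l ltW.
  apply: le_trans (ler_wpM2l (_ : 0 <= cn h ^+ 2 / 2) e3) _.
    by rewrite divr_ge0 ?sqr_ge0.
  have -> : cn h ^+ 2 / 2 * expR (cn z + 1) = (cn h * expR (cn z + 1)) / 2 * cn h by field.
  by apply: ler_wpM2r => //; have := mulr_ge0 h0 (ltW E0); lra.
have eF : entire F by apply: cderiv_entire => z; exists (F' z).
have Fexp z : cn (F z) <= expR (cn z) by apply: (ulim_le UU (hF z)) => n; exact: expcoef_bound.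
have Flip z h : cn h <= 1 -> cn (F (z + h) - F z) <= cn h * (2 * expR (cn z + 1)).
  by move=> h1; apply: (ulim_le UU (ulimB UU (hF (z + h)) (hF z))) => n; exact: expcoef_lip.
exists F; split.
- split => // eps e0; exists 1 => z; rewrite mul1r; apply: le_trans (Fexp z) _.
  by rewrite ler_expR mulrDl mul1r lerDl mulr_ge0 ?cn_ge0// ltW.
- by apply: (ulim_cst_eq UU (hF 0)) => n; case: (hS n).
- move=> z; apply/eqP; rewrite -subr_eq0; apply/eqP.
  apply: (ulim_cst_eq UU (ulimB UU (hF (- z)) (hF z))) => n.
  by have [_ _ _ -> _] := hS n; rewrite subrr.
have cS n : continuous (fun v : R => cn (S n).[v%:C%C] `^ p * v).
  by move=> v; apply: cvgM; [exact: cont_cn_powR|exact: cvg_id].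
have cF : continuous (fun v : R => cn (F v%:C%C) `^ p * v).
  move=> x; apply: cvgM; last exact: cvg_id.
  apply: (@powR_ge0_cont _ _ (fun v : R => cn (F v%:C%C)) p1) => [|t]; last exact: cn_ge0.
  apply: rcont_cn; apply: ccont_comp; last by apply: rcont_real; exact: cont_id.
  by apply: cderiv_cont => z; exists (F' z).
move=> L; rewrite le_eqVlt => /orP[/eqP<-|L0]; first by rewrite RI_point invr_ge0 ltW.
apply/ler_addgt0Pr => e e0.
(* The integral of eps v over [0, L] is e/2. *)
pose eps := e / L ^+ 2.
have L20 : 0 < L ^+ 2 by rewrite exprn_gt0.
have eps0 : 0 < eps by rewrite divr_gt0.
have [d d0 hd] := real_unif_cont (continuous_powR p1) (expR_gt0 L) eps0.
pose c := 2 * expR (L + 1).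
have c0 : 0 < c by rewrite mulr_gt0// expR_gt0.
pose d4 := d / 4.
have d40 : 0 < d4 by rewrite divr_gt0.
have s0 : 0 < Num.min 1 (d4 / c) by rewrite lt_min ltr01 divr_gt0.
have [K [s [s1 s2 hK]]] := grid L0 s0.
(* One error d/4 at the node and one from each Lipschitz bound add up to less than [d]. *)
have hU : U [set n | forall i, (i < K)%N -> cn ((S n).[(i%:R * s)%:C%C] - F (i%:R * s)%:C%C) <= d4].
  by apply: (ultra_forall UU) => i; exact: hF.
have hU2 : U [set n | (Num.bound L <= n)%N] by apply: Uoo; exact: nbhs_infty_ge.
have [n [/= n1 n2]] := filter_ex (filterI hU hU2).
have [n3 _ _ _ n4] := hS n.
have Ln : L <= 2 * (nS n).1%:R.
  have b : L < (Num.bound L)%:R by apply: archi_boundP; exact: ltW.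
  have b2 : (Num.bound L)%:R <= (nS n).1%:R :> R by rewrite ler_nat (leq_trans n2).
  have b3 : 0 <= (nS n).1%:R :> R by exact: ler0n.
  lra.
have close (v : R) : 0 <= v <= L -> cn ((S n).[v%:C%C] - F v%:C%C) < d.
  move=> hv; have [i iK [/andP[i1 i2] i3]] := hK v hv.
  move: i2; rewrite le_min => /andP[i4 i5].
  have [y yE] : exists y : R, y = i%:R * s by exists (i%:R * s).
  rewrite -yE in i1 i3 i4 i5; have hy := n1 i iK; rewrite -yE in hy.
  have y0 : 0 <= y by rewrite yE mulr_ge0// ltW.
  have vE : v%:C%C = y%:C%C + (v - y)%:C%C by rewrite rmorphB /= addrC subrK.
  have cnh : cn (v - y)%:C%C = v - y by rewrite cn_real ger0_norm.
  have cny : cn y%:C%C = y by rewrite cn_real ger0_norm.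
  have cb : (v - y) * (2 * expR (y + 1)) <= d4.
    apply: (@le_trans _ _ ((d4 / c) * c)); last by rewrite divfK ?gt_eqF.
    apply: ler_pM => //.
    by rewrite /c ler_pM2l// ler_expR lerD2r.
  have l1 := expcoef_lip y%:C%C (S1 n) (_ : cn (v - y)%:C%C <= 1).
  have l2 := Flip y%:C%C (v - y)%:C%C.
  rewrite -vE cnh cny in l1 l2; have {}l1 := le_trans (l1 i4) cb; have {}l2 := le_trans (l2 i4) cb.
  have -> : (S n).[v%:C%C] - F v%:C%C = ((S n).[v%:C%C] - (S n).[y%:C%C]) +
    (((S n).[y%:C%C] - F y%:C%C) - (F v%:C%C - F y%:C%C)) by ring.
  apply: le_lt_trans (cnD _ _) _.
  have l3 := cnD ((S n).[y%:C%C] - F y%:C%C) (- (F v%:C%C - F y%:C%C)).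
  rewrite cnN in l3.
  have := lerD l1 (le_trans l3 (lerD hy l2)); move=> /le_lt_trans; apply.
  rewrite /d4; lra.
apply: (@le_trans _ _ (RI (fun v : R => cn (S n).[v%:C%C] `^ p * v + eps * v) 0 L)).
  apply: RI_le => //.
    by move=> v; apply: cvgD; [exact: cS|apply: cvgMr; exact: cvg_id].
  move=> v hv; have [v0 vL] := andP hv; rewrite -mulrDl; apply: ler_wpM2r => //.
  have Sb : 0 <= cn (S n).[v%:C%C] <= expR L.
    rewrite cn_ge0 /=; apply: le_trans (expcoef_bound _ (S1 n)) _.
    by rewrite ler_expR cn_real ger0_norm.
  have := hd _ (cn (F v%:C%C)) Sb.
  rewrite !(ger0_norm (cn_ge0 _)) => h.
  have : `|cn (F v%:C%C) - cn (S n).[v%:C%C]| < d.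
    apply: le_lt_trans (close v hv); rewrite -[X in _ <= X]cnN opprB; exact: cn_dist.
  by move/h; rewrite ler_norml => /andP[_]; rewrite lerBlDl.
rewrite RID; last 2 first.
- exact: cS.
- by move=> v; apply: cvgMr; exact: cvg_id.
rewrite RIZ; last exact: cont_id.
rewrite int_id ?(ltW L0)//; apply: lerD.
  apply: le_trans n4; rewrite (RI_split (cS n) (ltW L0) Ln) lerDl.
  apply: RI_ge0 => v /andP[v1 _]; rewrite mulr_ge0 ?powR_ge0//.
  exact: le_trans (ltW L0) v1.
by rewrite /eps mulrA divfK ?gt_eqF//; lra.
Qed.

End UpperBound.

(** * A nonzero function of finite weighted norm *)

Section Nontriviality.
Context {R : realType}.
Local Notation C := R[i].

(** The unnormalized Fejer kernel as an algebraic polynomial in cos t. *)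
Definition fejer_cheb m : {poly C} := \sum_(k < m) \sum_(l < m) cheb `|k - l|%N.

Lemma size_fejer_cheb m : (size (fejer_cheb m) <= m)%N.
Proof.
apply: leq_trans (size_sum _ _ _) _; apply/bigmax_leqP => k _.
apply: leq_trans (size_sum _ _ _) _; apply/bigmax_leqP => l _.
apply: leq_trans (size_cheb _) _.
by have := ltn_ord k; have := ltn_ord l; lia.
Qed.

Lemma fejer_cheb_cos m (t : R) :
  (fejer_cheb m).[(cos t)%:C%C] = (cn (dirichlet m (- t)) ^+ 2)%:C%C.
Proof.
have -> : (fejer_cheb m).[(cos t)%:C%C] = (\sum_(k < m) \sum_(l < m) cos (t *+ `|k - l|%N))%:C%C.
  rewrite horner_sum rmorph_sum; apply: eq_bigr => k _.
  by rewrite horner_sum rmorph_sum; apply: eq_bigr => l _; exact: cheb_cos.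
have /(congr1 (@complex.Re R)) h := dirichlet_sqr m (- t).
rewrite [LHS]/= in h; rewrite h; apply: (congr1 (real_complex R)); rewrite [RHS]raddf_sum; apply: eq_bigr => k _.
rewrite [RHS]raddf_sum; apply: eq_bigr => l _.
rewrite /ecirc /cexp /= expR0 mul1r.
case: (leqP l k) => lk.
  rewrite mulrN cosN -[t *+ _]mulr_natl; congr (cos (_ * t)).
  by rewrite distnEl// natrB// rmorphB.
rewrite mulrN -mulNr -[t *+ _]mulr_natl; congr (cos (_ * t)).
by rewrite distnEr 1?ltnW// natrB 1?ltnW// rmorphB /= opprB.
Qed.

Lemma dirichlet_bounds m (t : R) : 0 <= sin t ->
  cn (dirichlet m t) <= m%:R /\ sin t * cn (dirichlet m t) <= 2.
Proof.
move=> s0; have D0 := cn_ge0 (dirichlet m t); split.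
  apply: le_trans (cn_sum _ _ _) _; rewrite -[leRHS]mulr1 -[m in leRHS]card_ord mulr_natl -sumr_const.
  by apply: ler_sum => k _; rewrite cnX cn_ecirc expr1n.
have h := ecirc_chord m t.
apply: (@le_trans _ _ (cn (ecirc t - 1) * cn (dirichlet m t))).
  apply: ler_wpM2r => //; apply: le_trans (cn_Im _).
  by rewrite /ecirc /cexp /= expR0 mul1r oppr0 addr0 ler_norm.
rewrite -(@ler_pXn2r _ 2) ?nnegrE ?mulr_ge0 ?cn_ge0//.
by rewrite exprMn; apply: le_trans h _; rewrite (_ : 4 = 2 ^+ 2 :> R)//; ring.
Qed.

(** With D the Dirichlet modulus, D^(4p) sin t <= m^(4(p-1)) (D sin t) D D^2 <= m^(4(p-1)) 2 m D^2,
    and D^2 has mass 2 pi m. Composition with -X puts the peak at -1, so that the substitution - cos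
    t is increasing. *)
Lemma Apoly_fejer (p : R) m : 1 <= p ->
  Apoly p ((fejer_cheb m \Po - 'X) ^+ 2) <= (m%:R ^+ 4) `^ (p - 1) * (4 * pi * m%:R ^+ 2).
Proof.
move=> p1; set P := _ ^+ 2; have p0 : 0 < p by lra.
have cc : continuous (fun t : R => - cos t) by move=> x; apply: cvgN; exact: continuous_cos.
have dc (t : R) : 0 <= t <= pi -> is_derive t 1 (fun t : R => - cos t) (sin t).
  by move=> _; apply: is_derive_eq; rewrite opprK.
have [+ _] := RI_subst (pi_ge0 R) (@cont_cn_powR _ _ P p1) cc (@continuous_sin R) dc.
rewrite cos0 cospi opprK => /(_ (@m1_le1 R)); rewrite -[RI _ (-1) 1]/(Apoly p P) => <-.
pose D (t : R) := cn (dirichlet m (0 - t)).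
have cD : continuous (fun t => D t ^+ 2) by exact: cont_dirichlet2.
have PE (t : R) : cn P.[(- cos t)%:C%C] = D t ^+ 4.
  rewrite /P horner_exp horner_comp !hornerE rmorphN opprK fejer_cheb_cos cnX cn_real.
  by rewrite ger0_norm ?sqr_ge0// -exprM /D sub0r.
set c := (m%:R ^+ 4) `^ (p - 1).
have c0 : 0 <= c by exact: powR_ge0.
apply: (@le_trans _ _ (RI (fun t => c * (2 * m%:R) * D t ^+ 2) 0 pi)).
  apply: RI_le.
  - move=> x; apply: cvgM; last exact: continuous_sin.
    apply: (@continuous_comp _ _ _ (fun t : R => - cos t) (fun t => cn P.[t%:C%C] `^ p)).
      by apply: cvgN; exact: continuous_cos.
    exact: cont_cn_powR.
  - by move=> x; apply: cvgMr; exact: cD.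
  move=> t ht; rewrite PE.
  have s0 : 0 <= sin t by exact: sin_ge0_pi.
  have [b1 b2] := dirichlet_bounds m s0.
  have DE : D t = cn (dirichlet m t).
    rewrite /D sub0r -[LHS]ger0_norm ?cn_ge0// -[RHS]ger0_norm ?cn_ge0//.
    have e : D t ^+ 2 = cn (dirichlet m t) ^+ 2.
      apply: (@complexI R); rewrite -[t in RHS]opprK /D sub0r -!fejer_cheb_cos cosN//.
    by rewrite -!sqrtr_sqr; rewrite /D sub0r in e; rewrite e.
  rewrite DE; move: b1 b2; set d := cn (dirichlet m t) => b1 b2.
  have d0 : 0 <= d by exact: cn_ge0.
  have h1 : (d ^+ 4) `^ p <= c * d ^+ 4.
    have -> : (d ^+ 4) `^ p = (d ^+ 4) `^ (p - 1) * d ^+ 4.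
      rewrite -{3}[d ^+ 4]powRr1 ?exprn_ge0// -powRD ?subrK//.
      by apply/implyP => /eqP; lra.
    apply: ler_wpM2r; first exact: exprn_ge0.
    apply: ge0_ler_powR; rewrite ?nnegrE ?exprn_ge0 ?subr_ge0//.
    by apply: lerXn2r; rewrite ?nnegrE.
  apply: le_trans (ler_wpM2r s0 h1) _.
  have -> : c * d ^+ 4 * sin t = c * ((sin t * d) * d * d ^+ 2) by ring.
  rewrite -[leRHS]mulrA; apply: ler_wpM2l => //.
  apply: ler_wpM2r; first exact: sqr_ge0.
  by apply: ler_pM => //; exact: mulr_ge0.
have pp : 0 <= pi :> R by exact: pi_ge0.
have pp2 : pi <= pi *+ 2 :> R by rewrite mulr2n lerDl.
have cD' : continuous (fun t => c * (2 * m%:R) * D t ^+ 2) by move=> x; apply: cvgMr; exact: cD.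
apply: (@le_trans _ _ (RI (fun t => c * (2 * m%:R) * D t ^+ 2) 0 (pi *+ 2))).
  rewrite (RI_split cD' pp pp2) lerDl; apply: RI_ge0 => t _.
  by apply: mulr_ge0; [apply: mulr_ge0 => //; exact: mulr_ge0|exact: sqr_ge0].
rewrite RIZ// RI_dirichlet le_eqVlt; apply/orP; left; apply/eqP.
by rewrite -[pi *+ 2]mulr_natl; ring.
Qed.

(** Squared Fejer kernels concentrate on the scale 1/n^2 at an endpoint and satisfy the hypothesis
    of [core_upper], which converts them into a function with value 1 at 0. *)
Lemma nontrivial_extremal (p : R) : 1 <= p -> exists (F : C -> C) (I0 : R),
  [/\ exp_type_le1 F, F 0 = 1, forall z, F (- z) = F z &
    forall L : R, 0 <= L -> RI (fun v : R => cn (F v%:C%C) `^ p * v) 0 L <= I0].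
Proof.
(* With degree bound 2 m, (2m)^2 times 4 pi m^2 is 16 pi m^4; this [B] leaves half of the peak value
   m^4. *)
move=> p1; pose B : R := (32 * pi)^-1.
have pi0 := pi_gt0 R.
have B0 : 0 < B by rewrite invr_gt0 mulr_gt0.
suff /(core_upper p1 B0)[F hF] : forall N, exists n (P : {poly C}) (x : R),
    [/\ (N <= n)%N, (0 < n)%N, (size P <= n.+1)%N,
     -1 <= x <= 1 & B * (n%:R ^+ 2 * Apoly p P) < cn P.[x%:C%C] `^ p].
  by exists F, B^-1.
move=> N; have [m [mN m0]] : exists m, (N <= m)%N /\ (0 < m)%N by exists N.+1.
have m0' : 0 < m%:R :> R by rewrite ltr0n.
exists (2 * m)%N, ((fejer_cheb m \Po - 'X) ^+ 2), (-1); split.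
- by rewrite mul2n -addnn (leq_trans mN)// leq_addr.
- by rewrite muln_gt0.
- apply: leq_trans (size_poly_exp_leq _ _) _.
  have : (size (fejer_cheb m \Po - 'X) <= m)%N.
    by rewrite size_comp_poly2 ?size_fejer_cheb// size_polyN size_polyX.
  by move: (size _) => s; lia.
- lra.
have -> : cn ((fejer_cheb m \Po - 'X) ^+ 2).[(-1)%:C%C] = m%:R ^+ 4.
  have e : - (-1)%:C%C = (cos (0 : R))%:C%C by rewrite -rmorphN opprK cos0.
  rewrite horner_exp horner_comp hornerN hornerX e fejer_cheb_cos.
  rewrite cnX cn_real ger0_norm ?sqr_ge0// -exprM oppr0 /dirichlet ecirc0.
  under eq_bigr do rewrite expr1n.
  by rewrite sumr_const card_ord cn_nat.
have A := Apoly_fejer m p1.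
have m4 : 0 < m%:R ^+ 4 :> R by exact: exprn_gt0.
have -> : (m%:R ^+ 4) `^ p = (m%:R ^+ 4) `^ (p - 1) * m%:R ^+ 4 :> R.
  rewrite -{3}[m%:R ^+ 4]powRr1 ?ltW// -powRD ?subrK//.
  by apply/implyP => /eqP; lra.
have c0 : 0 < (m%:R ^+ 4) `^ (p - 1) :> R by exact: powR_gt0.
apply: (@le_lt_trans _ _ (B * ((2 * m)%:R ^+ 2 *
    ((m%:R ^+ 4) `^ (p - 1) * (4 * pi * m%:R ^+ 2))))).
  by rewrite ler_pM2l//; apply: ler_wpM2l => //; exact: sqr_ge0.
have -> : B * ((2 * m)%:R ^+ 2 * ((m%:R ^+ 4) `^ (p - 1) * (4 * pi * m%:R ^+ 2))) =
   2^-1 * ((m%:R ^+ 4) `^ (p - 1) * m%:R ^+ 4).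
  by rewrite /B natrM; move: pi pi0 => q q0; field; rewrite gt_eqF.
rewrite gtr_pMl ?mulr_gt0//; lra.
Qed.

End Nontriviality.

(** * The sharp constants *)

Section Norms.
Context {R : realType}.
Local Notation C := R[i].
Local Notation mu := (@lebesgue_measure R).

Definition poly_on (q : {poly C}) : R -> C :=
  patch (cst 0) `[-1, 1] (fun t => q.[t%:C%C]).

Lemma poly_onE q (x : R) : -1 <= x <= 1 -> poly_on q x = q.[x%:C%C].
Proof. by move=> hx; rewrite /poly_on patchT// inE /= in_itv. Qed.

Lemma poly_on0 q (x : R) : ~ (-1 <= x <= 1) -> poly_on q x = 0.
Proof. by move=> hx; rewrite /poly_on patchN// notin_setE /= in_itv. Qed.

Lemma Lnorm_poly_on (p : R) (q : {poly C}) : 1 <= p ->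
  Lnorm_on (measurable_itv `[-1, 1]%R) p%:E (poly_on q) = (Apoly p q `^ p^-1)%:E.
Proof.
move=> p1; have p0 : 0 < p by lra.
rewrite /Lnorm_on unlock -poweR_EFin; congr (_ `^ _)%E.
pose g := fun x : R => (cn q.[x%:C%C] `^ p)%:E.
rewrite (_ : (fun x : R => _) = g \_ `[-1, 1]); last first.
  apply/funext => x; rewrite /cabs abse_EFin poweR_EFin ger0_norm ?cn_ge0//.
  case: (pselect (-1 <= x <= 1)) => hx.
    by rewrite poly_onE// patchT// inE /= in_itv.
  by rewrite poly_on0 ?cn0 ?powR0 ?gt_eqF// patchN// notin_setE /= in_itv.
rewrite -integral_mkcond (eq_measure_integral mu); last first.
  by move=> A mA AI; rewrite /= /mrestr (setIidl AI).
by rewrite RI_EFin//; exact: cont_cn_powR.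
Qed.

Lemma sup_norm_le (q : {poly C}) (M : R) : 0 <= M ->
  (forall x : R, -1 <= x <= 1 -> cn q.[x%:C%C] <= M) ->
  (Lnorm_on (measurable_itv `[-1, 1]%R) +oo (poly_on q) <= M%:E)%E.
Proof.
move=> M0 hM; rewrite /Lnorm_on unlock; case: ifPn => // _.
apply/ess_supP/aeW => x /=; rewrite lee_fin ger0_norm ?cn_ge0//.
case: (pselect (-1 <= x <= 1)) => hx; first by rewrite poly_onE// hM.
by rewrite poly_on0// cn0.
Qed.

(** An essential bound y < |q(1)| would, by continuity, make a whole interval [1 - e, 1]
    negligible. *)
Lemma sup_norm_ge (q : {poly C}) :
  ((cn q.[1])%:E <= Lnorm_on (measurable_itv `[-1, 1]%R) +oo (poly_on q))%E.
Proof.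
rewrite leNgt; apply/negP => h.
have L0 : (0 <= Lnorm_on (measurable_itv `[-1, 1]%R) +oo (poly_on q))%E by exact: Lnorm_ge0.
move: h L0; case E : (Lnorm_on _ _ _) => [y| |]//; rewrite lte_fin lee_fin => h y0.
have : (Lnorm_on (measurable_itv `[-1, 1]%R) +oo (poly_on q) <= y%:E)%E by rewrite E.
rewrite /Lnorm_on unlock /= {1}/mrestr setTI lebesgue_measure_itv /= lte_fin.
rewrite (_ : -1 < 1); last by lra.
rewrite -EFinD lte_fin (_ : 0 < 1 - -1); last by lra.
move=> /ess_supP [A [mA A0 hA]].
have d0 : 0 < (cn q.[1] - y) / 2 by rewrite divr_gt0// subr_gt0.
have [d dp hd] := eps_continuous (@cont_cn_horner R q) 1 d0.
pose e := Num.min 1 (d / 2).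
have e0 : 0 < e by rewrite lt_min ltr01 divr_gt0.
have e1 : e <= 1 by rewrite ge_min lexx.
have ed : e < d by rewrite gt_min ltr_pdivrMr// ltr_pMr// ltr1n orbT.
have sub : `[1 - e, 1]%classic `<=` A `&` `[-1, 1].
  move=> x /=; rewrite in_itv /= => /andP[x1 x2].
  have hx : -1 <= x <= 1 by apply/andP; split => //; lra.
  split; last by rewrite in_itv.
  apply: hA => /=; rewrite /cabs lee_fin ger0_norm ?cn_ge0// poly_onE// => hy.
  have := hd (x - 1); rewrite (_ : 1 + (x - 1) = x); last by ring.
  rewrite [`|x - 1|]distrC ger0_norm ?subr_ge0//.
  have -> : 1 - x < d by lra.
  move=> /(_ isT); rewrite ler_norml -[1%:C%C]/((1 : R)%:C%C) => /andP[h1 _].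
  move: h1 hy; rewrite (_ : (1 : R)%:C%C = 1)//; lra.
have : (mu `[(1 - e)%R, 1%R]%classic <= 0)%E.
  rewrite -A0 /mrestr /=; apply: le_measure => //; rewrite inE.
    exact: measurable_itv.
  by apply: measurableI => //; exact: measurable_itv.
rewrite lebesgue_measure_itv /= lte_fin ltrBlDr ltrDl e0 -EFinD lee_fin; lra.
Qed.

Lemma weight_continuous (F : C -> C) (p : R) : 1 <= p -> ccont F ->
  continuous (fun t : R => cn (F t%:C%C) `^ p * `|t|).
Proof.
move=> p1 cF x; apply: cvgM; last exact: norm_continuous.
apply: (@powR_ge0_cont _ _ (fun v : R => cn (F v%:C%C)) p1) => [|t]; last exact: cn_ge0.
by apply: rcont_cn; apply: ccont_comp => //; apply: rcont_real; exact: cont_id.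
Qed.

Lemma weight_RI_le (F : C -> C) (p a b : R) : 1 <= p -> ccont F ->
  ((RI (fun t : R => cn (F t%:C%C) `^ p * `|t|) a b)%:E <=
   \int[mu]_t (cn (F t%:C%C) `^ p * `|t|)%:E)%E.
Proof.
move=> p1 cF; have cw := weight_continuous p1 cF.
rewrite -RI_EFin//; apply: ge0_subset_integral => //.
  by apply/measurable_EFinP; exact: continuous_measurable_fun.
by move=> t _; rewrite lee_fin mulr_ge0// powR_ge0.
Qed.

Lemma weight_even_le (F : C -> C) (p I0 : R) : 1 <= p -> ccont F ->
  (forall z, F (- z) = F z) ->
  (forall L : R, 0 <= L -> RI (fun v : R => cn (F v%:C%C) `^ p * v) 0 L <= I0) ->
  (\int[mu]_t (cn (F t%:C%C) `^ p * `|t|)%:E <= (2 * I0)%:E)%E.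
Proof.
move=> p1 cF Fe hI; have cw := weight_continuous p1 cF.
have w0 (t : R) : 0 <= cn (F t%:C%C) `^ p * `|t| by rewrite mulr_ge0// powR_ge0.
rewrite (ge0_symfun_integralT w0 cw); last first.
  by move=> t /=; rewrite normrN rmorphN Fe.
rewrite EFinM; apply: lee_wpmul2l => //.
rewrite (_ : [set x : R | 0 <= x] = `[0, +oo[%classic); last first.
  by apply/seteqP; split => x /=; rewrite in_itv /= andbT.
rewrite ge0_integral_ereal_sup//; last exact: continuous_measurable_fun.
apply: ge_ereal_sup => _ [n _ <-]; rewrite RI_EFin// lee_fin.
rewrite (RI_eq (_ : forall x, 0 <= x <= n.+1%:R -> _ = cn (F x%:C%C) `^ p * x)); last first.
  by move=> x /andP[x0 _]; rewrite ger0_norm.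
exact: hI.
Qed.

Definition even_part (g : C -> C) (z : C) : C := 2^-1 * (g z + g (- z)).

Lemma entire_even_part g : entire g -> entire (even_part g).
Proof.
move=> eg; have en := entireM (@entire_cst R (-1)) (@entire_id R).
have eN := entire_comp eg en.
have := entireM (@entire_cst R 2^-1) (entireD eg eN); congr entire.
by apply/funext => z; rewrite /even_part mulN1r.
Qed.

Lemma cn_half_sum (p : R) (a b : C) : 1 <= p ->
  cn (2^-1 * (a + b)) `^ p <= 2^-1 * (cn a `^ p + cn b `^ p).
Proof.
move=> p1; have p0 : 0 < p by lra.
have h2 : 0 < 2^-1 :> R by rewrite invr_gt0.
have l01 : 0 < (2^-1 : R) < 1 by lra.
have ha : 0 <= 2^-1 * cn a by rewrite mulr_ge0 ?cn_ge0 ?ltW.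
have hb : 0 <= 2^-1 * cn b by rewrite mulr_ge0 ?cn_ge0 ?ltW.
have h : cn (2^-1 * (a + b)) <= 2^-1 * cn a + 2^-1 * cn b.
  rewrite -mulrDr cnM cnV cn_nat; apply: ler_wpM2l; [exact: ltW|exact: cnD].
apply: (@le_trans _ _ ((2^-1 * cn a + 2^-1 * cn b) `^ p)).
  by apply: ge0_ler_powR; rewrite ?nnegrE ?cn_ge0 ?addr_ge0// ltW.
apply: le_trans (powR_split p1 ha hb l01) _.
rewrite (_ : 1 - 2^-1 = 2^-1 :> R); last by field.
have e : (2^-1 : R) `^ (1 - p) * 2^-1 `^ p = 2^-1.
  by rewrite -powRD ?subrK ?powRr1 ?ltW // gt_eqF ?implybT.
rewrite (powRM _ (ltW h2) (cn_ge0 a)) (powRM _ (ltW h2) (cn_ge0 b)) [X in X + _]mulrA [X in _ + X]mulrA e.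
by rewrite -mulrDr.
Qed.

(** Convexity applied to the values at v and - v folds the two half-line integrals into one with
    weights 1/2. *)
Lemma even_part_weight (g : C -> C) (p I0 : R) : 1 <= p -> entire g ->
  (\int[mu]_t (cn (g t%:C%C) `^ p * `|t|)%:E <= I0%:E)%E ->
  forall L : R, 0 <= L ->
    RI (fun v : R => cn (even_part g v%:C%C) `^ p * v) 0 L <= I0 / 2.
Proof.
move=> p1 eg hI L L0; have p0 : 0 < p by lra.
have cg := cderiv_cont (entire_cderiv eg).
have cw := weight_continuous p1 cg.
have NL : - L <= 0 by rewrite oppr_le0.
have h : RI (fun t : R => cn (g t%:C%C) `^ p * `|t|) (- L) L <= I0.
  by rewrite -lee_fin; apply: le_trans hI; exact: weight_RI_le.
have cN : continuous (fun t : R => - t) by move=> x; apply: cvgN; exact: cvg_id.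
have cwN : continuous (fun t : R => cn (g (- t)%:C%C) `^ p * `|- t|).
  move=> t; exact: (@continuous_comp _ _ _ (fun t : R => - t)
    (fun t : R => cn (g t%:C%C) `^ p * `|t|) t (cN t) (cw (- t))).
have refl : RI (fun t : R => cn (g (- t)%:C%C) `^ p * `|- t|) 0 L =
    RI (fun t : R => cn (g t%:C%C) `^ p * `|t|) (- L) 0.
  have dN (x : R) : 0 <= x <= L -> is_derive x 1 (fun t : R => - t) (-1).
    by move=> _; apply: is_derive_eq.
  have [_] := RI_subst L0 cw cN (@cst_continuous _ _ (-1 : R)) dN.
  rewrite oppr0 => /(_ NL) /(congr1 -%R); rewrite opprK => <-.
  rewrite -[RHS]mulN1r -RIZ; last by move=> t; apply: cvgMl; exact: cwN.
  by apply: RI_eq => t _; rewrite mulrN1 mulN1r opprK.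
rewrite (RI_split cw NL L0) -refl in h.
have -> : I0 / 2 = 2^-1 * I0 by rewrite mulrC.
apply: le_trans (ler_wpM2l _ h); last by rewrite invr_ge0.
have cs : continuous (fun t : R => cn (g (- t)%:C%C) `^ p * `|- t| + cn (g t%:C%C) `^ p * `|t|).
  by move=> t; apply: cvgD; [exact: cwN|exact: cw].
rewrite -RID// -RIZ//.
have ce := cderiv_cont (entire_cderiv (entire_even_part eg)).
rewrite (RI_eq (_ : forall x, 0 <= x <= L -> _ = cn (even_part g x%:C%C) `^ p * `|x|)); last first.
  by move=> x /andP[x0 _]; rewrite ger0_norm.
apply: RI_le; first exact: weight_continuous.
  by move=> t; apply: cvgMr; exact: cs.
move=> v _; rewrite normrN -mulrDl mulrA; apply: ler_wpM2r => //.
by rewrite rmorphN addrC; exact: cn_half_sum.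
Qed.

End Norms.

(** * From suprema to competitors and back *)

Section SharpConstants.
Context {R : realType}.
Local Notation C := R[i].
Local Notation mu := (@lebesgue_measure R).

Lemma powR_root (p c A : R) : 1 <= p -> 0 <= c -> 0 <= A ->
  (c `^ p * A) `^ p^-1 = c * A `^ p^-1.
Proof.
move=> p1 c0 A0; have p0 : 0 < p by lra.
by rewrite powRM ?powR_ge0// -powRrM divff ?gt_eqF// powRr1.
Qed.

Lemma powR_rootK (p a : R) : 1 <= p -> 0 <= a -> (a `^ p) `^ p^-1 = a.
Proof. by move=> p1 a0; have := powR_root p1 a0 ler01; rewrite mulr1 powR1 mulr1. Qed.

Lemma root_le (p c A a : R) : 1 <= p -> 0 <= c -> 0 <= A -> 0 <= a ->
  c `^ p * A <= a `^ p -> c * A `^ p^-1 <= a.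
Proof.
move=> p1 c0 A0 a0 h; rewrite -powR_root// -[leRHS](powR_rootK p1)//.
by apply: ge0_ler_powR; rewrite ?nnegrE ?mulr_ge0 ?powR_ge0 ?invr_ge0//; lra.
Qed.

Lemma root_ge (p c A a : R) : 1 <= p -> 0 <= c -> 0 <= A -> 0 <= a ->
  a `^ p <= c `^ p * A -> a <= c * A `^ p^-1.
Proof.
move=> p1 c0 A0 a0 h; rewrite -powR_root// -[leLHS](powR_rootK p1)//.
by apply: ge0_ler_powR; rewrite ?nnegrE ?mulr_ge0 ?powR_ge0 ?invr_ge0//; lra.
Qed.

(* Division in [\bar R] has [0 / 0 = 0 * +oo = 0] and [a / 0 = +oo] for [a > 0]. *)
Lemma le_ratio (a c N : R) (x : \bar R) : 0 < a -> (a%:E <= x)%E -> 0 <= N -> c * N <= a ->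
  (c%:E <= x / N%:E)%E.
Proof.
move=> a0 ax; rewrite le_eqVlt => /orP[/eqP<-|N0] h.
  by rewrite inve0 gt0_muley ?leey// (lt_le_trans _ ax)// lte_fin.
rewrite inver gt_eqF// lee_pdivlMr// -EFinM.
by apply: le_trans ax; rewrite lee_fin.
Qed.

Lemma ratio_le (c N : R) (x : \bar R) : 0 <= c -> (0 <= x)%E -> 0 <= N -> (x <= (c * N)%:E)%E ->
  (x / N%:E <= c%:E)%E.
Proof.
move=> c0 x0; rewrite le_eqVlt => /orP[/eqP<-|N0] h.
  rewrite mulr0 in h; have -> : x = 0%E by apply/eqP; rewrite eq_le h x0.
  by rewrite mul0e lee_fin.
by rewrite inver gt_eqF// lee_pdivrMr// -EFinM.
Qed.

Lemma Apoly_ge0 (p : R) (q : {poly C}) : 0 <= Apoly p q.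
Proof. by apply: RI_ge0 => t _; exact: powR_ge0. Qed.

(** If the inequality failed at every point of the segment for some competitor, [c] would bound its
    ratio. *)
Lemma lt_sharp_constant (p c : R) n : 1 <= p -> 0 <= c ->
  (c%:E < sharp_constant (measurable_itv `[-1, 1]%R) (@polys_on_itvN11 R n)
        (Lnorm_on (measurable_itv `[-1, 1]%R) p%:E) idfun)%E ->
  exists (q : {poly C}) (x : R), [/\ (size q <= n.+1)%N, -1 <= x <= 1 &
    c `^ p * Apoly p q < cn q.[x%:C%C] `^ p].
Proof.
move=> p1 c0 /ereal_sup_gt[_ [f [[q /= qn <-] _] <-]] h.
exists q; apply: contrapT => hq; move: h; rewrite ltNge => /negP; apply.
rewrite -/(poly_on q) Lnorm_poly_on//; apply: ratio_le => //.
- exact: Lnorm_ge0.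
- exact: powR_ge0.
have A0 := Apoly_ge0 p q.
apply: sup_norm_le; first by rewrite mulr_ge0 ?powR_ge0.
move=> x hx; apply: root_ge; rewrite ?cn_ge0// leNgt; apply/negP => h.
by apply: hq; exists x.
Qed.

Lemma sharp_constant_ge (p c : R) n (q : {poly C}) : 1 <= p -> 0 <= c -> (size q <= n.+1)%N ->
  q.[1] != 0 -> c `^ p * Apoly p q <= cn q.[1] `^ p ->
  (c%:E <= sharp_constant (measurable_itv `[-1, 1]%R) (@polys_on_itvN11 R n)
        (Lnorm_on (measurable_itv `[-1, 1]%R) p%:E) idfun)%E.
Proof.
move=> p1 c0 qn q1 h; have A0 := Apoly_ge0 p q.
apply: le_trans (ereal_sup_ubound _); last first.
  exists (poly_on q) => //; split; first by exists q.
  move=> /(congr1 (@^~ 1)) /=; rewrite poly_onE ?lexx ?m1_le1//.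
  by rewrite (_ : (1 : R)%:C%C = 1)//; exact/eqP.
rewrite Lnorm_poly_on//; apply: (le_ratio _ (sup_norm_ge q)).
- by rewrite cn_gt0.
- exact: powR_ge0.
- by apply: root_le; rewrite ?cn_ge0.
Qed.

Lemma weight_norm_fin (p : R) (f : R -> C) (I0 : R) :
  (\int[mu]_t (cn (f t) `^ p * `|t|)%:E <= I0%:E)%E ->
  exists2 w : R, 0 <= w <= I0 &
    (\int[mu]_t (cn (f t) `^ p * `|t|)%:E)%E = w%:E.
Proof.
have : (0 <= \int[mu]_t (cn (f t) `^ p * `|t|)%:E)%E.
  by apply: integral_ge0 => t _; rewrite lee_fin mulr_ge0 ?powR_ge0.
case: (\int[mu]_t _)%E => [w| |]//; rewrite !lee_fin => w0 w1.
by exists w => //; rewrite w0.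
Qed.

Lemma sharp_constant_at_ge (p c I0 : R) (F : C -> C) : 1 <= p -> 0 <= c ->
  exp_type_le1 F -> F 0 = 1 -> (forall z, F (- z) = F z) ->
  (forall L : R, 0 <= L -> RI (fun v : R => cn (F v%:C%C) `^ p * v) 0 L <= I0) ->
  c `^ p * (2 * I0) <= 1 ->
  (c%:E <= sharp_constant_at (E11 `&` L_abs_weight p) (Lnorm_abs_weight p) idfun (0 : R))%E.
Proof.
move=> p1 c0 hF F0 Fe hI h.
have cF := cderiv_cont (entire_cderiv hF.1).
have [w /andP[w0 w1] wE] := weight_norm_fin (weight_even_le p1 cF Fe hI).
pose f (t : R) := F t%:C%C.
have fE : Lnorm_abs_weight p f = (w `^ p^-1)%:E.
  by rewrite /Lnorm_abs_weight wE poweR_EFin.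
apply: le_trans (ereal_sup_ubound _); last first.
  exists f => //; split; first split.
  - by exists F.
  - by rewrite /L_abs_weight /= fE ltry.
  by move=> /(congr1 (@^~ 0)) /eqP; rewrite /f /= F0 oner_eq0.
have f0 : cabs f 0 = 1%:E by rewrite /cabs /f F0 cn1.
rewrite fE f0; apply: (@le_ratio 1) => //; first exact: powR_ge0.
apply: root_le => //; rewrite powR1; apply: le_trans h.
by apply: ler_wpM2l => //; exact: powR_ge0.
Qed.

Lemma lt_sharp_constant_at (p c : R) : 1 <= p -> 0 <= c ->
  (c%:E < sharp_constant_at (E11 `&` L_abs_weight p) (Lnorm_abs_weight p) idfun (0 : R))%E ->
  exists (g : C -> C) (I0 : R), [/\ exp_type_le1 g, 0 <= I0,
    (\int[mu]_t (cn (g t%:C%C) `^ p * `|t|)%:E <= I0%:E)%E & c `^ p * I0 < cn (g 0) `^ p].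
Proof.
move=> p1 c0 /ereal_sup_gt[_ [f [[[g hg <-] fL] _] <-]] h.
have p0 : p^-1 != 0 by rewrite invr_neq0// gt_eqF//; lra.
have fL' := lty_poweRy p0 fL.
have [w /andP[w0 _] wE] : exists2 w : R, 0 <= w <= fine (\int[mu]_t (cn (g t%:C%C) `^ p * `|t|)%:E) &
    (\int[mu]_t (cn (g t%:C%C) `^ p * `|t|)%:E)%E = w%:E.
  apply: weight_norm_fin; rewrite fineK// ge0_fin_numE//.
  by apply: integral_ge0 => t _; rewrite lee_fin mulr_ge0 ?powR_ge0.
exists g, w; split => //; first by rewrite wE.
rewrite ltNge; apply/negP => hw; move: h; rewrite ltNge => /negP; apply.
rewrite /Lnorm_abs_weight wE poweR_EFin; apply: ratio_le => //.
- by rewrite lee_fin cn_ge0.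
- exact: powR_ge0.
by rewrite lee_fin; apply: root_ge; rewrite ?cn_ge0.
Qed.

(** The even part keeps the value at 0 and costs only I0/2. The strict inequality pays for all
    multiplicative losses of [core_lower] and for its error terms when [n] is large. *)
Lemma lower_polynomials (p b I0 : R) (g : C -> C) : 1 <= p -> exp_type_le1 g -> 0 <= I0 ->
  (\int[mu]_t (cn (g t%:C%C) `^ p * `|t|)%:E <= I0%:E)%E ->
  b `^ p * (I0 / 2) < cn (g 0) `^ p ->
  exists N, forall n, (N <= n)%N -> exists P : {poly C}, [/\ (size P <= n.+1)%N, P.[1] != 0 &
    b `^ p * (n%:R ^+ 2 * Apoly p P) <= cn P.[1] `^ p].
Proof.
move=> p1 [eg gK] I00 hI hG; have p0 : 0 < p by lra.
pose f := even_part g.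
have f0 : f 0 = g 0 by rewrite /f /even_part oppr0; field.
have fe z : f (- z) = f z by rewrite /f /even_part opprK addrC.
have fK eps : 0 < eps -> exists C0 : R, forall z, cn (f z) <= C0 * expR ((1 + eps) * cn z).
  move=> /gK[C0 hC0]; exists C0 => z; rewrite /f /even_part cnM cnV cn_nat.
  have h1 := hC0 z; have h2 := hC0 (- z); rewrite cnN in h2.
  have := cnD (g z) (g (- z)); lra.
set G := cn (g 0) `^ p in hG; set J := b `^ p * (I0 / 2) in hG.
have b0 : 0 <= b `^ p by exact: powR_ge0.
have J0 : 0 <= J by rewrite mulr_ge0// divr_ge0.
have G0 : 0 < G by exact: le_lt_trans hG.
(* A factor strictly between J/G and 1, so that J/t still lies below G. *)
pose t := (1 + J / G) / 2.
have JG : 0 <= J / G < 1 by rewrite divr_ge0 ?(ltW G0)//= ltr_pdivrMr// mul1r.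
have t0 : 0 < t by rewrite /t; lra.
have t1 : t < 1 by rewrite /t; lra.
have tG : J / t < G.
  rewrite ltr_pdivrMr//; have -> : G * t = (G + J) / 2 by rewrite /t; field; rewrite gt_eqF.
  lra.
(* With kappa = l = s the losses s^-2 and s^(1-p) multiply to s^-(p+1) = 1/t. *)
pose s := t `^ (p + 1)^-1.
have s0 : 0 < s by exact: powR_gt0.
have st : s `^ (p + 1) = t by rewrite /s -powRrM mulVf ?powRr1 ?(ltW t0)// gt_eqF//; lra.
have s1 : s < 1.
  rewrite ltNge; apply/negP => s1; move: t1; rewrite -st ltNge => /negP; apply.
  rewrite -[leLHS](powRr0 s); apply: ler_powR => //; lra.
have s01 : 0 < s < 1 by rewrite s0.
have [D D0 hD] := core_lower p1 (entire_even_part eg) fe fK (even_part_weight p1 eg hI) s01 s01.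
have eps0 : 0 < (G - J / t) / 2 by rewrite divr_gt0// subr_gt0.
have [d d0 hd] := eps_continuous (continuous_powR p1) (cn (g 0)) eps0.
(* One half of the gap absorbs the error in the value at 1, the other the error in the integral. *)
set eps := (G - J / t) / 2 in eps0 hd.
pose E := b `^ p * s ^- 2 * D.
have E0 : 0 <= E by rewrite !mulr_ge0// invr_ge0 exprn_ge0// ltW.
exists (Num.bound (D / d + E / eps)).+1 => n nN.
have n0 : (0 < n)%N by exact: leq_trans nN.
have n0' : 0 < n%:R :> R by rewrite ltr0n.
have Dd : 0 <= D / d by rewrite divr_ge0// ltW.
have Ee : 0 <= E / eps by rewrite divr_ge0// ltW.
have nb : D / d + E / eps < n%:R.
  apply: (@lt_le_trans _ _ (Num.bound (D / d + E / eps))%:R).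
    by apply: archi_boundP; exact: addr_ge0.
  by rewrite ler_nat ltnW.
have hDn : D / n%:R < d by rewrite ltr_pdivrMr// mulrC -ltr_pdivrMr//; lra.
have hEn : E / n%:R <= eps by rewrite ler_pdivrMr// mulrC -ler_pdivrMr//; lra.
have [P [Pn P1 PA]] := hD n n0; exists P.
have hP : cn (P.[1] - g 0) < d.
  apply: le_lt_trans hDn; rewrite -f0; apply: le_trans P1 _.
  apply: ler_wpM2l => //; rewrite lef_pV2 ?posrE ?exprn_gt0//.
  by rewrite -{1}[n%:R]expr1; apply: ler_weXn2l => //; rewrite ler1n.
have PG : G - eps <= cn P.[1] `^ p.
  have := hd (cn P.[1] - cn (g 0)); rewrite (_ : cn (g 0) + (cn P.[1] - cn (g 0)) = cn P.[1]); last by ring.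
  rewrite !(ger0_norm (cn_ge0 _)) => h.
  have /h : `|cn P.[1] - cn (g 0)| < d by apply: le_lt_trans hP; exact: cn_dist.
  by rewrite -/G ler_norml lerBrDr addrC => /andP[].
have Jt : 0 <= J / t by rewrite divr_ge0// ltW.
have GE : 0 < G - eps by rewrite /eps; lra.
split => //.
  apply/eqP => P10; move: (lt_le_trans GE PG).
  by rewrite P10 cn0 powR0 ?ltxx// gt_eqF.
apply: le_trans PG.
have s2 : 0 < s ^+ 2 by rewrite exprn_gt0.
have -> : b `^ p * (n%:R ^+ 2 * Apoly p P) = b `^ p * s ^- 2 * ((s * n%:R) ^+ 2 * Apoly p P).
  by field; rewrite gt_eqF.
apply: le_trans (ler_wpM2l _ PA) _; first by rewrite mulr_ge0// invr_ge0 ltW.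
have sE : s ^- 2 * s `^ (1 - p) = t^-1.
  rewrite -st -powRN -powR_mulrn ?(ltW s0)// -powRN -powRD; last by rewrite (gt_eqF s0) implybT.
  by congr (_ `^ _); ring.
have -> : b `^ p * s ^- 2 * (s `^ (1 - p) * (I0 / 2) + D / n%:R) =
   (s ^- 2 * s `^ (1 - p)) * J + E / n%:R by rewrite /J /E; ring.
rewrite sE [t^-1 * J]mulrC; apply: le_trans (lerD (lexx _) hEn) _.
by rewrite /eps; lra.
Qed.

(** Testing against reals treats finite and infinite limits alike; nonnegativity excludes -oo. *)
Lemma ereal_cvg_sandwich (u : nat -> \bar R) (l : \bar R) : (0 <= l)%E ->
  (forall b : R, (b%:E < l)%E -> exists N, forall n, (N <= n)%N -> (b%:E <= u n)%E) ->
  (forall b : R, (l < b%:E)%E -> exists N, forall n, (N <= n)%N -> (u n <= b%:E)%E) ->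
  u @ \oo --> l.
Proof.
case: l => [l| |] // l0 hl hu; last first.
  apply/cvgeyPge => A; have [N hN] := hl A (ltry A).
  by exists N => // n /= Nn; exact: hN.
have H (e : R) : 0 < e -> exists N, forall n, (N <= n)%N -> ((l - e)%:E <= u n <= (l + e)%:E)%E.
  move=> e0; have [|N1 h1] := hl (l - e); first by rewrite lte_fin ltrBlDr ltrDl.
  have [|N2 h2] := hu (l + e); first by rewrite lte_fin ltrDl.
  exists (maxn N1 N2) => n; rewrite geq_max => /andP[n1 n2].
  by rewrite h1// h2.
apply/fine_cvgP; split.
  have [N hN] := H 1 ltr01; exists N => // n /= /hN /andP[a b].
  by rewrite fin_numElt (lt_le_trans _ a) ?ltNyr// (le_lt_trans b) ?ltry.
apply/cvgrPdist_le => e e0; have [N hN] := H e e0; exists N => // n /= /hN.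
case: (u n) => [v| |]//; rewrite ?lee_fin => /andP[a b]//=.
by rewrite ler_norml; apply/andP; split; lra.
Qed.

End SharpConstants.

Theorem corollary4p6 (R : realType) (p : R) (hp : 1 <= p) :
  ((fun n : nat =>
      ((n%:R : R) `^ (- (2 / p)))%:E *
      sharp_constant (measurable_itv `[-1, 1]%R) (@polys_on_itvN11 R n)
        (Lnorm_on (measurable_itv `[-1, 1]%R) p%:E) idfun)%E
     : nat -> \bar R) @ \oo -->
  ((2 `^ p^-1)%:E *
   sharp_constant_at (E11 `&` L_abs_weight p) (Lnorm_abs_weight p) idfun 0)%E.
Proof.
have p0 : 0 < p by lra.
set S := sharp_constant_at _ _ _ _.
pose r : R := 2 `^ p^-1; rewrite -/r.
have r0 : 0 < r by exact: powR_gt0.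
have rp : r `^ p = 2 by rewrite /r -powRrM mulVf ?gt_eqF// powRr1.
(* A nonzero competitor is required here: the supremum of an empty set would be -oo. *)
have S0 : (0 <= S)%E.
  have [F [I0 [hF F0 Fe hI]]] := nontrivial_extremal hp.
  apply: (sharp_constant_at_ge hp (lexx 0) hF F0 Fe hI).
  by rewrite powR0 ?gt_eqF// mul0r.
have divp (b : R) : 0 <= b -> (b / r) `^ p = b `^ p / 2.
  move=> b0; have <- : (b / r) `^ p * 2 = b `^ p.
    by rewrite -rp -powRM ?divfK ?gt_eqF ?divr_ge0 ?(ltW r0).
  by rewrite mulfK.
have scale (b : R) (n : nat) (T : \bar R) : (0 < n)%N ->
    ((b * n%:R `^ (2 / p))%:E <= T)%E = (b%:E <= (n%:R `^ (- (2 / p)))%:E * T)%E.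
  move=> n0; have q0 : 0 < n%:R `^ (2 / p) :> R by rewrite powR_gt0// ltr0n.
  by rewrite powRN lee_pdivlMl// -EFinM mulrC.
have npow (b : R) (n : nat) : 0 <= b -> (b * n%:R `^ (2 / p)) `^ p = b `^ p * n%:R ^+ 2.
  move=> b0; rewrite powRM ?powR_ge0// -powRrM divfK ?gt_eqF//.
  by rewrite powR_mulrn.
apply: ereal_cvg_sandwich; first by rewrite mule_ge0// lee_fin ltW.
- move=> b hb; have [b0|b0] := ltP b 0.
    (* For b < 0 the constant polynomial 1 shows that the sharp constant is nonnegative. The index
       starts at 1 because [scale] requires n > 0. *)
    exists 1%N => n n0; rewrite -scale//.
    apply: (@le_trans _ _ 0%E).
      by rewrite lee_fin mulr_le0_ge0 ?powR_ge0// ltW.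
    apply: (@sharp_constant_ge _ _ 0 _ 1) => //.
    + by rewrite size_poly1.
    + by rewrite hornerC oner_neq0.
    by rewrite powR0 ?gt_eqF// mul0r powR_ge0.
  have hb' : ((b / r)%:E < S)%E by rewrite mulrC EFinM lte_pdivrMl.
  have br0 : 0 <= b / r by rewrite divr_ge0// ltW.
  have [g [I0 [hg I00 hI hG]]] := lt_sharp_constant_at hp br0 hb'.
  have [|N hN] := @lower_polynomials _ p b I0 g hp hg I00 hI.
    by move: hG; rewrite divp// -mulrA [2^-1 * _]mulrC.
  exists N.+1 => n nN; have n0 : (0 < n)%N by exact: leq_trans nN.
  have [P [Pn P1 PA]] := hN n (ltnW nN).
  rewrite -scale//; apply: (sharp_constant_ge hp _ Pn P1).
    by rewrite mulr_ge0 ?powR_ge0.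
  by rewrite npow// -mulrA.
- move=> b hb; apply: contrapT => hN.
  have b0 : 0 < b.
    by rewrite -lte_fin; apply: le_lt_trans hb; rewrite mule_ge0// lee_fin ltW.
  have B0 : 0 < b `^ p by exact: powR_gt0.
  (* If the bound by [b] fails beyond every index, polynomials of arbitrarily large degree violate
     it, and their limit [F] has half-line integral at most b^-p. *)
  have [N|F [hF F0 Fe hI]] := core_upper hp B0.
    apply: contrapT => hc; apply: hN; exists N.+1 => n nN.
    have n0 : (0 < n)%N by exact: leq_trans nN.
    rewrite leNgt; apply/negP => hlt; apply: hc.
    have bn0 : 0 <= b * n%:R `^ (2 / p) by rewrite mulr_ge0 ?powR_ge0// ltW.
    have /(lt_sharp_constant hp bn0)[q [x [qn hx hq]]] : ((b * n%:R `^ (2 / p))%:E <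
        sharp_constant (measurable_itv `[-1, 1]%R) (@polys_on_itvN11 R n)
        (Lnorm_on (measurable_itv `[-1, 1]%R) p%:E) idfun)%E.
      have q0 : 0 < n%:R `^ (2 / p) :> R by rewrite powR_gt0// ltr0n.
      by move: hlt; rewrite powRN lte_pdivlMl// -EFinM mulrC.
    exists n, q, x; split => //; first exact: ltnW.
    by move: hq; rewrite npow ?(ltW b0)// -mulrA.
  have br0 : 0 <= b / r by rewrite divr_ge0 ?ltW.
  move: hb; rewrite ltNge => /negP; apply.
  rewrite -lee_pdivrMl// -EFinM mulrC.
  apply: (sharp_constant_at_ge hp br0 hF F0 Fe hI).
  (* The 2 from the two half-lines cancels r^p = 2, so the required inequality is an equality. *)
  rewrite divp ?(ltW b0)// le_eqVlt; apply/orP; left; apply/eqP.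
  by field; rewrite gt_eqF.
Qed.
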